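(* Let $\mathbf A_n=\mathbf U_n\mathbf T_n\mathbf V_n$ be the isotropic random matrices and $\mathbf P_n$ the bounded finite rank perturbations described in the context, and let $\varepsilon>0$ be fixed. Suppose that for all sufficiently large $n$, $\mathbf P_n$ has no eigenvalue in the band $\{z\in\mathbb C : b+\varepsilon<|z|<b+3\varepsilon\}$ and has $r_b$ eigenvalues, counted with multiplicity, $\lambda_1(\mathbf P_n),\ldots,\lambda_{r_b}(\mathbf P_n)$ with modulus at least $b+3\varepsilon$ (the integer $r_b$ and the numbers $\lambda_i(\mathbf P_n)$ may depend on $n$ and be random). Then, with probability tending to one as $n\to\infty$, $\mathbf A_n+\mathbf P_n$ has exactly $r_b$ eigenvalues (counted with multiplicity) with modulus higher than $b+2\varepsilon$. Furthermore, after a proper labeling $\lambda_1(\mathbf A_n+\mathbf P_n),\ldots,\lambda_{r_b}(\mathbf A_n+\mathbf P_n)$ of these eigenvalues, $$\forall i\in\{1,\ldots,r_b\},\qquad \lambda_i(\mathbf A_n+\mathbf P_n)-\lambda_i(\mathbf P_n)\longrightarrow 0\quad\text{in probability.}$$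
   Context: For each $n\ge1$, $\mathbf A_n=\mathbf U_n\mathbf T_n\mathbf V_n$ is an $n\times n$ random matrix, where $\mathbf T_n=\operatorname{diag}(s_1,\ldots,s_n)$ with non-negative numbers $s_i$ (depending implicitly on $n$, possibly random), and $\mathbf U_n,\mathbf V_n$ are independent Haar-distributed unitary $n\times n$ matrices, independent of $\mathbf T_n$. $\|\cdot\|_{\mathrm{op}}$ is the operator norm. Standing hypotheses: (1) there is a deterministic $b\ge0$ such that $\frac1n\operatorname{Tr}(\mathbf T_n^2)\to b^2$ in probability as $n\to\infty$; (2) there is $M>0$ such that $\mathbb P(\|\mathbf T_n\|_{\mathrm{op}}>M)\to0$; (3) there is a constant $\kappa>0$ such that for all $n$ and all $z\in\mathbb C$, $\operatorname{Im}(z)>n^{-\kappa}$ implies $|\operatorname{Im}(G_{\mu_{\mathbf T_n}}(z))|\le\frac1\kappa$, where $\mu_{\mathbf T_n}$ is the empirical spectral distribution of $\mathbf T_n$ and $G_\mu(z)=\int\frac{\mu(dx)}{z-x}$ is the Stieltjes transform. $(\mathbf P_n)$ is a sequence of $n\times n$ complex matrices (possibly random, but independent of $\mathbf U_n,\mathbf T_n,\mathbf V_n$) with rank at most a fixed integer $r$ and with $\|\mathbf P_n\|_{\mathrm{op}}$ bounded by a constant independent of $n$. The multiplicity of an eigenvalue is its order as a root of the characteristic polynomial. *)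

(* Defs.v *)
From HB Require Import structures.
From mathcomp Require Import all_boot all_order all_algebra.
From mathcomp Require Import all_classical all_reals all_analysis.
From mathcomp Require Export complex.
Set Implicit Arguments.
Unset Strict Implicit.
Unset Printing Implicit Defensive.
Import Order.TTheory GRing.Theory Num.Theory.
Import numFieldNormedType.Exports.
Export Normc.
Local Open Scope classical_set_scope.
Local Open Scope ring_scope.
Local Open Scope complex_scope.

HB.instance Definition _ (R : realType) := isPointed.Build R[i] 0.

(* The Borel sigma-algebra of the complex n x n matrices: the one generated by
   the real and imaginary parts of the entries. *)
Definition mx_coord_sets (R : realType) n : set (set 'M[R[i]]_n) :=
  [set E | exists (i j : 'I_n) (B : set R), measurable B /\
     (E = [set A : 'M[R[i]]_n | B (complex.Re (A i j))] \/
      E = [set A : 'M[R[i]]_n | B (complex.Im (A i j))])].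

Notation cmx R n := (g_sigma_algebraType (@mx_coord_sets R n)).

Definition l2norm (R : realType) n (x : 'cV[R[i]]_n) : R :=
  Num.sqrt (\sum_(i < n) normc (x i 0) ^+ 2).

Definition opnorm (R : realType) n (A : 'M[R[i]]_n) : R :=
  sup [set l2norm (A *m x) | x in [set x : 'cV[R[i]]_n | l2norm x <= 1]].

(* Independence of two random elements. For three or more, pair them up: the
   sigma-algebra of a product type is the product sigma-algebra. *)
Definition independent_rv (R : realType) d d1 d2 (Omega : measurableType d)
    (T1 : measurableType d1) (T2 : measurableType d2) (P : probability Omega R)
    (X : Omega -> T1) (Y : Omega -> T2) : Prop :=
  forall (A : set T1) (B : set T2), measurable A -> measurable B ->
    P (X @^-1` A `&` Y @^-1` B) = (P (X @^-1` A) * P (Y @^-1` B))%E.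

(* The law of U is the Haar probability measure of the unitary group, i.e. the
   probability measure carried by it and invariant under translations. *)
Definition haar_unitary (R : realType) d (Omega : measurableType d)
    (P : probability Omega R) n (U : Omega -> cmx R n) : Prop :=
  [/\ measurable_fun setT U,
      {ae P, forall w, (U w : 'M[R[i]]_n) \is unitarymx},
      forall W : 'M[R[i]]_n, W \is unitarymx ->
        forall B : set (cmx R n), measurable B ->
        P [set w | B (W *m U w)] = P [set w | B (U w)] &
      forall W : 'M[R[i]]_n, W \is unitarymx ->
        forall B : set (cmx R n), measurable B ->
        P [set w | B (U w *m W)] = P [set w | B (U w)]].

(* mu_ext (P n) is the outer probability: it agrees with P n on measurable sets
   and makes the two notions below meaningful for arbitrary families of events
   and functions. The probability space may change with n. *)
Definition with_high_probability (R : realType) (d : nat -> measure_display)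
    (Omega : forall n, measurableType (d n))
    (P : forall n, probability (Omega n) R)
    (E : forall n, set (Omega n)) : Prop :=
  (fun n => mu_ext (P n) (~` E n)) @ \oo --> 0%E.

Definition cvg_in_probability (R : realType) (d : nat -> measure_display)
    (Omega : forall n, measurableType (d n))
    (P : forall n, probability (Omega n) R)
    (X : forall n, Omega n -> R[i]) (l : R[i]) : Prop :=
  forall delta : R, 0 < delta ->
    (fun n => mu_ext (P n) [set w | delta <= normc (X n w - l)]) @ \oo --> 0%E.

(* The empirical spectral distribution of diag(x 0, ..., x n.-1). *)
Definition esd_diag (R : realType) n (x : nat -> R) :
    {measure set R -> \bar R} :=
  mscale (n%:R^-1)%:nng (msum (fun i => \d_(x i)) n).

Definition stieltjes (R : realType)
    (mu : {measure set R -> \bar R}) (z : R[i]) : R[i] :=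
  (\int[mu]_(x in setT) complex.Re ((z - x%:C)^-1))%R +i*
  (\int[mu]_(x in setT) complex.Im ((z - x%:C)^-1))%R.

(* l enumerates the eigenvalues of A lying in S, each one repeated as many times
   as its order as a root of the characteristic polynomial. *)
Definition lists_eigenvalues (R : realType) n (A : 'M[R[i]]_n)
    (S : pred R[i]) (l : seq R[i]) : Prop :=
  forall z : R[i],
    count_mem z l = if S z then mup z (char_poly A) else 0%N.

Definition has_nb_eigenvalues (R : realType) n (A : 'M[R[i]]_n)
    (S : pred R[i]) (k : nat) : Prop :=
  exists l : seq R[i], lists_eigenvalues A S l /\ size l = k.

(* Main.v *)
(* Write A = U S with S = T V and factor P = X Y with r columns in X. For
   |z| >= b + eps the ratio det (z - A - P) / det (z - A) is the r x r determinant
   det (1 - Y (z - A)^-1 X), which is close to det (1 - z^-1 Y X) as soon as the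
   entries of Y A^k X (k >= 1) are small compared with (b + eps / 2)^k; a Rouche
   argument then matches the outliers of A + P with those of P. The smallness is
   proved for k up to K = O(log n), beyond which the mere size of A^K suffices.
   Follow the orbit x, A x, ..., A^K x while revealing U one column at a time: up to
   a rotation, the next vector is S applied to a Haar vector of a subspace of
   codimension at most K, so by second moments it is nearly orthogonal to what came
   before and its squared norm is about Tr (T^2) / n = b^2. *)
From HB Require Import structures.
Require Import Defs.
From mathcomp Require Import all_boot all_order all_algebra.
From mathcomp Require Import all_classical all_reals all_analysis.
From mathcomp Require Import measurable_realfun perm ring lra zify.
Set Implicit Arguments.
Unset Strict Implicit.
Unset Printing Implicit Defensive.
Import Order.TTheory GRing.Theory Num.Theory.
Import numFieldNormedType.Exports.
Local Open Scope classical_set_scope.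
Local Open Scope ring_scope.
Local Open Scope complex_scope.

(** * Counting zeros by averages over roots of unity *)

(** For one starting vector, second moments only give a failure probability of order [K ^ 4 / n].
    This affords the [p ^ 2] pairs of a row of [Y] and a column of [X], but not a union over the [n]
    basis vectors, which a bound on all entries of the powers of [A] seems to require. There the
    orbits start from sign vectors instead: one large entry spoils at least half of them, and an
    average over signs replaces the union. The second moment of [nsq (S *m u)] for a Haar unit
    vector [u] comes without integration formulas: all unit vectors of the free subspace have the
    same law, so a pointwise inequality over polarization vectors can be averaged, and the unknown
    moment then stands on both sides with different coefficients. The eigenvalues of [P] move with
    [n] and may coalesce, so no fixed radius isolates them. They are grouped into clusters at a
    scale chosen among finitely many, which keeps the tolerance on the determinants independent of
    [n]. *)

Lemma prod_unity_roots (F : fieldType) (N : nat) (l : seq F) (r a : F) :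
  r != 0 -> size l = N -> 'X^N - 1 = \prod_(w <- l) ('X - w%:P) ->
  \prod_(w <- l) (r * w - a) = (-1) ^+ N * (a ^+ N - r ^+ N).
Proof.
move=> r0 sl lE.
have -> : \prod_(w <- l) (r * w - a) = \prod_(w <- l) (- r * (a / r - w)).
  by apply: eq_bigr => w _; rewrite mulrBr mulrCA mulNr divff// mulrN1 mulNr opprK addrC.
rewrite big_split/= big_const_seq count_predT sl iter_mulr_1.
have -> : \prod_(w <- l) (a / r - w) = (a / r) ^+ N - 1.
  have := congr1 (fun p : {poly F} => p.[a / r]) lE.
  rewrite /= horner_prod hornerD hornerXn hornerN hornerC => ->.
  by apply: eq_bigr => w _; rewrite hornerXsubC.
have -> : a ^+ N - r ^+ N = r ^+ N * ((a / r) ^+ N - 1).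
  by rewrite mulrBr mulr1 -exprMn mulrCA divff// mulr1.
by rewrite [(- r) ^+ N]exprNn mulrA.
Qed.

Section Rouche.
Variable R : realType.
Local Notation C := R[i].
Implicit Types (a z c : C) (s t : seq C).

Lemma normc_ge0 z : 0 <= normc z.
Proof. by case: z => x y; rewrite /normc sqrtr_ge0. Qed.

Lemma normc_eq0 z : (normc z == 0) = (z == 0).
Proof. by apply/eqP/eqP => [/eq0_normc//|->]; rewrite normc0. Qed.

Lemma normc_gt0 z : (0 < normc z) = (z != 0).
Proof. by rewrite lt_def normc_ge0 andbT normc_eq0. Qed.

Lemma normcX z n : normc (z ^+ n) = normc z ^+ n.
Proof.
elim: n => [|n IH]; first by rewrite !expr0 normc1.
by rewrite !exprS normcM IH.
Qed.

Lemma normc_real (x : R) : normc x%:C = `|x|.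
Proof. by rewrite /normc /= expr0n addr0 sqrtr_sqr. Qed.

Lemma normc_sub z w : normc (z - w) = normc (w - z).
Proof. by rewrite -normcN opprB. Qed.

Lemma normc_prod (I : Type) (r : seq I) (P : pred I) (f : I -> C) :
  normc (\prod_(i <- r | P i) f i) = \prod_(i <- r | P i) normc (f i).
Proof. exact: (big_morph _ (@normcM R) (normc1 R)). Qed.

Lemma normc_sum (I : Type) (r : seq I) (P : pred I) (f : I -> C) :
  normc (\sum_(i <- r | P i) f i) <= \sum_(i <- r | P i) normc (f i).
Proof.
elim/big_rec2: _ => [|i y x _ le]; first by rewrite normc0.
by apply: le_trans (le_normcD _ _) _; rewrite lerD2l.
Qed.

Lemma normc_dist z w : normc z - normc w <= normc (z - w).
Proof. by rewrite lerBlDr -{1}(subrK w z); exact: le_normcD. Qed.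

Lemma unity_roots (N : nat) : (0 < N)%N ->
  exists l : seq C, [/\ size l = N, forall w, w \in l -> normc w = 1 &
    'X^N - 1 = \prod_(w <- l) ('X - w%:P)].
Proof.
move=> N0; have [l lE] := closed_field_poly_normal ('X^N - 1 : {poly C}).
have lc : lead_coef ('X^N - 1 : {poly C}) = 1.
  by rewrite -polyC1 lead_coefXnsubC.
rewrite lc scale1r in lE.
have sz : size l = N.
  by apply: succn_inj; rewrite -(size_prod_XsubC l id) -lE -polyC1 size_XnsubC.
exists l; split=> // w wl.
have : root ('X^N - 1) w by rewrite lE root_prod_XsubC.
rewrite rootE !hornerE subr_eq0 => /eqP wN.
have : normc w ^+ N = 1 by rewrite -normcX wN normc1.
by move/eqP; rewrite pexpr_eq1 ?normc_ge0// => /eqP.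
Qed.

Lemma circle_prod (N : nat) (l : seq C) (a : C) (r : R) : 0 < r ->
  size l = N -> 'X^N - 1 = \prod_(w <- l) ('X - w%:P) ->
  \prod_(w <- l) normc (r%:C * w - a) = normc ((r ^+ N)%:C - a ^+ N).
Proof.
move=> r0 sl lE; 
have rC0 : r%:C != 0 :> C by rewrite (inj_eq (@complexI R)) gt_eqF.
rewrite -normc_prod (prod_unity_roots _ rC0 sl lE) normcM normcX normcN normc1.
by rewrite expr1n mul1r normc_sub (rmorphXn (real_complex R)).
Qed.

Lemma geom_small (q e : R) : 0 <= q < 1 -> 0 < e ->
  exists N0, forall N, (N0 <= N)%N -> q ^+ N <= e.
Proof.
move=> /andP[q0 q1] e0.
have : (fun n => q ^+ n) @ \oo --> 0 by apply: cvg_expr; rewrite ger0_norm.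
move/cvgrPdist_le => /(_ _ e0) [N0 _ H]; exists N0 => N NN.
have := H N NN; rewrite sub0r normrN; apply: le_trans; exact: ler_norm.
Qed.

(** By [circle_prod] this is the product of [normc (z - a)] over the [N] points [z = c + r w] with
    [w ^ N = 1]. As in Jensen's formula, it behaves like the [N]-th power of the larger of [r] and
    [normc (a - c)]. *)
Definition circ_fac (N : nat) c a (r : R) := normc ((r ^+ N)%:C - (a - c) ^+ N).

Lemma circ_fac_in N c a r : 0 < r -> (normc (a - c) / r) ^+ N <= 2^-1 ->
  r ^+ N / 2 <= circ_fac N c a r <= 2 * r ^+ N.
Proof.
move=> r0; rewrite expr_div_n ler_pdivrMr ?exprn_gt0// => h.
have rN : 0 < r ^+ N by rewrite exprn_gt0.
have nrN : normc (r ^+ N)%:C = r ^+ N by rewrite normc_real gtr0_norm.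
apply/andP; split.
  apply: le_trans (normc_dist _ _); rewrite nrN normcX; lra.
apply: le_trans (le_normcD _ _) _; rewrite normcN nrN normcX; lra.
Qed.

Lemma circ_fac_out N c a r : 0 < r < normc (a - c) ->
  (r / normc (a - c)) ^+ N <= 2^-1 ->
  normc (a - c) ^+ N / 2 <= circ_fac N c a r <= 2 * normc (a - c) ^+ N.
Proof.
move=> /andP[r0 ra]; have a0 := lt_trans r0 ra.
rewrite expr_div_n ler_pdivrMr ?exprn_gt0// => h.
have rN : 0 < normc (a - c) ^+ N by rewrite exprn_gt0.
have r'N : 0 < r ^+ N by rewrite exprn_gt0.
have nrN : normc (r ^+ N)%:C = r ^+ N by rewrite normc_real gtr0_norm.
apply/andP; split.
  rewrite /circ_fac (normc_sub (r ^+ N)%:C).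
  apply: le_trans (normc_dist _ _); rewrite nrN normcX; lra.
apply: le_trans (le_normcD _ _) _; rewrite normcN nrN normcX; lra.
Qed.

Section TwoCircles.
Variables (c : C) (r1 r2 : R).
Hypotheses (r1_gt0 : 0 < r1) (r12 : r1 < r2).

Let inside a := normc (a - c) < r1.

(** Only a point inside both circles feels the change of radius, by a factor [(r2 / r1) ^ N], hence
    the boolean [inside a] as an exponent. For large [N] each of the two factors is known up to [2],
    which makes [4] for their ratio. *)
Lemma circ_fac_ratio a : (normc (a - c) < r1) || (r2 < normc (a - c)) ->
  exists N0, forall N, (N0 <= N)%N ->
   [/\ 0 < circ_fac N c a r1,
    ((r2 / r1) ^+ N) ^+ inside a * circ_fac N c a r1 <= 4 * circ_fac N c a r2 &
    circ_fac N c a r2 <= 4 * (((r2 / r1) ^+ N) ^+ inside a * circ_fac N c a r1)].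
Proof.
have r2_gt0 := lt_trans r1_gt0 r12; have half_gt0 : 0 < 2^-1 :> R by [].
rewrite /inside; case: ltP => [ain _|_ /= aout].
  have q01 : 0 <= normc (a - c) / r1 < 1.
    by rewrite divr_ge0 ?normc_ge0 ?ltW//= ltr_pdivrMr// mul1r.
  have [N0 HN0] := geom_small q01 half_gt0.
  exists N0 => N /HN0 h1; rewrite expr1.
  have h2 : (normc (a - c) / r2) ^+ N <= 2^-1.
    apply: le_trans h1; apply: lerXn2r; rewrite ?nnegrE ?divr_ge0 ?normc_ge0 ?(ltW r1_gt0) ?(ltW r2_gt0)//.
    by rewrite ler_wpM2l ?normc_ge0// lef_pV2 ?posrE// ltW.
  have /andP[l1 u1] := circ_fac_in r1_gt0 h1.
  have /andP[l2 u2] := circ_fac_in r2_gt0 h2.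
  have p1 : 0 < r1 ^+ N by rewrite exprn_gt0.
  have p2 : 0 < r2 ^+ N by rewrite exprn_gt0.
  have e1 : (r2 / r1) ^+ N * r1 ^+ N = r2 ^+ N.
    by rewrite expr_div_n divfK// gt_eqF.
  have q0 : 0 < (r2 / r1) ^+ N by rewrite exprn_gt0 ?divr_gt0.
  split; first by lra.
    have := ler_wpM2l (ltW q0) u1; lra.
  have := ler_wpM2l (ltW q0) l1; lra.
have a0 := lt_trans r2_gt0 aout.
have q01 : 0 <= r2 / normc (a - c) < 1.
  by rewrite divr_ge0 ?normc_ge0 ?ltW//= ltr_pdivrMr// mul1r.
have [N0 HN0] := geom_small q01 half_gt0.
exists N0 => N /HN0 h2; rewrite expr0 !mul1r.
have h1 : (r1 / normc (a - c)) ^+ N <= 2^-1.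
  apply: le_trans h2; apply: lerXn2r; rewrite ?nnegrE ?divr_ge0 ?normc_ge0 ?(ltW r1_gt0) ?(ltW r2_gt0)//.
  by rewrite ler_pM2r ?invr_gt0 // ltW.
have ra1 : 0 < r1 < normc (a - c) by rewrite r1_gt0 (lt_trans r12).
have ra2 : 0 < r2 < normc (a - c) by rewrite r2_gt0.
have /andP[l1 u1] := circ_fac_out ra1 h1.
have /andP[l2 u2] := circ_fac_out ra2 h2.
have p1 : 0 < normc (a - c) ^+ N by rewrite exprn_gt0.
by split; lra.
Qed.

Lemma circ_prod_ratio s :
  (forall a, a \in s -> (normc (a - c) < r1) || (r2 < normc (a - c))) ->
  exists N0, forall N, (N0 <= N)%N ->
   [/\ 0 < \prod_(a <- s) circ_fac N c a r1,
    ((r2 / r1) ^+ N) ^+ count inside s * \prod_(a <- s) circ_fac N c a r1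
      <= 4 ^+ size s * \prod_(a <- s) circ_fac N c a r2 &
    \prod_(a <- s) circ_fac N c a r2 <= 4 ^+ size s *
      (((r2 / r1) ^+ N) ^+ count inside s * \prod_(a <- s) circ_fac N c a r1)].
Proof.
elim: s => [_|a s IH sP].
  by exists 0%N => N _; rewrite !big_nil /= !expr0; split; lra.
have [|N1 H1] := IH; first by move=> x xs; apply: sP; rewrite inE xs orbT.
have [|N2 H2] := @circ_fac_ratio a; first by apply: sP; rewrite mem_head.
exists (maxn N1 N2) => N; rewrite geq_max => /andP[/H1[p1 l1 u1] /H2[p2 l2 u2]].
have q0 : 0 < (r2 / r1) ^+ N.
  by rewrite exprn_gt0 ?divr_gt0 ?(lt_trans r1_gt0 r12).
rewrite !big_cons /= exprD exprS; split; first by rewrite mulr_gt0.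
  rewrite mulrACA (mulrACA 4); apply: ler_pM => //.
    by apply: mulr_ge0; [exact/exprn_ge0/ltW | exact: ltW].
  by apply: mulr_ge0; [exact/exprn_ge0/ltW | exact: ltW].
rewrite (mulrACA ((r2 / r1) ^+ N ^+ _)) (mulrACA 4); apply: ler_pM => //.
  exact: normc_ge0.
by apply: prodr_ge0 => ? _; exact: normc_ge0.
Qed.

(** The pointwise bound is multiplied over the [N] sample points of the circle. The loss is
    [dl ^ N], to be weighed against the gain [(r2 / r1) ^ N] of one zero. *)
Lemma circle_mean s t (r dl : R) (N : nat) : 0 < r -> (0 < N)%N -> 0 <= dl ->
  (forall z, normc (z - c) = r ->
    normc (\prod_(a <- s) (z - a)) <= dl * normc (\prod_(b <- t) (z - b))) ->
  \prod_(a <- s) circ_fac N c a r <= dl ^+ N * \prod_(b <- t) circ_fac N c b r.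
Proof.
move=> r0 N0 dl0 h; have [l [sl l1 lE]] := unity_roots N0.
have E u : \prod_(a <- u) circ_fac N c a r =
    \prod_(w <- l) normc (\prod_(a <- u) (r%:C * w + c - a)).
  under [RHS]eq_bigr do rewrite normc_prod.
  rewrite exchange_big /=; apply: eq_bigr => a _.
  rewrite /circ_fac -(circle_prod _ r0 sl lE); apply: eq_bigr => w _.
  by rewrite opprB addrCA addrA (addrC c).
have -> : dl ^+ N = \prod_(w <- l) dl.
  by rewrite big_const_seq count_predT sl iter_mulr_1.
rewrite !E -big_split /= !big_seq; apply: ler_prod => w wl.
rewrite normc_ge0 /=; apply: h.
by rewrite addrK normcM (l1 w)// mulr1 normc_real gtr0_norm.
Qed.

(* Averaging over N-th roots of unity on two concentric circles compares the
   numbers of zeros: the ratio of the two averages of f is about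
   (r2 / r1) ^ (N * number of zeros of f in the small disc). *)
Lemma rouche_le s t (dl : R) :
  1 <= dl -> dl ^+ 2 < r2 / r1 ->
  (forall a, a \in s -> (normc (a - c) < r1) || (r2 < normc (a - c))) ->
  (forall a, a \in t -> (normc (a - c) < r1) || (r2 < normc (a - c))) ->
  (forall z, normc (z - c) = r2 ->
    normc (\prod_(a <- s) (z - a)) <= dl * normc (\prod_(b <- t) (z - b))) ->
  (forall z, normc (z - c) = r1 ->
    normc (\prod_(a <- t) (z - a)) <= dl * normc (\prod_(b <- s) (z - b))) ->
  (count inside s <= count inside t)%N.
Proof.
move=> dl1 dlr sP tP h2 h1; have r2_gt0 := lt_trans r1_gt0 r12.
have dl0 : 0 <= dl by lra.
have [N1 H1] := circ_prod_ratio sP; have [N2 H2] := circ_prod_ratio tP.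
rewrite leqNgt; apply/negP => ts.
have q1 : 0 < r2 / r1 by rewrite divr_gt0.
pose D : R := 4 ^+ size s * 4 ^+ size t.
have D0 : 0 < D by rewrite mulr_gt0 ?exprn_gt0.
have q01 : 0 <= dl ^+ 2 / (r2 / r1) < 1.
  by rewrite divr_ge0 ?exprn_ge0 ?(ltW q1)//= ltr_pdivrMr// mul1r.
have D20 : 0 < (2 * D)^-1 by rewrite invr_gt0 mulr_gt0.
have [N3 H3] := geom_small q01 D20.
pose N := (N1 + N2 + N3).+1.
have [p1 l1 u1] : _ := H1 N (leqW (leq_trans (leq_addr N2 N1) (leq_addr N3 _))).
have [p2 l2 u2] : _ := H2 N (leqW (leq_trans (leq_addl N1 N2) (leq_addr N3 _))).
have {}H3 : _ := H3 N (leqW (leq_addl (N1 + N2) N3)).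
have m2 := circle_mean (N := N) r2_gt0 isT dl0 h2.
have m1 := circle_mean (N := N) r1_gt0 isT dl0 h1.
set x := (r2 / r1) ^+ N in l1 u1 l2 u2 H3.
have x1 : 1 <= x by rewrite exprn_ege1// ler_pdivlMr// mul1r ltW.
have x0 : 0 < x by lra.
set p := count inside s in ts l1 u1; set q := count inside t in ts l2 u2.
set F1 := \prod_(a <- s) circ_fac N c a r1 in p1 l1 u1 m1.
set F2 := \prod_(a <- s) circ_fac N c a r2 in l1 u1 m2.
set G1 := \prod_(a <- t) circ_fac N c a r1 in p2 l2 u2 m1.
set G2 := \prod_(a <- t) circ_fac N c a r2 in l2 u2 m2.
have dN0 : 0 <= dl ^+ N by rewrite exprn_ge0.
have xp : x * x ^+ q <= x ^+ p by rewrite -exprS; exact: ler_weXn2l.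
have xq : 0 < x ^+ q by rewrite exprn_gt0.
(* An extra zero of [s] inside would gain a factor [x], whereas passing from [s] to [t] on the outer
   circle and back on the inner one costs [dl ^ N] twice, up to the constant [D]. *)
have key : x * x ^+ q * F1 <= D * ((dl ^+ 2) ^+ N) * (x ^+ q * F1).
  apply: le_trans (ler_wpM2r (ltW p1) xp) _.
  apply: le_trans l1 _.
  apply: le_trans (ler_wpM2l _ m2) _; first by rewrite exprn_ge0.
  have : dl ^+ N * G2 <= dl ^+ N * (4 ^+ size t * (x ^+ q * (dl ^+ N * F1))).
    apply: ler_wpM2l => //; apply: le_trans u2 _.
    apply: ler_wpM2l; first by rewrite exprn_ge0.
    by apply: ler_wpM2l => //; exact: ltW.
  have s4 : 0 <= 4 ^+ size s :> R by rewrite exprn_ge0.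
  move/(ler_wpM2l s4).
  move/le_trans; apply; rewrite /D -exprM mulnC exprM expr2.
  rewrite le_eqVlt; apply/orP; left; apply/eqP.
  ring.
rewrite -mulrA ler_pM2r ?mulr_gt0// in key.
move: H3; rewrite expr_div_n -/x ler_pdivrMr// ler_pdivlMl ?mulr_gt0//.
move=> H3.
have : x <= x / 2 by apply: le_trans key _; lra.
lra.
Qed.

End TwoCircles.

End Rouche.

(** * Matching the roots of two polynomials that are close on annuli *)

Section Counting.
Variable R : realType.
Local Notation C := R[i].
Implicit Types (a z c : C) (s t : seq C).

(** Each product is at most [1 + 2 * eta] times the other, because [1 / (1 - eta) <= 1 + 2 * eta]
    for [eta <= 1 / 2]. Closeness on the whole annulus, and not only on its two boundary circles, is
    what excludes roots of [s] from it. *)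
Lemma rouche_eq s t c (r1 r2 eta : R) :
  0 < r1 < r2 -> 0 <= eta <= 2^-1 -> (1 + 2 * eta) ^+ 2 < r2 / r1 ->
  (forall z, r1 <= normc (z - c) <= r2 ->
    \prod_(b <- t) (z - b) != 0 /\
    normc (\prod_(a <- s) (z - a) - \prod_(b <- t) (z - b)) <=
      eta * normc (\prod_(b <- t) (z - b))) ->
  count (fun a => normc (a - c) < r1) s = count (fun a => normc (a - c) < r1) t
  /\ (forall a, a \in s -> (normc (a - c) < r1) || (r2 < normc (a - c))).
Proof.
move=> /andP[r1_gt0 r12] /andP[eta0 eta2] etar H.
pose f z := \prod_(a <- s) (z - a); pose g z := \prod_(b <- t) (z - b).
have up z : r1 <= normc (z - c) <= r2 -> normc (f z) <= (1 + 2 * eta) * normc (g z).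
  move=> /H[_]; rewrite -/(f z) -/(g z) => h.
  have := le_normcD (f z - g z) (g z); rewrite subrK => h'.
  have := mulr_ge0 eta0 (normc_ge0 (g z)); lra.
have dn z : r1 <= normc (z - c) <= r2 -> normc (g z) <= (1 + 2 * eta) * normc (f z).
  move=> /H[_]; rewrite -/(f z) -/(g z) => h.
  have := le_normcD (g z - f z) (f z); rewrite subrK normc_sub => h'.
  have h1 : (1 - eta) * normc (g z) <= normc (f z) by lra.
  have : 0 <= eta * (1 - 2 * eta) * normc (g z).
    by rewrite !mulr_ge0 ?normc_ge0//; lra.
  have := ler_wpM2l (ltac:(lra) : 0 <= 1 + 2 * eta) h1; lra.
have tP b : b \in t -> (normc (b - c) < r1) || (r2 < normc (b - c)).
  move=> bt; case: ltP => //= b1; rewrite ltNge; apply/negP => b2.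
  have [] := H b; first by rewrite b1.
  by rewrite prodf_seq_neq0 => /allP /(_ _ bt) /=; rewrite subrr eqxx.
have sP b : b \in s -> (normc (b - c) < r1) || (r2 < normc (b - c)).
  move=> bt; case: ltP => //= b1; rewrite ltNge; apply/negP => b2.
  have bb : r1 <= normc (b - c) <= r2 by rewrite b1.
  have f0 : f b = 0.
    apply/eqP; rewrite /f prodf_seq_eq0; apply/hasP; exists b => //=.
    by rewrite subrr.
  have := dn _ bb; rewrite f0 normc0 mulr0 => g0.
  have [+ _] := H _ bb; rewrite -normc_gt0 -/(g b) => ?; lra.
have i1 z : normc (z - c) = r1 -> r1 <= normc (z - c) <= r2.
  by move=> ->; rewrite lexx ltW.
have i2 z : normc (z - c) = r2 -> r1 <= normc (z - c) <= r2.
  by move=> ->; rewrite lexx ltW.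
have dl1 : 1 <= 1 + 2 * eta by lra.
split=> //; apply/eqP; rewrite eqn_leq; apply/andP; split.
- by apply: (rouche_le r1_gt0 r12 dl1) => // z hz; [exact/up/i2 | exact/dn/i1].
- by apply: (rouche_le r1_gt0 r12 dl1) => // z hz; [exact/dn/i2 | exact/up/i1].
Qed.

(** A root [0] contributes [normc z] exactly, so only the nonzero roots cost a factor [sg / B]. For
    a matrix of bounded rank the loss does not depend on its size. *)
Lemma prod_dist_ge (pi : seq C) (z : C) (sg B : R) : 0 < sg <= B ->
  0 < normc z <= B -> (forall p, p \in pi -> p != 0 -> sg <= normc (z - p)) ->
  normc z ^+ size pi * (sg / B) ^+ count (fun p => p != 0) pi <=
  normc (\prod_(p <- pi) (z - p)).
Proof.
move=> /andP[sg0 sgB] /andP[z0 zB]; have B0 := lt_le_trans sg0 sgB.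
elim: pi => [|p pi IH] H; first by rewrite !big_nil normc1 !expr0 mulr1.
rewrite big_cons normcM /= exprS exprD mulrACA; apply: ler_pM.
- by rewrite mulr_ge0 ?normc_ge0 ?exprn_ge0 ?divr_ge0 ?(ltW sg0) ?(ltW B0).
- by apply: mulr_ge0; [exact/exprn_ge0/normc_ge0|apply/exprn_ge0/divr_ge0; exact: ltW].
- have [->|p0] := eqVneq p 0; first by rewrite expr0 mulr1 subr0.
  rewrite expr1; apply: le_trans (H p (mem_head _ _) p0).
  rewrite mulrA ler_pdivrMr// mulrC ler_wpM2l ?(ltW sg0)//.
- by apply: IH => q qpi; apply: H; rewrite inE qpi orbT.
Qed.

(** * The lists [al], [be] and [pi] stand for the eigenvalues of [A], [A + P] and [P] *)

Section Perturbation.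
Variables (al be pi : seq C) (n r : nat) (zeta dl B : R).
Hypotheses (zeta_gt0 : 0 < zeta) (sz_pi : size pi = n)
  (pi_rank : (count (fun p => p != 0%R) pi <= r)%N)
  (al_lt : forall a, a \in al -> normc a < zeta)
  (close : forall z, zeta <= normc z ->
    normc (z ^+ n * \prod_(b <- be) (z - b) -
           \prod_(p <- pi) (z - p) * \prod_(a <- al) (z - a)) <=
    dl * normc (z ^+ n * \prod_(a <- al) (z - a))).

(** The polynomial of [be] times [z ^ n] is compared with the product of those of [pi] and [al],
    hence the padding by [n] zeros. The error [dl], relative to [z ^ n] times the polynomial of
    [al], becomes an error [eta] relative to the product because [prod_dist_ge] bounds the
    polynomial of [pi] below by [normc z ^ n * (sg / B) ^ r]. *)
Lemma disc_count c (r1 r2 sg eta : R) :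
  0 < r1 < r2 -> 0 <= eta <= 2^-1 -> (1 + 2 * eta) ^+ 2 < r2 / r1 ->
  0 < sg <= B -> dl <= eta * (sg / B) ^+ r ->
  (forall z, r1 <= normc (z - c) <= r2 -> zeta <= normc z <= B /\
     forall p, p \in pi -> p != 0 -> sg <= normc (z - p)) ->
  count (fun a => normc (a - c) < r1) (nseq n 0 ++ be) =
  count (fun a => normc (a - c) < r1) (pi ++ al) /\
  (forall a, a \in be -> (normc (a - c) < r1) || (r2 < normc (a - c))).
Proof.
move=> r12 eta2 etar sgB dle H.
have /andP[eta0 _] := eta2.
have /andP[sg0 sgBl] := sgB; have B0 := lt_le_trans sg0 sgBl.
suff [h1 h2] : count (fun a => normc (a - c) < r1) (nseq n 0 ++ be) =
    count (fun a => normc (a - c) < r1) (pi ++ al) /\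
    (forall a, a \in nseq n 0 ++ be -> (normc (a - c) < r1) || (r2 < normc (a - c))).
  by split=> // a ab; apply: h2; rewrite mem_cat ab orbT.
apply: (rouche_eq r12 eta2 etar) => z /H[/andP[z1 z2] zp].
have z0 : 0 < normc z by apply: lt_le_trans z1.
rewrite !big_cat /= (_ : \prod_(i <- nseq n 0) (z - i) = z ^+ n); last first.
  by rewrite big_nseq subr0 iter_mulr_1.
have zB : 0 < normc z <= B by rewrite z0.
have lb := prod_dist_ge sgB zB zp.
have al0 : 0 < normc (\prod_(a <- al) (z - a)).
  rewrite normc_gt0 prodf_seq_neq0; apply/allP => a aal /=.
  rewrite subr_eq0; apply/eqP => za; have := al_lt aal; rewrite -za; lra.
have q1 : sg / B <= 1 by rewrite ler_pdivrMr// mul1r.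
have q0 : 0 < sg / B by rewrite divr_gt0.
have qr : (sg / B) ^+ r <= (sg / B) ^+ count (fun p => p != 0) pi.
  by apply: ler_wiXn2l => //; exact: ltW.
have {}lb : normc (z ^+ n) * (sg / B) ^+ r <= normc (\prod_(p <- pi) (z - p)).
  apply: le_trans lb; rewrite sz_pi normcX ler_wpM2l// exprn_ge0// ltW//.
have pi0 : 0 < normc (\prod_(p <- pi) (z - p)).
  by apply: lt_le_trans lb; rewrite normcX mulr_gt0 ?exprn_gt0.
split; first by rewrite -normc_gt0 normcM mulr_gt0.
apply: le_trans (close z1) _; rewrite !normcM mulrA [leRHS]mulrA.
rewrite ler_pM2r//.
apply: le_trans (ler_wpM2l eta0 lb); rewrite mulrCA mulrC ler_wpM2l// normc_ge0//.
Qed.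

End Perturbation.

(** Pigeonhole on scales: if some [x] lies between [D] and [8 * D], the scale drops to [D / 8], for
    which [x] is no longer an obstacle. Each drop uses up one element of [d]. Applied to mutual
    distances, the gap splits a finite set into well separated clusters. *)
Lemma scale_gap (d : seq R) (D : R) : 0 < D ->
  exists2 sg, D / 8 ^+ size d <= sg <= D &
    forall x, x \in d -> x <= sg \/ 8 * sg < x.
Proof.
move En : (size d) => N; elim: N d En D => [|N IH] d sd D D0.
  by exists D; rewrite ?expr0 ?divr1 ?lexx// (size0nil sd).
have [/hasP[x xd /andP[x1 x2]]|/hasPn no] :=
    boolP (has (fun x => (D < x) && (x <= 8 * D)) d).
  have sr : size (rem x d) = N by rewrite size_rem// sd.
  have D8 : 0 < D / 8 by rewrite divr_gt0.
  have [sg /andP[sg1 sg2] H] := IH _ sr _ D8.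
  exists sg => [|y yd].
    apply/andP; split; last by apply: le_trans sg2 _; lra.
    by rewrite exprS invfM mulrA.
  have [->|yx] := eqVneq y x; first by right; lra.
  by apply: H; rewrite -[y \in _]/(y \in rem x d) (rem_mem yx).
exists D => [|y /no]; last first.
  by rewrite negb_and -!leNgt -ltNge => /orP[]; [left|right].
rewrite lexx andbT ler_pdivrMr ?exprn_gt0// ler_peMr ?(ltW D0)//.
by rewrite exprn_ege1//; lra.
Qed.

End Counting.

(** Think of [e] as belonging to the same cluster and of [E c] as lying near the cluster of [c].
    Matching [x] with a point [y] near it lowers both counts by one for the cluster of [x] and
    changes no other, so the hypotheses survive for the remaining elements. *)
Lemma greedy_matching (T U : eqType) (e : rel T) (E : T -> pred U)
    (l : seq T) (m : seq U) :
  (forall c, c \in l -> e c c) ->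
  (forall c c', c \in l -> c' \in l -> e c c' = e c' c) ->
  (forall c c' y, c \in l -> c' \in l -> y \in m -> E c y -> E c' y = e c c') ->
  (forall c, c \in l -> count (E c) m = count (e c) l) ->
  size m = size l ->
  exists2 m', perm_eq m' m & all2 E l m'.
Proof.
elim: l m => [|x l IH] m eR eS EE cnt sz.
  by exists [::]; rewrite // (size0nil sz).
have xl := mem_head x l.
have : has (E x) m.
  by rewrite has_count cnt//= eR.
case/hasP=> y ym Exy.
have sub c : c \in l -> c \in x :: l by rewrite inE orbC => ->.
have mE := perm_to_rem ym.
have [|||||m' pm am] := IH (rem y m).
- by move=> c /sub/eR.
- by move=> c c' /sub cl /sub cl'; exact: eS.
- by move=> c c' z /sub cl /sub cl' /mem_rem; exact: EE.
- move=> c cl; have := cnt _ (sub _ cl).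
  by rewrite (seq.permP mE) /= (EE x c y xl (sub _ cl) ym Exy) (eS x c xl (sub _ cl)) => /addnI.
- by rewrite size_rem// sz.
exists (y :: m'); last by rewrite /= Exy.
by rewrite perm_sym (perm_trans mE)// perm_cons perm_sym.
Qed.

Lemma all2_sub (T U : Type) (P Q : T -> U -> bool) l m :
  (forall x y, P x y -> Q x y) -> all2 P l m -> all2 Q l m.
Proof.
move=> PQ; elim: l m => [|x l IH] [|y m] //= /andP[/PQ -> am].
exact: IH.
Qed.

Section Matching.
Variable R : realType.
Local Notation C := R[i].

(** A first comparison across the band fixes the number of outliers; a second one, around each
    cluster of eigenvalues of [P], places them. The tolerance [dl] is chosen before [n], so that it
    can serve along the whole sequence. *)
Lemma outlier_matching (b eps M D : R) (r : nat) :
  0 <= b -> 0 < eps -> 0 <= M -> 0 < D ->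
  exists2 dl : R, 0 < dl & forall (n : nat) (al be pi : seq C),
    size al = n -> size be = n -> size pi = n ->
    (count (fun p => p != 0%R) pi <= r)%N ->
    (forall a, a \in al -> normc a < b + eps) ->
    (forall p, p \in pi -> normc p <= M) ->
    (forall p, p \in pi -> ~ (b + eps < normc p < b + 3 * eps)) ->
    (forall z, b + eps <= normc z ->
      normc (z ^+ n * \prod_(b <- be) (z - b) -
             \prod_(p <- pi) (z - p) * \prod_(a <- al) (z - a)) <=
      dl * normc (z ^+ n * \prod_(a <- al) (z - a))) ->
  forall l, perm_eq l [seq p <- pi | b + 3 * eps <= normc p] ->
  exists2 m, perm_eq m [seq z <- be | b + 2 * eps < normc z] &
    all2 (fun c y => normc (y - c) < D) l m.
Proof.
move=> b0 eps0 M0 D0.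
pose B := M + b + 4 * eps.
(* The first bound makes discs of radius [2 * sg] smaller than [D]; the second keeps discs of radius
   [3 * sg] around the outliers of [P] at modulus above [b + 2 * eps]. *)
pose D' := Num.min (D / 3) (eps / 10).
have D'0 : 0 < D' by rewrite lt_min; apply/andP; split; rewrite divr_gt0.
have D'1 : D' <= D / 3 by rewrite ge_min lexx.
have D'2 : D' <= eps / 10 by rewrite ge_min lexx orbT.
(* At most [r] outliers have at most [r * r] mutual distances, so the scale given by [scale_gap]
   never falls below [sm]. *)
pose sm := D' / 8 ^+ (r * r)%N.
have smE : sm = D' / 8 ^+ (r * r)%N by [].
clearbody sm.
have sm0 : 0 < sm by rewrite smE divr_gt0// exprn_gt0.
have smD : sm <= D'.
  rewrite smE ler_pdivrMr ?exprn_gt0// ler_peMr ?(ltW D'0)//.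
  by rewrite exprn_ege1//; lra.
(* The radii [b + 5 / 3 * eps] and [b + 7 / 3 * eps] cut the forbidden band into thirds, so the
   points between them stay at distance at least [2 / 3 * eps] from the eigenvalues of [P]. *)
pose q := (b + 7 / 3 * eps) / (b + 5 / 3 * eps).
have q1 : 1 < q by rewrite ltr_pdivlMr; lra.
(* The second bound is for the ratio [q] of the circles around [0]; the first suffices for the ratio
   [3 / 2] of the small discs. *)
pose eta := Num.min (16^-1) ((q - 1) / 8).
have eta0 : 0 < eta by rewrite lt_min invr_gt0 ltr0n/= divr_gt0// subr_gt0.
have eta1 : eta <= 16^-1 by rewrite ge_min lexx.
have eta2 : eta <= (q - 1) / 8 by rewrite ge_min lexx orbT.
have etaE : (1 + 2 * eta) ^+ 2 <= 1 + 5 * eta.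
  have : 0 <= eta * (4^-1 - eta) by rewrite mulr_ge0//; lra.
  by rewrite expr2; lra.
have B0 : 0 < B by rewrite /B; lra.
exists (eta * (sm / B) ^+ r).
  by rewrite mulr_gt0// exprn_gt0// divr_gt0.
move=> n al be pi sal sbe spi rk alP piM band close l pl.
have zeta0 : 0 < b + eps by lra.
have eta12 : 0 <= eta <= 2^-1 by apply/andP; split; lra.
have cnt c r1 r2 sg h :=
  @disc_count R al be pi n r _ _ B zeta0 spi rk alP close c r1 r2 sg eta h eta12.
have dle sg : sm <= sg -> eta * (sm / B) ^+ r <= eta * (sg / B) ^+ r.
  move=> ssg; rewrite ler_wpM2l ?(ltW eta0)//.
  have sg0 := lt_le_trans sm0 ssg.
  apply: lerXn2r; rewrite ?nnegrE ?divr_ge0 ?(ltW sm0) ?(ltW sg0) ?(ltW B0)//.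
  by rewrite ler_pM2r ?invr_gt0.
have piP p : p \in pi -> (normc p <= b + eps) \/ (b + 3 * eps <= normc p).
  move=> pp; case: (leP (normc p) (b + eps)) => [|h]; first by left.
  right; rewrite leNgt; apply/negP => h'; apply: (band _ pp).
  by rewrite h.
have tri (x y z : C) : normc (x - z) <= normc (x - y) + normc (y - z).
  by have := le_normcD (x - y) (y - z); rewrite addrA subrK.
have tri0 (x y : C) : normc x <= normc (x - y) + normc y.
  by have := tri x y 0; rewrite !subr0.
have [|||||in_eq in_out] := cnt 0 (b + 5 / 3 * eps) (b + 7 / 3 * eps)
    (2 / 3 * eps).
- by apply/andP; split; lra.
- rewrite -/q; lra.
- by apply/andP; split; rewrite /B; lra.
- by apply: dle; lra.
- move=> z; rewrite subr0 => /andP[z1 z2]; split.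
    by apply/andP; split; rewrite /B; lra.
  move=> p /piP pp _.
  have := tri0 p z; have := tri0 z p; rewrite normc_sub.
  by case: pp => ?; lra.
have sz_eq : size [seq z <- be | b + 2 * eps < normc z] = size l.
  rewrite (perm_size pl) !size_filter.
  have bc := count_predC (fun z => b + 2 * eps < normc z) be.
  have pc := count_predC (fun z => b + 3 * eps <= normc z) pi.
  move: in_eq; rewrite !count_cat.
  have -> : count (fun a => normc (a - 0) < b + 5 / 3 * eps) (nseq n 0) = n.
    by rewrite count_nseq subr0 normc0 (_ : 0 < _)%R ?mul1n//; lra.
  have -> : count (fun a => normc (a - 0) < b + 5 / 3 * eps) al = n.
    rewrite -sal -[RHS](count_predT al); apply: eq_in_count => a /alP ?.
    by rewrite subr0; apply: lt_trans (ltac:(eassumption)) _; lra.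
  have -> : count (fun a => normc (a - 0) < b + 5 / 3 * eps) be =
      count (predC (fun z => b + 2 * eps < normc z)) be.
    apply: eq_in_count => a /in_out; rewrite subr0 /= -leNgt => aa.
    by apply/idP/idP => ?; case/orP: aa => ?; lra.
  have -> : count (fun a => normc (a - 0) < b + 5 / 3 * eps) pi =
      count (predC (fun z => b + 3 * eps <= normc z)) pi.
    apply: eq_in_count => a /piP aa; rewrite subr0 /= -ltNge.
    by apply/idP/idP => ?; case: aa => ?; lra.
  move=> bp; move: bc pc; rewrite sbe spi => <- /esym.
  by move: bp; rewrite [RHS]addnC => /addnI -> /addIn.
have lpi c : c \in l -> c \in pi /\ b + 3 * eps <= normc c.
  by rewrite (perm_mem pl) mem_filter => /andP[].
have szl : (size l <= r)%N.
  rewrite (perm_size pl) size_filter; apply: leq_trans rk.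
  apply: sub_count => p /= hp; rewrite -normc_gt0; lra.
have [sg /andP[sg1 sg2] gap] := scale_gap [seq normc (x - y) | x <- l, y <- l] D'0.
have {}sg1 : sm <= sg.
  apply: le_trans sg1; rewrite smE ler_pM2l// lef_pV2 ?posrE ?exprn_gt0//.
  by rewrite ler_weXn2l ?size_allpairs ?leq_mul//; lra.
have sg0 : 0 < sg by lra.
have {}gap x y : x \in l -> y \in l -> normc (x - y) <= sg \/ 8 * sg < normc (x - y).
  by move=> xl yl; apply: gap; apply/allpairsP; exists (x, y).
(* By the gap an outlier of [P] is within [sg] of [c] or farther than [8 * sg]. The annulus between
   [2 * sg] and [3 * sg] thus stays at distance [sg] from all of them, and the other eigenvalues of
   [P] are far inside. *)
have disc c : c \in l ->
    count (fun y => normc (y - c) < 2 * sg) be = count (fun y => normc (c - y) <= sg) l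
    /\ forall y, y \in be -> (normc (y - c) < 2 * sg) || (3 * sg < normc (y - c)).
  move=> cl; have [cpi c3] := lpi _ cl; have cM := piM _ cpi.
  have [|||||ceq cout] := cnt c (2 * sg) (3 * sg) sg.
  - by apply/andP; split; lra.
  - by rewrite invfM mulrA ltr_pdivlMr ?ltr_pdivlMr//; nra.
  - by apply/andP; split; rewrite /B; lra.
  - exact: dle.
  - move=> z /andP[z1 z2]; have zc := tri0 z c.
    have cz := tri0 c z; rewrite normc_sub in cz; split.
      by apply/andP; split; rewrite /B; lra.
    move=> p ppi _.
    have [p1|p3] := piP _ ppi; first by have := tri0 z p; lra.
    have pl' : p \in l by rewrite (perm_mem pl) mem_filter p3.
    have := tri z p c; have := tri c z p; rewrite (normc_sub c z) (normc_sub p c).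
    by have [] := gap _ _ cl pl'; lra.
  split=> //; move: ceq; rewrite !count_cat count_nseq sub0r normcN.
  rewrite [_ < 2 * sg]ltNge (_ : 2 * sg <= normc c) ?mul0n ?add0n; last by lra.
  move=> ->.
  have -> : count (fun a => normc (a - c) < 2 * sg) al = 0%N.
    apply/eqP; rewrite -leqn0 leqNgt -has_count; apply/hasPn => a /alP aa.
    by rewrite -leNgt; have := tri0 c a; rewrite normc_sub; lra.
  rewrite addn0 (seq.permP pl) count_filter; apply: eq_in_count => p ppi /=.
  have pc := tri0 c p; rewrite (normc_sub p).
  apply/idP/idP => [h|/andP[h _]]; last by lra.
  have [p1|p3] := piP _ ppi; first lra.
  rewrite p3 andbT; have pl' : p \in l by rewrite (perm_mem pl) mem_filter p3.
  by have [] := gap _ _ cl pl'; lra.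
have [|||||m pm am] := @greedy_matching C C (fun x y => normc (x - y) <= sg)
  (fun c y => normc (y - c) < 2 * sg) l [seq z <- be | b + 2 * eps < normc z].
- by move=> c _; rewrite subrr normc0 ltW.
- by move=> c c' _ _; rewrite normc_sub.
- move=> c c' y cl cl'; rewrite mem_filter => /andP[_ ybe] yc.
  have [_ /(_ _ ybe) yc'] := disc _ cl'.
  have := tri y c c'; have := tri c y c'; rewrite (normc_sub c y) => t1 t2.
  have g := gap _ _ cl cl'.
  apply/idP/idP => h.
    by case: g => //; lra.
  by case/orP: yc' => //; lra.
- move=> c cl; have [<- _] := disc _ cl; rewrite count_filter.
  apply: eq_in_count => y _ /=; apply/andP/idP => [[]//|h]; split=> //.
  have [_ c3] := lpi _ cl; have := tri0 c y; rewrite normc_sub; lra.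
- exact: sz_eq.
exists m => //; apply: all2_sub am => c y /= h; lra.
Qed.

End Matching.

(** * Determinants of finite rank perturbations *)

(** One block matrix is reduced in two ways, by right factors of determinants [1] and [x ^+ p].
    Keeping the powers of [x] avoids any inverse, so the identity also applies when [x] is the
    indeterminate. *)
Lemma det_scalar_subM (F : comNzRingType) n p (x : F) (X : 'M[F]_(n, p)) (Y : 'M[F]_(p, n)) :
  \det (x%:M - X *m Y) * x ^+ p = x ^+ n * \det (x%:M - Y *m X).
Proof.
have e1 : block_mx x%:M X Y 1%:M *m block_mx 1%:M 0 (- Y) 1%:M =
    block_mx (x%:M - X *m Y) X 0 1%:M.
  by rewrite mulmx_block !mulmx1 !mul1mx !mulmx0 !add0r !mulmxN addrN.
have e2 : block_mx x%:M X Y 1%:M *m block_mx 1%:M (- X) 0 x%:M =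
    block_mx x%:M 0 Y (x%:M - Y *m X).
  rewrite mulmx_block !mulmx1 !mulmx0 !addr0 mul1mx !mulmxN.
  by rewrite mul_scalar_mx mul_mx_scalar addNr addrC.
have d1 := congr1 determinant e1; have d2 := congr1 determinant e2.
move: d1 d2; rewrite !det_mulmx !det_ublock !det_lblock !det1 !mulr1 !mul1r !det_scalar.
by move=> <- <-.
Qed.

Lemma det_1subC (F : comNzRingType) n p (X : 'M[F]_(n, p)) (Y : 'M[F]_(p, n)) :
  \det (1%:M - X *m Y) = \det (1%:M - Y *m X).
Proof. by have := det_scalar_subM 1 X Y; rewrite !expr1n mulr1 mul1r. Qed.

Lemma horner_char_poly (F : fieldType) n (A : 'M[F]_n) z : (char_poly A).[z] = \det (z%:M - A).
Proof.
rewrite /char_poly -[LHS]/(horner_eval z _) -det_map_mx; congr (\det _).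
apply/matrixP => i j; rewrite !mxE /= /horner_eval hornerD hornerN hornerC.
by rewrite hornerMn hornerX.
Qed.

Section LOne.
Variable R : realType.
Local Notation C := R[i].

(** This norm is submultiplicative for rectangular matrices and follows at once from bounds on
    entries. The powers of [n] that it costs will be beaten by a geometric decay in [K]. *)
Definition l1 m n (A : 'M[C]_(m, n)) : R := \sum_i \sum_j normc (A i j).

Lemma l1_ge0 m n (A : 'M[C]_(m, n)) : 0 <= l1 A.
Proof. by do 2!(apply: sumr_ge0 => ? _); exact: normc_ge0. Qed.

Lemma l1_entry m n (A : 'M[C]_(m, n)) i j : normc (A i j) <= l1 A.
Proof.
rewrite /l1 (bigD1 i)//= (bigD1 j)//= -addrA lerDl addr_ge0//.
  by apply: sumr_ge0 => ? _; exact: normc_ge0.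
by do 2!(apply: sumr_ge0 => ? _); exact: normc_ge0.
Qed.

Lemma l1_eq0 m n (A : 'M[C]_(m, n)) : l1 A = 0 -> A = 0.
Proof.
move=> A0; apply/matrixP => i j; rewrite mxE; apply/eqP; rewrite -normc_eq0.
by rewrite eq_le normc_ge0 andbT -A0 l1_entry.
Qed.

Lemma l1D m n (A B : 'M[C]_(m, n)) : l1 (A + B) <= l1 A + l1 B.
Proof.
rewrite /l1 -big_split; apply: ler_sum => i _; rewrite -big_split /=.
by apply: ler_sum => j _; rewrite mxE le_normcD.
Qed.

Lemma l1Z m n (c : C) (A : 'M[C]_(m, n)) : l1 (c *: A) = normc c * l1 A.
Proof.
rewrite /l1 mulr_sumr; apply: eq_bigr => i _; rewrite mulr_sumr.
by apply: eq_bigr => j _; rewrite mxE normcM.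
Qed.

Lemma l1_sum m n (I : Type) (s : seq I) (F : I -> 'M[C]_(m, n)) :
  l1 (\sum_(i <- s) F i) <= \sum_(i <- s) l1 (F i).
Proof.
elim: s => [|i s IH]; rewrite ?big_nil ?big_cons.
  by rewrite /l1 !big1// => i _; rewrite big1// => j _; rewrite mxE normc0.
by apply: le_trans (l1D _ _) _; rewrite lerD2l.
Qed.

Lemma l1M m n p (A : 'M[C]_(m, n)) (B : 'M[C]_(n, p)) :
  l1 (A *m B) <= l1 A * l1 B.
Proof.
apply: (@le_trans _ _ (\sum_i \sum_k (normc (A i k) * \sum_j normc (B k j)))).
  apply: ler_sum => i _; under [leRHS]eq_bigr do rewrite mulr_sumr.
  rewrite exchange_big; apply: ler_sum => j _ /=; rewrite mxE.
  apply: le_trans (normc_sum _ _ _) _; apply: ler_sum => k _.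
  by rewrite normcM.
rewrite {2}/l1 mulr_suml; apply: ler_sum => i _; rewrite mulr_suml.
apply: ler_sum => k _; rewrite ler_wpM2l ?normc_ge0//.
rewrite /l1 [leRHS](bigD1 k)//= lerDl; apply: sumr_ge0 => ? _.
by apply: sumr_ge0 => ? _; exact: normc_ge0.
Qed.

Lemma l1_le m n (A : 'M[C]_(m, n)) (x : R) :
  (forall i j, normc (A i j) <= x) -> l1 A <= (m * n)%:R * x.
Proof.
move=> Ax; apply: (@le_trans _ _ (\sum_(i < m) \sum_(j < n) x)).
  by do 2!(apply: ler_sum => ? _).
by rewrite !sumr_const !card_ord -mulrnA mulr_natl mulnC.
Qed.

Lemma prod_diff (I : Type) (s : seq I) (f g : I -> C) (B e : R) : 1 <= B ->
  (forall i, normc (f i) <= B) -> (forall i, normc (g i) <= B) ->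
  (forall i, normc (f i - g i) <= e) ->
  normc (\prod_(i <- s) f i - \prod_(i <- s) g i) <= (size s)%:R * B ^+ size s * e.
Proof.
move=> B1 fB gB fg; elim: s => [|i s IH].
  by rewrite !big_nil subrr normc0 !mul0r.
rewrite !big_cons; set p := \prod_(j <- s) f j in IH *; set q := \prod_(j <- s) g j in IH *.
have -> : f i * p - g i * q = f i * (p - q) + (f i - g i) * q.
  by rewrite mulrBr mulrBl addrA subrK.
have qB : normc q <= B ^+ size s.
  rewrite /q normc_prod; elim: (s) => [|k s' IH']; rewrite ?big_nil ?big_cons//=.
  by rewrite exprS ler_pM// ?normc_ge0//; apply: prodr_ge0 => ? _; exact: normc_ge0.
have e0 : 0 <= e := le_trans (normc_ge0 _) (fg i).
apply: le_trans (le_normcD _ _) _; rewrite !normcM /=.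
have h1 : normc (f i) * normc (p - q) <= B * ((size s)%:R * B ^+ size s * e).
  by rewrite ler_pM ?normc_ge0.
have h2 : normc (f i - g i) * normc q <= e * B ^+ (size s).+1.
  rewrite ler_pM ?normc_ge0// (le_trans qB)// exprS ler_peMl//.
  by rewrite exprn_ge0//; lra.
apply: le_trans (lerD h1 h2) _.
rewrite -[in leRHS]natr1 exprS; set x := B ^+ _; set y := (size s)%:R.
by rewrite le_eqVlt; apply/orP; left; apply/eqP; ring.
Qed.

Lemma det_diff p (M N : 'M[C]_p) (B e : R) : 1 <= B ->
  (forall i j, normc (M i j) <= B) -> (forall i j, normc (N i j) <= B) ->
  (forall i j, normc (M i j - N i j) <= e) ->
  normc (\det M - \det N) <= (p`!)%:R * (p%:R * B ^+ p * e).
Proof.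
move=> B1 MB NB MN; rewrite /determinant -sumrB.
apply: le_trans (normc_sum _ _ _) _.
apply: (@le_trans _ _ (\sum_(s : 'S_p) (p%:R * B ^+ p * e))); last first.
  by rewrite sumr_const -[leLHS]mulr_natl card_Sn.
apply: ler_sum => s _; rewrite -mulrBr normcM normcX normcN normc1 expr1n mul1r.
have := @prod_diff 'I_p (index_enum _) (fun i => M i (s i)) (fun i => N i (s i)) B e B1.
by rewrite /index_enum -enumT size_enum_ord; apply.
Qed.

End LOne.

(** * Truncated Neumann series of the resolvent *)

Section Resolvent.
Variable R : realType.
Local Notation C := R[i].

Definition neumann n (A : 'M[C]_n) (z : C) (K : nat) : 'M[C]_n :=
  \sum_(k < K) z^-1 ^+ k.+1 *: A ^+ k.

Lemma neumannP n (A : 'M[C]_n) z K : z != 0 ->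
  (z%:M - A) *m neumann A z K = 1%:M - z^-1 ^+ K *: A ^+ K.
Proof.
move=> z0; elim: K => [|K IH].
  by rewrite /neumann big_ord0 mulmx0 !expr0 scale1r subrr.
rewrite /neumann big_ord_recr /= mulmxDr IH -scalemxAr mulmxBl mul_scalar_mx.
have -> : A *m A ^+ K = A ^+ K.+1 by rewrite exprS.
rewrite scalerBr scalerA.
by rewrite exprSr -mulrA mulVf// mulr1 addrA subrK.
Qed.

Lemma unit_1sub_l1 n (N : 'M[C]_n) : l1 N < 1 -> 1%:M - N \in unitmx.
Proof.
move=> N1; rewrite -row_free_unit; apply: inj_row_free => v.
rewrite mulmxBr mulmx1 => /eqP; rewrite subr_eq0 => /eqP vN.
apply: l1_eq0; apply/eqP; rewrite eq_le l1_ge0 andbT.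
have := l1M v N; rewrite -vN => h; have v0 := l1_ge0 v.
rewrite leNgt; apply/negP => v1.
have : l1 v * l1 N < l1 v * 1 by rewrite ltr_pM2l.
by rewrite mulr1 => /(le_lt_trans h); rewrite ltxx.
Qed.

Lemma geom_sum_le (be ze w : R) (K : nat) : 0 < be < ze -> 0 <= w <= ze^-1 ->
  \sum_(k < K) w ^+ k.+1 * be ^+ k <= (ze - be)^-1.
Proof.
move=> /andP[be0 bz] /andP[w0 wz]; have ze0 := lt_trans be0 bz.
apply: (@le_trans _ _ (\sum_(k < K) ze^-1 ^+ k.+1 * be ^+ k)).
  apply: ler_sum => k _; apply: ler_wpM2r; first by rewrite exprn_ge0// ltW.
  by rewrite lerXn2r// nnegrE invr_ge0 ltW.
rewrite -[leRHS]mul1r ler_pdivlMr ?subr_gt0//.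
suff -> : (\sum_(k < K) ze^-1 ^+ k.+1 * be ^+ k) * (ze - be) = 1 - (be / ze) ^+ K.
  by rewrite gerBl exprn_ge0// divr_ge0// ltW.
elim: K => [|K IH]; first by rewrite big_ord0 mul0r expr0 subrr.
rewrite big_ord_recr /= mulrDl IH !exprS !exprMn.
have zz : ze^-1 * ze = 1 by rewrite mulVf// gt_eqF.
have -> : ze^-1 * ze^-1 ^+ K * be ^+ K * (ze - be) =
  (ze^-1 * ze) * (ze^-1 ^+ K * be ^+ K) - be * ze^-1 * (ze^-1 ^+ K * be ^+ K) by ring.
by rewrite zz; ring.
Qed.

Section Bounds.
Variables (n p K : nat) (A : 'M[C]_n) (X : 'M[C]_(n, p)) (Y : 'M[C]_(p, n)).
Variables (be ze M1 eta Cx : R).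
Hypotheses (beze : 0 < be < ze) (M1_ge0 : 0 <= M1) (eta_ge0 : 0 <= eta) (Cx_ge0 : 0 <= Cx).
Hypothesis powA : forall k, (k <= K)%N -> forall a b,
  normc ((A ^+ k) a b) <= n%:R * M1 * be ^+ k.
Hypothesis quadA : forall k, (0 < k < K)%N -> forall i j,
  normc ((Y *m A ^+ k *m X) i j) <= eta * be ^+ k.
Hypothesis Y1 : forall i a, normc (Y i a) <= 1.
Hypothesis X1 : forall a j, normc (X a j) <= Cx.
Hypothesis YX1 : forall i j, normc ((Y *m X) i j) <= Cx.
Let nu := n%:R ^+ 3 * M1 * (be / ze) ^+ K.
Hypothesis nu_small : nu <= 2^-1.
Hypothesis K_gt0 : (0 < K)%N.

(** The tail is [Y *m Rz *m Nm *m X]. The exponent [8] collects one [n] from each of [X] and [Y],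
    and [n ^ 3] from each of the resolvent and [A ^+ K]: [n ^ 2] entries, each carrying the factor
    [n] of [powA]. *)
Definition remainder_bound := p%:R ^+ 2 * n%:R ^+ 8 * (2 * M1 ^+ 2 * Cx * (ze - be)^-1)
   * (be / ze) ^+ K.
Let e := eta * (ze - be)^-1 + remainder_bound.

Section AtPoint.
Variable z : C.
Hypothesis ze_z : ze <= normc z.

Let be_gt0 : 0 < be. Proof. by case/andP: beze. Qed.
Let ze_gt0 : 0 < ze. Proof. by case/andP: beze => ? ?; exact: lt_trans be_gt0 _. Qed.
Let nz_gt0 : 0 < normc z. Proof. exact: lt_le_trans ze_z. Qed.
Let z_neq0 : z != 0. Proof. by rewrite -normc_gt0. Qed.
Let w := (normc z)^-1.
Let w_bd : 0 <= w <= ze^-1.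
Proof. by rewrite /w invr_ge0 normc_ge0 lef_pV2 ?posrE. Qed.

Let Nm := z^-1 ^+ K *: A ^+ K.

Let l1N : l1 Nm <= nu.
Proof.
rewrite /Nm l1Z normcX normcV -/w.
have h := l1_le (powA (leqnn K)).
case/andP: w_bd => w0 w1.
have hw : w ^+ K <= ze^-1 ^+ K by rewrite lerXn2r// nnegrE invr_ge0 ltW.
apply: le_trans (ler_pM _ (l1_ge0 _) hw h) _; first by rewrite exprn_ge0.
rewrite /nu natrM exprMn.
by rewrite le_eqVlt; apply/orP; left; apply/eqP; ring.
Qed.

Let l1S : l1 (neumann A z K) <= n%:R ^+ 3 * M1 * (ze - be)^-1.
Proof.
apply: le_trans (l1_sum _ _) _.
apply: (@le_trans _ _ (\sum_(k < K) n%:R ^+ 3 * M1 * (w ^+ k.+1 * be ^+ k))).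
  apply: ler_sum => k _; rewrite l1Z normcX normcV -/w.
  have h := l1_le (powA (ltnW (ltn_ord k))).
  have wk : 0 <= w ^+ k.+1 by rewrite exprn_ge0//; case/andP: w_bd.
  apply: le_trans (ler_wpM2l wk h) _; rewrite natrM.
  by rewrite le_eqVlt; apply/orP; left; apply/eqP; ring.
rewrite -mulr_sumr ler_wpM2l ?geom_sum_le//.
by rewrite mulr_ge0// exprn_ge0.
Qed.

Lemma resolvent_unit : z%:M - A \in unitmx.
Proof.
have h1 : 2^-1 < 1 :> R by lra.
have := unit_1sub_l1 (le_lt_trans (le_trans l1N nu_small) h1).
by rewrite -neumannP// unitmx_mul => /andP[].
Qed.

Let Rz := invmx (z%:M - A).

Let RzE : Rz = neumann A z K + Rz *m Nm.
Proof.
have := neumannP A K z_neq0; move/(congr1 (mulmx Rz)).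
rewrite mulmxA mulVmx ?resolvent_unit// mul1mx mulmxBr mulmx1 => ->.
by rewrite subrK.
Qed.

(** The resolvent is its truncation plus itself times a matrix of norm at most [1 / 2]; the second
    term is absorbed into the left side. *)
Let l1R : l1 Rz <= 2 * (n%:R ^+ 3 * M1 * (ze - be)^-1).
Proof.
have := l1D (neumann A z K) (Rz *m Nm); rewrite -RzE => h.
have h1 := le_trans (l1M Rz Nm) (ler_wpM2l (l1_ge0 Rz) l1N).
have h2 := ler_wpM2l (l1_ge0 Rz) nu_small.
have := l1S; lra.
Qed.

(** The term [k = 0] of the series is the subtracted [z^-1 *: (Y *m X)]. The terms with [0 < k < K]
    form a geometric sum by [quadA], and the tail is estimated crudely by [remainder_bound]. *)
Lemma resolvent_quad i j :
  normc ((Y *m Rz *m X - z^-1 *: (Y *m X)) i j) <= e.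
Proof.
have Ksplit : neumann A z K = z^-1 *: 1%:M +
    \sum_(1 <= k < K) z^-1 ^+ k.+1 *: A ^+ k.
  rewrite /neumann -(big_mkord xpredT (fun k => z^-1 ^+ k.+1 *: A ^+ k)).
  by rewrite big_ltn// expr1 expr0.
have -> : Y *m Rz *m X - z^-1 *: (Y *m X) =
    \sum_(1 <= k < K) z^-1 ^+ k.+1 *: (Y *m A ^+ k *m X) + Y *m (Rz *m Nm) *m X.
  rewrite {1}RzE Ksplit !mulmxDr !mulmxDl -scalemxAr mulmx1 -scalemxAl.
  set a := z^-1 *: _; rewrite -(addrA a) (addrC a) addrK.
  rewrite mulmx_sumr mulmx_suml; congr (_ + _).
  by apply: eq_bigr => k _; rewrite -scalemxAr -scalemxAl.
rewrite mxE summxE; apply: le_trans (le_normcD _ _) _; apply: lerD.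
  apply: le_trans (normc_sum _ _ _) _.
  apply: (@le_trans _ _ (\sum_(1 <= k < K) eta * (w ^+ k.+1 * be ^+ k))).
    rewrite big_nat [leRHS]big_nat; apply: ler_sum => k kK.
    rewrite mxE normcM normcX normcV -/w mulrCA ler_wpM2l ?quadA//.
    by rewrite exprn_ge0//; case/andP: w_bd.
  rewrite -mulr_sumr ler_wpM2l//; apply: le_trans (geom_sum_le K beze w_bd).
  rewrite -(big_mkord xpredT (fun k => w ^+ k.+1 * be ^+ k)) [leRHS]big_ltn//.
  rewrite lerDr; apply: mulr_ge0; apply: exprn_ge0; last exact: ltW.
  by case/andP: w_bd.
apply: le_trans (l1_entry _ _ _) _; rewrite mulmxA.
apply: le_trans (l1M _ _) _.
have hY : l1 Y <= (p * n)%:R by rewrite -[leRHS]mulr1; exact: l1_le.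
have hX : l1 X <= (n * p)%:R * Cx by exact: l1_le.
have h1 := le_trans (l1M (Y *m Rz) Nm) (ler_pM (l1_ge0 _) (l1_ge0 _) (l1M Y Rz) l1N).
have h2 := ler_pM (l1_ge0 _) (l1_ge0 _) hY l1R.
have nu0 : 0 <= nu.
  by rewrite !mulr_ge0 ?exprn_ge0 ?divr_ge0 ?(ltW be_gt0) ?(ltW ze_gt0).
have h3 := le_trans h1 (ler_wpM2r nu0 h2).
apply: le_trans (ler_pM (l1_ge0 _) (l1_ge0 _) h3 hX) _.
rewrite /remainder_bound /nu !natrM.
by rewrite le_eqVlt; apply/orP; left; apply/eqP; ring.
Qed.

(** Once [\det (z%:M - A)] and [z ^+ n] are factored out, [det_1subC] leaves two determinants of
    size [p], whose matrices differ by the left side of [resolvent_quad]. The statement is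
    multiplied out so that both sides are polynomial in [z]. *)
Lemma det_close : e <= 1 ->
  normc (z ^+ n * \det (z%:M - (A + X *m Y)) -
         \det (z%:M - X *m Y) * \det (z%:M - A)) <=
  (p`!)%:R * (p%:R * (2 + Cx / ze) ^+ p * e) *
    normc (z ^+ n * \det (z%:M - A)).
Proof.
move=> e1.
have -> : \det (z%:M - (A + X *m Y)) = \det (z%:M - A) * \det (1%:M - Y *m Rz *m X).
  have -> : z%:M - (A + X *m Y) = (z%:M - A) *m (1%:M - (Rz *m X) *m Y).
    by rewrite mulmxBr mulmx1 !mulmxA mulmxV ?resolvent_unit// mul1mx opprD addrA.
  by rewrite det_mulmx det_1subC mulmxA.
have -> : \det (z%:M - X *m Y) = z ^+ n * \det (1%:M - z^-1 *: (Y *m X)).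
  have -> : z%:M - X *m Y = z *: (1%:M - (z^-1 *: X) *m Y).
    by rewrite scalerBr -scalemxAl scalerA divff// scale1r scalemx1.
  by rewrite detZ det_1subC scalemxAr.
set a := \det (z%:M - A); set d1 := \det _; set d2 := \det _.
have -> : z ^+ n * (a * d1) - z ^+ n * d2 * a = (d1 - d2) * (z ^+ n * a) by ring.
rewrite normcM ler_wpM2r ?normc_ge0//.
have Cz : 0 <= Cx / ze by rewrite divr_ge0// ltW.
have d1b i j : normc ((1%:M : 'M[C]_p) i j) <= 1.
  by rewrite mxE; case: (i == j); rewrite ?normc1 ?normc0.
have yx i j : normc ((z^-1 *: (Y *m X)) i j) <= Cx / ze.
  rewrite mxE normcM normcV -/w mulrC; case/andP: w_bd => w0 w1.
  by rewrite ler_pM// normc_ge0.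
have rq := resolvent_quad.
have sub1 (N : 'M[C]_p) i j : normc ((1%:M - N) i j) <= 1 + normc (N i j).
  rewrite mxE [(- N) i j]mxE; apply: le_trans (le_normcD _ _) _.
  by rewrite normcN lerD2r.
apply: det_diff; first by lra.
- move=> i j; apply: le_trans (sub1 _ _ _) _.
  set u := Y *m Rz *m X; set v := z^-1 *: (Y *m X).
  have := le_normcD ((u - v) i j) (v i j); have := rq i j; have := yx i j.
  rewrite -/u -/v !mxE subrK; lra.
- by move=> i j; apply: le_trans (sub1 _ _ _) _; have := yx i j; lra.
- move=> i j; apply: le_trans (rq i j).
  rewrite -normcN; set u := Y *m Rz *m X; set v := z^-1 *: _.
  have -> : (u - v) i j = - ((1%:M - u) i j - (1%:M - v) i j).
    by rewrite !mxE; ring.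
  by [].
Qed.

End AtPoint.
End Bounds.
End Resolvent.

(** * Unitary stabilizers and Krylov orbits *)

Notation adjmx M := (map_mx Num.conj (trmx M)).

Section HermitianNorm.
Variable R : realType.
Local Notation C := R[i].

Lemma normc_sqr (z : C) : (normc z ^+ 2)%:C = Num.conj z * z.
Proof. by rewrite -normCKC (rmorphXn (real_complex R)). Qed.

Lemma normc_conj (z : C) : normc (Num.conj z) = normc z.
Proof. by case: z => a b; rewrite /normc /= sqrrN. Qed.

Lemma adjmxM m n p (A : 'M[C]_(m, n)) (B : 'M[C]_(n, p)) :
  adjmx (A *m B) = adjmx B *m adjmx A.
Proof. by rewrite trmx_mul map_mxM. Qed.

Lemma adjmxK m n (A : 'M[C]_(m, n)) : adjmx (adjmx A) = A.
Proof. by apply/matrixP => i j; rewrite !mxE conjCK. Qed.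

Lemma adjmx1 n : adjmx (1%:M : 'M[C]_n) = 1%:M.
Proof. by rewrite trmx1 map_mx1. Qed.

Definition nsq m n (A : 'M[C]_(m, n)) : R := \sum_i \sum_j normc (A i j) ^+ 2.

Lemma nsq_ge0 m n (A : 'M[C]_(m, n)) : 0 <= nsq A.
Proof. by do 2!(apply: sumr_ge0 => ? _); exact: sqr_ge0. Qed.

Lemma nsq_eq0 m n (A : 'M[C]_(m, n)) : nsq A = 0 -> A = 0.
Proof.
move=> A0; apply/matrixP => i j; rewrite mxE; apply/eqP; rewrite -normc_eq0.
rewrite -sqrf_eq0.
move: A0 => /eqP; rewrite /nsq psumr_eq0 => [/allP /(_ i)|k _]; last first.
  by apply: sumr_ge0 => ? _; exact: sqr_ge0.
rewrite mem_index_enum => /(_ isT) /=; rewrite psumr_eq0 => [/allP /(_ j)|k _].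
  by rewrite mem_index_enum => /(_ isT).
exact: sqr_ge0.
Qed.

Lemma nsq_tr m n (A : 'M[C]_(m, n)) : (nsq A)%:C = \tr (adjmx A *m A).
Proof.
rewrite /nsq exchange_big (rmorph_sum (real_complex R)); apply: eq_bigr => j _ /=.
rewrite (rmorph_sum (real_complex R)) mxE; apply: eq_bigr => i _ /=.
by rewrite !mxE normc_sqr.
Qed.

Lemma nsq_adj m n (A : 'M[C]_(m, n)) : nsq (adjmx A) = nsq A.
Proof.
rewrite /nsq exchange_big; apply: eq_bigr => i _; apply: eq_bigr => j _.
by rewrite !mxE normc_conj.
Qed.

Lemma nsq_col n (x : 'cV[C]_n) : nsq x = \sum_i normc (x i 0) ^+ 2.
Proof. by apply: eq_bigr => i _; rewrite big_ord1. Qed.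

Lemma nsqZ m n (c : C) (A : 'M[C]_(m, n)) : nsq (c *: A) = normc c ^+ 2 * nsq A.
Proof.
rewrite /nsq mulr_sumr; apply: eq_bigr => i _; rewrite mulr_sumr.
by apply: eq_bigr => j _; rewrite mxE normcM exprMn.
Qed.

Lemma nsq_col_sum m n (A : 'M[C]_(m, n)) : nsq A = \sum_j nsq (col j A).
Proof.
rewrite /nsq exchange_big; apply: eq_bigr => j _; apply: eq_bigr => i _.
by rewrite big_ord1 mxE.
Qed.

Lemma unitary_adjmx n (U : 'M[C]_n) : U \is unitarymx -> adjmx U *m U = 1%:M.
Proof. by move=> /unitarymxP /mulmx1C. Qed.

Lemma nsq_unitaryl n p (U : 'M[C]_n) (A : 'M[C]_(n, p)) :
  U \is unitarymx -> nsq (U *m A) = nsq A.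
Proof.
move=> Uu; apply: (@complexI R); rewrite !nsq_tr adjmxM mulmxA -(mulmxA (adjmx A)).
by rewrite (unitary_adjmx Uu) mulmx1.
Qed.

Lemma nsq_unitaryr n p (U : 'M[C]_n) (A : 'M[C]_(p, n)) :
  U \is unitarymx -> nsq (A *m U) = nsq A.
Proof.
move=> Uu; have Uu' : adjmx U \is unitarymx by rewrite (trmxC_unitary U).
by rewrite -(nsq_adj (A *m U)) adjmxM (nsq_unitaryl _ Uu') nsq_adj.
Qed.

Lemma sum_cauchy (I : finType) (a b : I -> R) :
  (\sum_i a i * b i) ^+ 2 <= (\sum_i a i ^+ 2) * (\sum_i b i ^+ 2).
Proof.
have : 0 <= \sum_i \sum_j (a i * b j - a j * b i) ^+ 2.
  by do 2!(apply: sumr_ge0 => ? _); exact: sqr_ge0.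
suff -> : \sum_i \sum_j (a i * b j - a j * b i) ^+ 2 =
  2 * ((\sum_i a i ^+ 2) * (\sum_i b i ^+ 2) - (\sum_i a i * b i) ^+ 2) by lra.
have E1 : (\sum_i a i ^+ 2) * (\sum_i b i ^+ 2) = \sum_i \sum_j a i ^+ 2 * b j ^+ 2.
  by rewrite mulr_suml; apply: eq_bigr => i _; rewrite mulr_sumr.
have E2 : (\sum_i a i ^+ 2) * (\sum_i b i ^+ 2) = \sum_i \sum_j a j ^+ 2 * b i ^+ 2.
  by rewrite E1 exchange_big.
have E3 : (\sum_i a i * b i) ^+ 2 = \sum_i \sum_j (a i * b i) * (a j * b j).
  by rewrite expr2 mulr_suml; apply: eq_bigr => i _; rewrite mulr_sumr.
rewrite mulrBr mulrDl mul1r {1}E1 E2 E3 mulr_sumr -big_split -sumrB /=.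
apply: eq_bigr => i _; rewrite mulr_sumr -big_split -sumrB /=.
by apply: eq_bigr => j _; ring.
Qed.

Lemma mulmx_cauchy m n p (A : 'M[C]_(m, n)) (B : 'M[C]_(n, p)) i j :
  normc ((A *m B) i j) ^+ 2 <=
  (\sum_k normc (A i k) ^+ 2) * (\sum_k normc (B k j) ^+ 2).
Proof.
rewrite mxE; apply: le_trans (sum_cauchy _ _).
rewrite lerXn2r ?nnegrE ?normc_ge0//.
  by apply: sumr_ge0 => k _; rewrite mulr_ge0 ?normc_ge0.
by apply: le_trans (normc_sum _ _ _) _; apply: ler_sum => k _; rewrite normcM.
Qed.

Lemma nsqM m n p (A : 'M[C]_(m, n)) (B : 'M[C]_(n, p)) :
  nsq (A *m B) <= nsq A * nsq B.
Proof.
rewrite {2}/nsq mulr_suml; apply: ler_sum => i _.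
rewrite (_ : nsq B = \sum_j \sum_k normc (B k j) ^+ 2); last exact: exchange_big.
by rewrite mulr_sumr; apply: ler_sum => j _; exact: mulmx_cauchy.
Qed.

(** This is the group in which the randomness remains once the first [j] columns of a Haar unitary
    have been revealed. *)
Definition stab n (j : nat) (H : 'M[C]_n) : Prop :=
  H \is unitarymx /\
  forall a : 'I_n, (a < j)%N -> H *m (delta_mx a 0 : 'cV_n) = delta_mx a 0.

Definition above n (j : nat) (u : 'cV[C]_n) : Prop :=
  forall a : 'I_n, (a < j)%N -> u a 0 = 0.

Definition below n (j : nat) (u : 'cV[C]_n) : Prop :=
  forall a : 'I_n, (j <= a)%N -> u a 0 = 0.

Lemma stab1 n j : @stab n j 1%:M.
Proof.
split=> [|a _]; last by rewrite mul1mx.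
by apply/unitarymxP; rewrite adjmx1 mulmx1.
Qed.

Lemma stabM n j (H D : 'M[C]_n) : stab j H -> stab j D -> stab j (H *m D).
Proof.
move=> [Hu He] [Du De]; split; first exact: (mul_unitarymx Hu Du).
by move=> a aj; rewrite -mulmxA (De a aj) (He a aj).
Qed.

Lemma stab_adj n j (H : 'M[C]_n) : stab j H -> stab j (adjmx H).
Proof.
move=> [Hu He]; split; first by rewrite (trmxC_unitary H).
by move=> a aj; rewrite -[X in _ *m X](He a aj) mulmxA (unitary_adjmx Hu) mul1mx.
Qed.

Lemma stab_le n i j (H : 'M[C]_n) : (i <= j)%N -> stab j H -> stab i H.
Proof. by move=> ij [Hu He]; split=> // a ai; apply/He/leq_trans/ij. Qed.

Lemma cV_sum_delta n (u : 'cV[C]_n) : u = \sum_a u a 0 *: delta_mx a 0.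
Proof.
rewrite {1}[u]matrix_sum_delta; apply: eq_bigr => i _.
by rewrite big_ord1.
Qed.

Lemma stab_below n j (H : 'M[C]_n) (u : 'cV[C]_n) :
  stab j H -> below j u -> H *m u = u.
Proof.
move=> [_ He] uj; rewrite [u in RHS]cV_sum_delta {1}[u]cV_sum_delta mulmx_sumr.
apply: eq_bigr => a _; rewrite -scalemxAr.
by case: (ltnP a j) => [/He->//|/uj->]; rewrite !scale0r.
Qed.

Lemma col_entry n p (A : 'M[C]_(n, p)) (a : 'I_n) j :
  A a j = (adjmx (delta_mx a 0 : 'cV[C]_n) *m A) 0 j.
Proof.
rewrite !mxE (bigD1 a)//= big1 => [|i ia]; rewrite !mxE ?eqxx.
  by rewrite conjC1 mul1r addr0.
by rewrite (negPf ia) conjC0 mul0r.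
Qed.

(** The adjoint of [H] also fixes the first [j] basis vectors, so the coordinate [a < j] of [H *m u]
    is that of [u]. *)
Lemma stab_above n j (H : 'M[C]_n) (u : 'cV[C]_n) :
  stab j H -> above j u -> above j (H *m u).
Proof.
move=> /stab_adj[_ He] uj a aj; rewrite col_entry mulmxA.
rewrite -{1}[H]adjmxK -adjmxM He// -col_entry.
exact: uj.
Qed.

Section Reflection.
Variables (n : nat) (e v : 'cV[C]_n).

(* The complex reflection exchanging two unit vectors; when [v = e] the inverse
   is [0^-1 = 0] and this is the identity. *)
Definition reflection_mx : 'M[C]_n :=
  1%:M - ((adjmx (v - e) *m v) 0 0)^-1 *: ((v - e) *m adjmx (v - e)).

Hypotheses (e1 : nsq e = 1) (v1 : nsq v = 1).

Let unit_dot (u : 'cV[C]_n) : nsq u = 1 -> (adjmx u *m u) 0 0 = 1.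
Proof.
move=> u1; have := nsq_tr u; rewrite u1 => /esym.
by rewrite /mxtrace big_ord1.
Qed.

Let w := v - e.
Let ga := (adjmx w *m v) 0 0.

Let dotBl (x y z : 'cV[C]_n) :
  (adjmx (x - y) *m z) 0 0 = (adjmx x *m z) 0 0 - (adjmx y *m z) 0 0.
Proof.
by rewrite !mxE -sumrB; apply: eq_bigr => i _; rewrite !mxE rmorphB mulrBl.
Qed.

Let dotBr (x y z : 'cV[C]_n) :
  (adjmx x *m (y - z)) 0 0 = (adjmx x *m y) 0 0 - (adjmx x *m z) 0 0.
Proof.
by rewrite !mxE -sumrB; apply: eq_bigr => i _; rewrite !mxE mulrBr.
Qed.

Let gaE : ga = 1 - (adjmx e *m v) 0 0.
Proof. by rewrite /ga /w dotBl (unit_dot v1). Qed.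

(** For unit vectors the squared length of [w] is twice the real part of [ga], so [ga = 0] happens
    only for [v = e], where the default inverse gives the identity. *)
Let wwE : (adjmx w *m w) 0 0 = ga + Num.conj ga.
Proof.
have cE : (adjmx v *m e) 0 0 = Num.conj ((adjmx e *m v) 0 0).
  rewrite !mxE rmorph_sum; apply: eq_bigr => i _ /=.
  by rewrite !mxE [RHS]rmorphM /= conjCK mulrC.
rewrite gaE rmorphB rmorph1 /= -cE /w dotBl !dotBr (unit_dot e1) (unit_dot v1).
ring.
Qed.

Let ga0 : ga = 0 -> w = 0.
Proof.
move=> g0; apply: nsq_eq0; apply: (@complexI R); rewrite nsq_tr /mxtrace big_ord1.
by rewrite wwE g0 rmorph0 addr0.
Qed.

Lemma reflection_image : reflection_mx *m v = e.
Proof.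
rewrite /reflection_mx -/w -/ga mulmxBl mul1mx -scalemxAl -mulmxA.
have -> : adjmx w *m v = ga%:M by apply/matrixP=> i j; rewrite !ord1 [RHS]mxE eqxx.
rewrite mul_mx_scalar scalerA.
have [g0|g0] := eqVneq ga 0; last by rewrite mulVf// scale1r /w opprB addrC subrK.
have := ga0 g0 => w0; rewrite w0 scaler0 subr0.
by apply/eqP; rewrite -subr_eq0 -/w w0.
Qed.

Lemma reflection_unitary : reflection_mx \is unitarymx.
Proof.
apply/unitarymxP; rewrite /reflection_mx -/w -/ga.
have [g0|g0] := eqVneq ga 0.
  by rewrite (ga0 g0) mul0mx scaler0 subr0 adjmx1 mulmx1.
have g0' : Num.conj ga != 0 by rewrite fmorph_eq0.
have -> : adjmx (1%:M - ga^-1 *: (w *m adjmx w)) =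
    1%:M - Num.conj (ga^-1) *: (w *m adjmx w).
  rewrite linearB map_mxB adjmx1 linearZ /= map_mxZ; congr (_ - _ *: _).
  by rewrite adjmxM adjmxK.
have ww : w *m adjmx w *m (w *m adjmx w) = (ga + Num.conj ga) *: (w *m adjmx w).
  rewrite mulmxA -(mulmxA w).
  have -> : adjmx w *m w = (ga + Num.conj ga)%:M.
    by apply/matrixP=> i j; rewrite !ord1 [RHS]mxE eqxx wwE.
  by rewrite mul_mx_scalar scalemxAl.
move: (w *m adjmx w) ww => W ww.
rewrite mulmxBr mulmx1 mulmxBl mul1mx -scalemxAr -scalemxAl ww.
rewrite !scalerA -scalerBl -addrA -opprD -scalerDl.
have -> : Num.conj ga^-1 = (Num.conj ga)^-1 by exact: fmorphV.
have key (x y : C) : x != 0 -> y != 0 -> x^-1 + (y^-1 - y^-1 / x * (x + y)) = 0.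
  by move=> x0 y0; field; rewrite x0 y0.
by rewrite key// scale0r subr0.
Qed.

Lemma reflection_stab j : above j e -> above j v -> stab j reflection_mx.
Proof.
move=> ej vj; split=> [|a aj]; first exact: reflection_unitary.
rewrite /reflection_mx mulmxBl mul1mx -scalemxAl -mulmxA.
suff -> : adjmx (v - e) *m (delta_mx a 0 : 'cV_n) = 0 by rewrite mulmx0 scaler0 subr0.
rewrite -[LHS]adjmxK adjmxM adjmxK.
apply/matrixP => i k; rewrite !ord1 mxE [RHS]mxE mxE -col_entry !mxE.
by rewrite ej// vj// subr0 conjC0.
Qed.

End Reflection.

Lemma nsq_delta n (a : 'I_n) : nsq (delta_mx a 0 : 'cV[C]_n) = 1.
Proof.
rewrite nsq_col (bigD1 a)//= big1 => [|i ia]; rewrite !mxE ?eqxx.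
  by rewrite normc1 expr1n addr0.
by rewrite (negPf ia) normc0 expr0n.
Qed.

Lemma delta_above n j (a : 'I_n) : (j <= a)%N -> above j (delta_mx a 0 : 'cV[C]_n).
Proof.
move=> ja b bj; rewrite mxE (_ : b == a = false)//; apply/negP => /eqP ba.
by rewrite ba ltnNge ja in bj.
Qed.

(** The part of [u] on the first [j] coordinates is fixed by the stabilizer; the rest is reflected
    onto the direction of the [j]-th basis vector. *)
Lemma rotate_into n (j : 'I_n) (u : 'cV[C]_n) :
  exists2 D : 'M[C]_n, stab j D & below j.+1 (D *m u).
Proof.
pose z : 'cV[C]_n := \col_i (if (i < j)%N then 0 else u i 0).
have zj : above j z by move=> a aj; rewrite mxE aj.
have uz : below j (u - z) by move=> a aj; rewrite !mxE ltnNge aj subrr.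
have [z0|z0] := eqVneq (nsq z) 0.
  exists 1%:M; first exact: stab1.
  rewrite mul1mx => a aj; move: (uz a (ltnW aj)).
  by rewrite (nsq_eq0 z0) subr0.
pose c : R := Num.sqrt (nsq z).
have c0 : 0 < c by rewrite sqrtr_gt0 lt_def z0 nsq_ge0.
have cC0 : c%:C != 0 by rewrite (inj_eq (@complexI R)) gt_eqF.
pose v := c%:C^-1 *: z.
have v1 : nsq v = 1.
  rewrite nsqZ normcV normc_real gtr0_norm// exprVn sqr_sqrtr ?nsq_ge0//.
  by rewrite mulVf.
have vj : above j v by move=> a aj; rewrite mxE zj// mulr0.
pose e := delta_mx j 0 : 'cV[C]_n.
have ej : above j e by exact: delta_above.
have De := reflection_stab (nsq_delta j) v1 ej vj.
exists (reflection_mx e v) => // a aj.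
have -> : u = (u - z) + c%:C *: v by rewrite scalerA divff// scale1r subrK.
rewrite mulmxDr (stab_below De uz) -scalemxAr reflection_image ?nsq_delta//.
rewrite mxE (uz a (ltnW aj)) add0r !mxE.
by rewrite (_ : a == j = false) ?mulr0//; apply/negP => /eqP aj'; rewrite aj' ltnn in aj.
Qed.

End HermitianNorm.

(** * Orbits whose steps reveal one column at a time *)

Section Krylov.
Variable R : realType.
Local Notation C := R[i].
Variables (n : nat) (S : 'M[C]_n) (x y : 'cV[C]_n).
Local Notation e a := (delta_mx a 0 : 'cV[C]_n).

Definition orbit_vec (W : 'M[C]_n) k : 'cV[C]_n := (W *m S) ^+ k *m x.

Lemma orbit_vecS W k : orbit_vec W k.+1 = W *m (S *m orbit_vec W k).
Proof. by rewrite /orbit_vec exprS -!mulmxA. Qed.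

(* Under this invariant the first [j] steps of the orbit of [L *m H *m Q] do not
   depend on [H] in the stabilizer of the first [j] basis vectors. *)
Definition krylov_inv j (L Q : 'M[C]_n) : Prop :=
  [/\ L \is unitarymx, Q \is unitarymx &
   forall i, (i < j)%N -> below i.+1 (Q *m (S *m orbit_vec (L *m Q) i))].

(** Here [L *m e a] is a revealed column. Near orthogonality is asked after applying [S] because the
    growth of the orbit is read off the Gram matrix of the vectors [S *m L *m e a]. *)
Definition good_vec (b1 h : R) (a : 'I_n) (L : 'M[C]_n) : Prop :=
  [/\ nsq (S *m L *m e a) <= b1, normc ((adjmx y *m L *m e a) 0 0) <= h &
      forall b : 'I_n, (b < a)%N ->
        normc ((adjmx (S *m L *m e b) *m (S *m L *m e a)) 0 0) <= h].

Lemma below_le i j (u : 'cV[C]_n) : (i <= j)%N -> below i u -> below j u.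
Proof. by move=> ij bu a ja; apply/bu/leq_trans/ja. Qed.

(** At step [i < j] the matrix [H] is applied to a vector of the span of the first [i.+1] basis
    vectors, which it fixes. *)
Lemma orbit_stab j L Q H : krylov_inv j L Q -> stab j H ->
  forall i, (i <= j)%N -> orbit_vec (L *m H *m Q) i = orbit_vec (L *m Q) i.
Proof.
move=> [Lu Qu inv] Hj; elim=> [|i IH] ij; first by rewrite /orbit_vec !expr0.
rewrite !orbit_vecS (IH (ltnW ij)).
rewrite -!mulmxA; congr (_ *m _); apply: (stab_below Hj).
exact: below_le ij (inv i ij).
Qed.

(** [D] brings the newest vector into the span of the first [j.+1] basis vectors. It depends on [L]
    and [Q] only, so one [D] serves all [H], and since it lies in the stabilizer it can be absorbed
    into [H] there. *)
Lemma krylov_step (j : 'I_n) L Q : krylov_inv j L Q ->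
  exists2 D, stab j D & forall H, stab j H -> krylov_inv j.+1 (L *m H) (D *m Q).
Proof.
move=> inv; have [Lu Qu inv'] := inv.
have [D Dj Db] := rotate_into j (Q *m (S *m orbit_vec (L *m Q) j)).
exists D; first exact: Dj.
move=> H Hj; have HD := stabM Hj Dj.
split.
- exact: mul_unitarymx Lu (proj1 Hj).
- exact: mul_unitarymx (proj1 Dj) Qu.
move=> i; rewrite ltnS => ij.
have -> : L *m H *m (D *m Q) = L *m (H *m D) *m Q by rewrite !mulmxA.
rewrite (orbit_stab inv HD ij) -mulmxA.
move: ij; rewrite leq_eqVlt => /orP[/eqP ->//|ij].
rewrite (stab_below Dj); first exact: inv'.
exact: below_le ij (inv' i ij).
Qed.

Lemma below_l1_sqr j (g : 'cV[C]_n) : (j <= n)%N -> below j g ->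
  (\sum_a normc (g a 0)) ^+ 2 <= j%:R * nsq g.
Proof.
move=> jn gj.
have -> : \sum_a normc (g a 0) = \sum_(a < n) (if (a < j)%N then 1 else 0) * normc (g a 0).
  apply: eq_bigr => a _; case: ltnP => [_|/gj ->]; first by rewrite mul1r.
  by rewrite normc0 mulr0.
apply: le_trans (sum_cauchy _ _) _; rewrite -nsq_col ler_wpM2r ?nsq_ge0//.
have -> : \sum_(a < n) (if (a < j)%N then 1 else 0) ^+ 2 = \sum_(a < n | (a < j)%N) 1 :> R.
  rewrite [RHS]big_mkcond; apply: eq_bigr => a _.
  by case: ifP; rewrite ?expr1n ?expr0n.
by rewrite -(big_ord_widen n (fun=> 1) jn) sumr_const card_ord.
Qed.

(** The off-diagonal part of the Gram matrix contributes at most [h] times the squared sum of the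
    moduli of the coordinates of [g], and Cauchy-Schwarz on [j] coordinates turns this into
    [j%:R * h * nsq g]. *)
Lemma quad_form_le j (b1 h : R) (g : 'cV[C]_n) (Z : 'M[C]_n) :
  0 <= h -> (j <= n)%N -> below j g ->
  (forall a : 'I_n, (a < j)%N -> nsq (Z *m e a) <= b1) ->
  (forall a b : 'I_n, (a < j)%N -> (b < j)%N -> a != b ->
     normc ((adjmx (Z *m e a) *m (Z *m e b)) 0 0) <= h) ->
  nsq (Z *m g) <= (b1 + j%:R * h) * nsq g.
Proof.
move=> h0 jn gj Zb Zh.
pose q a b := (adjmx (Z *m e a) *m (Z *m e b)) 0 0.
have nE : (nsq (Z *m g))%:C = \sum_a \sum_b Num.conj (g a 0) * g b 0 * q a b.
  rewrite nsq_tr /mxtrace big_ord1 [in LHS](cV_sum_delta g) mulmx_sumr.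
  rewrite (raddf_sum (@trmx C n 1)) /= (raddf_sum (map_mx Num.conj)) /=.
  rewrite mulmx_suml summxE; apply: eq_bigr => a _.
  rewrite mulmx_sumr summxE; apply: eq_bigr => b _.
  rewrite -!scalemxAr mxE [(_ *: _)^T]linearZ /= map_mxZ -scalemxAl mxE.
  by rewrite mulrA (mulrC (g b 0)).
have nle : nsq (Z *m g) <= \sum_a \sum_b normc (g a 0) * normc (g b 0) * normc (q a b).
  rewrite -[leLHS]ger0_norm ?nsq_ge0// -normc_real nE.
  apply: le_trans (normc_sum _ _ _) _; apply: ler_sum => a _.
  apply: le_trans (normc_sum _ _ _) _; apply: ler_sum => b _.
  by rewrite !normcM normc_conj.
have g0 (a : 'I_n) : ~~ (a < j)%N -> normc (g a 0) = 0.
  by rewrite -leqNgt => /gj ->; rewrite normc0.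
have qaa (a : 'I_n) : (a < j)%N -> normc (q a a) <= b1.
  move=> aj; apply: le_trans (Zb a aj).
  have := nsq_tr (Z *m e a); rewrite /mxtrace big_ord1 /q => <-.
  by rewrite normc_real ger0_norm ?nsq_ge0.
apply: le_trans nle _.
pose G := \sum_(a < n) normc (g a 0).
have S1 (a : 'I_n) : \sum_b normc (g a 0) * normc (g b 0) * normc (q a b) <=
    b1 * normc (g a 0) ^+ 2 + h * normc (g a 0) * G.
  have [aj|aj] := boolP (a < j)%N; last first.
    rewrite g0// expr0n /= !mulr0 mul0r addr0 big1// => b _.
    by rewrite !mul0r.
  rewrite (bigD1 a)//= ; apply: lerD.
    by rewrite mulrC expr2 ler_wpM2r ?mulr_ge0 ?normc_ge0 ?qaa.
  rewrite mulr_sumr [leRHS](bigD1 a)//=.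
  apply: (@le_trans _ _ (\sum_(b | b != a) h * normc (g a 0) * normc (g b 0))).
    apply: ler_sum => b ba.
    have [bj|bj] := boolP (b < j)%N; last by rewrite (g0 b bj) !(mulr0, mul0r).
    rewrite mulrC -mulrA ler_wpM2r ?mulr_ge0 ?normc_ge0//.
    by apply: Zh; rewrite // eq_sym.
  by rewrite lerDr !mulr_ge0 ?normc_ge0.
apply: le_trans (ler_sum _ (fun a _ => S1 a)) _.
rewrite big_split /= -mulr_sumr -nsq_col -mulr_suml -mulr_sumr -/G.
rewrite mulrDl lerD2l -mulrA (mulrC j%:R) -mulrA ler_wpM2l//.
by rewrite -expr2; exact: below_l1_sqr.
Qed.

(** Each orbit vector is [L] applied to a combination of the first [j] basis vectors, so the
    estimates on the columns of [L] transfer to it. The first application of [S] acts on the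
    arbitrary vector [x]: there [M] replaces the growth factor, hence the exponent [k] for the
    vector of index [k.+1]. *)
Lemma krylov_growth j L Q (b1 h M : R) : 0 <= b1 -> 0 <= h -> (j <= n)%N ->
  krylov_inv j L Q -> (forall a : 'I_n, (a < j)%N -> good_vec b1 h a L) ->
  nsq (S *m x) <= M ->
  forall k, (k < j)%N ->
    nsq (orbit_vec (L *m Q) k.+1) <= M * (b1 + j%:R * h) ^+ k /\
    normc ((adjmx y *m orbit_vec (L *m Q) k.+1) 0 0) ^+ 2 <=
      j%:R * h ^+ 2 * (M * (b1 + j%:R * h) ^+ k).
Proof.
move=> b10 h0 jn [Lu Qu inv] good SM.
have be0 : 0 <= b1 + j%:R * h by rewrite addr_ge0// mulr_ge0.
pose g k := Q *m (S *m orbit_vec (L *m Q) k).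
have gE k : orbit_vec (L *m Q) k.+1 = L *m g k by rewrite orbit_vecS /g !mulmxA.
have gj k : (k < j)%N -> below j (g k) by move=> kj; exact: below_le kj (inv k kj).
have nE k : nsq (orbit_vec (L *m Q) k.+1) = nsq (S *m orbit_vec (L *m Q) k).
  by rewrite gE (nsq_unitaryl _ Lu) /g (nsq_unitaryl _ Qu).
have growth k : (k < j)%N -> nsq (orbit_vec (L *m Q) k.+1) <= M * (b1 + j%:R * h) ^+ k.
  elim: k => [|k IH] kj.
    by rewrite nE expr0 mulr1 /orbit_vec expr0 mul1mx.
  rewrite nE gE mulmxA exprSr mulrA.
  apply: (@le_trans _ _ ((b1 + j%:R * h) * nsq (g k))).
    apply: quad_form_le => // [|a aj|a b aj bj ab].
    - by apply: gj; exact: ltnW.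
    - by have [] := good a aj.
    - have [ba|ab'|/val_inj abE] := ltngtP b a; last by rewrite abE eqxx in ab.
        have [_ _ /(_ b ba)] := good a aj; apply: le_trans.
        have -> : adjmx (S *m L *m e a) *m (S *m L *m e b) =
          adjmx (adjmx (S *m L *m e b) *m (S *m L *m e a)).
          by rewrite [RHS]adjmxM adjmxK.
        by rewrite !mxE normc_conj.
      by have [_ _] := good b bj; exact.
  rewrite mulrC ler_wpM2r// -(nsq_unitaryl (g k) Lu) -gE.
  by apply: IH; exact: ltnW.
move=> k kj; split; first exact: growth.
have -> : (adjmx y *m orbit_vec (L *m Q) k.+1) 0 0 =
    \sum_a g k a 0 * (adjmx y *m L *m e a) 0 0.
  rewrite gE mulmxA [in LHS](cV_sum_delta (g k)) mulmx_sumr summxE.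
  by apply: eq_bigr => a _; rewrite -scalemxAr mxE.
have G0 : 0 <= \sum_a normc (g k a 0) by apply: sumr_ge0 => ? _; exact: normc_ge0.
apply: (@le_trans _ _ ((h * \sum_a normc (g k a 0)) ^+ 2)).
  rewrite lerXn2r ?nnegrE ?normc_ge0 ?mulr_ge0//.
  apply: le_trans (normc_sum _ _ _) _; rewrite mulr_sumr; apply: ler_sum => a _.
  rewrite normcM mulrC; have [aj|/(gj _ kj) ->] := ltnP a j; last first.
    by rewrite normc0 !mulr0.
  by rewrite ler_wpM2r ?normc_ge0//; have [] := good a aj.
rewrite exprMn [leRHS]mulrAC mulrC ler_wpM2r ?sqr_ge0//.
apply: le_trans (below_l1_sqr jn (gj k kj)) _; rewrite ler_wpM2l//.
by rewrite -(nsq_unitaryl (g k) Lu) -gE; exact: growth.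
Qed.

End Krylov.

(** * Measurability of matrix functions *)

Section ComplexMeasurable.
Variable R : realType.
Local Notation C := R[i].

Definition cmeas d (T : measurableType d) (f : T -> C) : Prop :=
  measurable_fun setT (fun t => complex.Re (f t)) /\
  measurable_fun setT (fun t => complex.Im (f t)).

Definition mxmeas d (T : measurableType d) m n (F : T -> 'M[C]_(m, n)) : Prop :=
  forall i j, cmeas (fun t => F t i j).

Section Closure.
Context d (T : measurableType d).
Implicit Types f g : T -> C.

Lemma cmeas_cst (c : C) : cmeas (fun _ : T => c).
Proof. by split; exact: measurable_cst. Qed.

Lemma cmeasD f g : cmeas f -> cmeas g -> cmeas (fun t => f t + g t).
Proof.
move=> [rf mf] [rg mg]; split.
  rewrite (_ : (fun t => _) = (fun t => complex.Re (f t) + complex.Re (g t))).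
    exact: measurable_funD.
  by apply/funext => t; case: (f t) (g t) => ? ? [].
rewrite (_ : (fun t => _) = (fun t => complex.Im (f t) + complex.Im (g t))).
  exact: measurable_funD.
by apply/funext => t; case: (f t) (g t) => ? ? [].
Qed.

Lemma cmeasM f g : cmeas f -> cmeas g -> cmeas (fun t => f t * g t).
Proof.
move=> [rf mf] [rg mg]; split.
  rewrite (_ : (fun t => _) = (fun t => complex.Re (f t) * complex.Re (g t)
     - complex.Im (f t) * complex.Im (g t))).
    by apply: measurable_funB; exact: measurable_funM.
  by apply/funext => t; case: (f t) (g t) => ? ? [].
rewrite (_ : (fun t => _) = (fun t => complex.Re (f t) * complex.Im (g t)
     + complex.Im (f t) * complex.Re (g t))).
  by apply: measurable_funD; exact: measurable_funM.
by apply/funext => t; case: (f t) (g t) => ? ? [].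
Qed.

Lemma cmeasN f : cmeas f -> cmeas (fun t => - f t).
Proof.
move=> mf; rewrite (_ : (fun t => - f t) = (fun t => -1 * f t)).
  by apply: cmeasM => //; exact: cmeas_cst.
by apply/funext => t; rewrite mulN1r.
Qed.

Lemma cmeas_conj f : cmeas f -> cmeas (fun t => Num.conj (f t)).
Proof.
move=> [rf mf]; split.
  by rewrite (_ : (fun t => _) = (fun t => complex.Re (f t)))//;
     apply/funext => t; case: (f t).
rewrite (_ : (fun t => _) = (fun t => - complex.Im (f t))).
  exact: measurable_funN.
by apply/funext => t; case: (f t).
Qed.

Lemma measurable_normc2 f : cmeas f -> measurable_fun setT (fun t => normc (f t) ^+ 2).
Proof.
move=> [rf mf].
rewrite (_ : (fun t => _) = (fun t => complex.Re (f t) ^+ 2 + complex.Im (f t) ^+ 2)).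
  by apply: measurable_funD; exact: measurable_funX.
apply/funext => t; case: (f t) => a b; rewrite /normc sqr_sqrtr//.
by rewrite addr_ge0 ?sqr_ge0.
Qed.

Lemma measurable_normc f : cmeas f -> measurable_fun setT (fun t => normc (f t)).
Proof.
move=> mf; rewrite (_ : (fun t => _) = Num.sqrt \o (fun t => normc (f t) ^+ 2)).
  apply: measurableT_comp; last exact: measurable_normc2.
  by apply: continuous_measurable_fun; exact: sqrt_continuous.
by apply/funext => t /=; rewrite sqrtr_sqr ger0_norm ?normc_ge0.
Qed.

Lemma cmeasV f : cmeas f -> cmeas (fun t => (f t)^-1).
Proof.
move=> mf; have [rf imf] := mf.
have mi : measurable_fun setT (fun t => (normc (f t) ^+ 2)^-1).
  (* The power function with exponent [-1] is measurable on the whole line and takes the default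
     value [0] at [0], as the inverse does. *)
  rewrite (_ : (fun t => _) = (@powR R ^~ (-1)) \o (fun t => normc (f t) ^+ 2)).
    by apply: measurableT_comp; [exact: measurable_powR|exact: measurable_normc2].
  by apply/funext => t /=; rewrite powR_inv1 ?sqr_ge0.
split.
  rewrite (_ : (fun t => _) = (fun t => complex.Re (f t) * (normc (f t) ^+ 2)^-1)).
    exact: measurable_funM.
  apply/funext => t; case: (f t) => a b; rewrite /normc /= sqr_sqrtr//=.
  by rewrite addr_ge0 ?sqr_ge0.
rewrite (_ : (fun t => _) = (fun t => - (complex.Im (f t) * (normc (f t) ^+ 2)^-1))).
  by apply: measurable_funN; exact: measurable_funM.
apply/funext => t; case: (f t) => a b; rewrite /normc /= sqr_sqrtr//=.
by rewrite addr_ge0 ?sqr_ge0.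
Qed.

Lemma cmeas_sum (I : Type) (s : seq I) (f : I -> T -> C) :
  (forall i, cmeas (f i)) -> cmeas (fun t => \sum_(i <- s) f i t).
Proof.
move=> mf; elim: s => [|i s IH].
  by under [X in cmeas X]funext do rewrite big_nil; exact: cmeas_cst.
by under [X in cmeas X]funext do rewrite big_cons; exact: cmeasD.
Qed.

Lemma cmeas_prod (I : Type) (s : seq I) (f : I -> T -> C) :
  (forall i, cmeas (f i)) -> cmeas (fun t => \prod_(i <- s) f i t).
Proof.
move=> mf; elim: s => [|i s IH].
  by under [X in cmeas X]funext do rewrite big_nil; exact: cmeas_cst.
by under [X in cmeas X]funext do rewrite big_cons; exact: cmeasM.
Qed.

Lemma mxmeas_cst m n (A : 'M[C]_(m, n)) : mxmeas (fun _ : T => A).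
Proof. by move=> i j; exact: cmeas_cst. Qed.

Lemma mxmeasD m n (F G : T -> 'M[C]_(m, n)) :
  mxmeas F -> mxmeas G -> mxmeas (fun t => F t + G t).
Proof.
move=> mF mG i j; under [X in cmeas X]funext do rewrite mxE.
exact: cmeasD.
Qed.

Lemma mxmeasN m n (F : T -> 'M[C]_(m, n)) : mxmeas F -> mxmeas (fun t => - F t).
Proof.
move=> mF i j; under [X in cmeas X]funext do rewrite mxE.
exact: cmeasN.
Qed.

Lemma mxmeasZ m n (f : T -> C) (F : T -> 'M[C]_(m, n)) :
  cmeas f -> mxmeas F -> mxmeas (fun t => f t *: F t).
Proof.
move=> mf mF i j; under [X in cmeas X]funext do rewrite mxE.
exact: cmeasM.
Qed.

Lemma mxmeasM m n p (F : T -> 'M[C]_(m, n)) (G : T -> 'M[C]_(n, p)) :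
  mxmeas F -> mxmeas G -> mxmeas (fun t => F t *m G t).
Proof.
move=> mF mG i j; under [X in cmeas X]funext do rewrite mxE.
by apply: cmeas_sum => k; exact: cmeasM.
Qed.

Lemma mxmeas_adj m n (F : T -> 'M[C]_(m, n)) :
  mxmeas F -> mxmeas (fun t => adjmx (F t)).
Proof.
move=> mF i j; under [X in cmeas X]funext do rewrite !mxE.
exact: cmeas_conj.
Qed.

Lemma mxmeasX n (F : T -> 'M[C]_n) k : mxmeas F -> mxmeas (fun t => F t ^+ k).
Proof.
move=> mF; elim: k => [|k IH].
  by under [X in mxmeas X]funext do rewrite expr0; exact: mxmeas_cst.
by under [X in mxmeas X]funext do rewrite exprS; exact: mxmeasM.
Qed.

Lemma cmeas_det n (F : T -> 'M[C]_n) : mxmeas F -> cmeas (fun t => \det (F t)).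
Proof.
move=> mF; rewrite /determinant; apply: cmeas_sum => s; apply: cmeasM.
  exact: cmeas_cst.
by apply: cmeas_prod => i; exact: mF.
Qed.

Lemma measurable_nsq m n (F : T -> 'M[C]_(m, n)) :
  mxmeas F -> measurable_fun setT (fun t => nsq (F t)).
Proof.
move=> mF; rewrite /nsq.
apply: measurable_sum => i; apply: measurable_sum => j.
exact: measurable_normc2.
Qed.

Lemma measurable_le (f : T -> R) (c : R) :
  measurable_fun setT f -> measurable [set t | f t <= c].
Proof.
move=> mf; rewrite -[X in measurable X]setTI.
rewrite (_ : [set t | f t <= c] = f @^-1` `]-oo, c]%classic).
  by apply: mf => //; exact: measurable_itv.
by rewrite set_itvE.
Qed.

Lemma measurable_gt (f : T -> R) (c : R) :
  measurable_fun setT f -> measurable [set t | c < f t].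
Proof.
move=> mf; rewrite (_ : [set t | c < f t] = ~` [set t | f t <= c]).
  exact/measurableC/measurable_le.
by apply/seteqP; split=> t /=; rewrite ltNge => /negP.
Qed.

Lemma cmxP n (F : T -> cmx R n) : measurable_fun setT F <-> mxmeas (F : T -> 'M[C]_n).
Proof.
split=> [mF i j|mF].
  split=> _ B mB.
    rewrite (_ : _ @^-1` B = F @^-1` [set A | B (complex.Re (A i j))])//.
    apply: (mF measurableT); apply: sub_sigma_algebra.
    by exists i, j, B; split=> //; left.
  rewrite (_ : _ @^-1` B = F @^-1` [set A | B (complex.Im (A i j))])//.
  apply: (mF measurableT); apply: sub_sigma_algebra.
  by exists i, j, B; split=> //; right.
apply: (@measurability _ _ T (cmx R n) setT F (@mx_coord_sets R n)) => //.
move=> _ [E [i [j [B [mB [] ->]]]] <-].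
  by have [+ _] := mF i j; apply.
by have [_ +] := mF i j; apply.
Qed.

End Closure.

Lemma mxmeas_id n : mxmeas (fun A : cmx R n => (A : 'M[C]_n)).
Proof. exact/cmxP/measurable_id. Qed.

Lemma mxmeas_comp d d' (T : measurableType d) (T' : measurableType d') m n
    (F : T' -> 'M[C]_(m, n)) (g : T -> T') :
  measurable_fun setT g -> mxmeas F -> mxmeas (F \o g).
Proof.
by move=> mg mF i j; have [r1 r2] := mF i j; split; [exact: (measurableT_comp r1)
  |exact: (measurableT_comp r2)].
Qed.

Lemma measurable_mxeq d (T : measurableType d) m n (F G : T -> 'M[C]_(m, n)) :
  mxmeas F -> mxmeas G -> measurable [set t | F t = G t].
Proof.
move=> mF mG.
rewrite (_ : [set t | F t = G t] = [set t | nsq (F t + - G t) <= 0]).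
  by apply/measurable_le/measurable_nsq/mxmeasD => //; exact: mxmeasN.
apply/seteqP; split=> t /= => [->|h].
  by rewrite subrr /nsq big1// => i _; rewrite big1// => j _; rewrite mxE normc0 expr0n.
apply/eqP; rewrite -subr_eq0; apply/eqP/nsq_eq0/eqP.
by rewrite eq_le h nsq_ge0.
Qed.

Lemma measurable_stab n j : measurable [set H : cmx R n | stab j (H : 'M[C]_n)].
Proof.
have mid := @mxmeas_id n.
rewrite (_ : [set H | _] = [set H : cmx R n | (H : 'M[C]_n) *m adjmx (H : 'M[C]_n) = 1%:M] `&`
  \bigcap_(a in [set a : 'I_n | (a < j)%N])
    [set H : cmx R n | (H : 'M[C]_n) *m (delta_mx a 0 : 'cV[C]_n) = delta_mx a 0]).
  apply: measurableI.
    by apply: measurable_mxeq; [apply: mxmeasM => //; exact: mxmeas_adj|exact: mxmeas_cst].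
  apply: fin_bigcap_measurable; first exact: finite_finset.
  move=> a _; apply: measurable_mxeq; last exact: mxmeas_cst.
  by apply: mxmeasM => //; exact: mxmeas_cst.
apply/seteqP; split=> H /=; first by move=> [/unitarymxP Hu He]; split.
by move=> [Hu He]; split; [exact/unitarymxP|exact: He].
Qed.

End ComplexMeasurable.

(** * A pointwise inequality behind the variance of quadratic forms *)

Section SecondMoment.
Variable R : realType.
Local Notation C := R[i].
Variable n : nat.
Local Notation e a := (delta_mx a 0 : 'cV[C]_n).

Lemma card_above j : (j <= n)%N -> \sum_(a < n | (j <= a)%N) 1 = (n - j)%:R :> R.
Proof.
move=> jn.
have : \sum_(a < n) 1 = n%:R :> R by rewrite sumr_const card_ord.
rewrite (bigID (fun a : 'I_n => (a < j)%N)) /= => h.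
move: h; rewrite -(big_ord_widen n (fun=> 1) jn) sumr_const card_ord => h.
rewrite natrB// -h addrC addrK; apply: eq_bigl => a.
by rewrite leqNgt.
Qed.

Lemma normcD_sqr (a b : C) :
  normc (a + b) ^+ 2 = normc a ^+ 2 + normc b ^+ 2 + 2 * complex.Re (Num.conj a * b).
Proof.
case: a b => [a1 a2] [b1 b2]; rewrite /normc /= !sqr_sqrtr ?addr_ge0 ?sqr_ge0//.
ring.
Qed.

Lemma Re_sqr_le (z : C) : complex.Re z ^+ 2 <= normc z ^+ 2.
Proof.
case: z => a b; rewrite /normc /= sqr_sqrtr ?addr_ge0 ?sqr_ge0//.
by rewrite lerDl sqr_ge0.
Qed.

Lemma Re_sum (I : Type) (s : seq I) (F : I -> C) :
  complex.Re (\sum_(i <- s) F i) = \sum_(i <- s) complex.Re (F i).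
Proof.
elim: s => [|i s IH]; rewrite ?big_nil ?big_cons// -IH.
by case: (F i) (\sum_(j <- s) F j) => [? ?] [? ?].
Qed.

Lemma nsqD m (x y : 'cV[C]_m) :
  nsq (x + y) = nsq x + nsq y + 2 * complex.Re ((adjmx x *m y) 0 0).
Proof.
rewrite !nsq_col mxE Re_sum mulr_sumr -!big_split; apply: eq_bigr => i _ /=.
by rewrite !mxE normcD_sqr.
Qed.

Lemma nsqN m k (x : 'M[C]_(m, k)) : nsq (- x) = nsq x.
Proof.
by apply: eq_bigr => i _; apply: eq_bigr => l _; rewrite mxE normcN.
Qed.

(* By polarization, these unit vectors recover the entries of [Z^* Z] from its
   quadratic form. *)
Definition test_vec (sg : bool) (a b : 'I_n) : 'cV[C]_n :=
  if a == b then e a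
  else ((Num.sqrt 2)^-1)%:C *: (if sg then e a + e b else e a - e b).

Lemma dot_delta (a b : 'I_n) : (adjmx (e a) *m e b) 0 0 = (a == b)%:R.
Proof. by rewrite -col_entry mxE eqxx andbT. Qed.

Lemma opp_mxE m k (M : 'M[C]_(m, k)) i l : (- M) i l = - M i l.
Proof. by rewrite mxE. Qed.

Lemma ReN (z : C) : complex.Re (- z) = - complex.Re z.
Proof. by case: z. Qed.

Lemma sqrt2V : (Num.sqrt 2)^-1 ^+ 2 = 2^-1 :> R.
Proof. by rewrite exprVn sqr_sqrtr. Qed.

Lemma nsq_test_vec sg a b : nsq (test_vec sg a b) = 1.
Proof.
rewrite /test_vec; have [_|ab] := eqVneq a b; first exact: nsq_delta.
rewrite nsqZ normc_real real_normK ?num_real// sqrt2V.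
have -> : nsq (if sg then e a + e b else e a - e b) = 2.
  case: sg; rewrite nsqD ?nsqN !nsq_delta ?mulmxN ?opp_mxE ?ReN dot_delta.
    by rewrite (negPf ab) mulr0 addr0.
  by rewrite (negPf ab) oppr0 mulr0 addr0.
by rewrite mulVf.
Qed.

Lemma above_test_vec j sg (a b : 'I_n) : (j <= a)%N -> (j <= b)%N ->
  above j (test_vec sg a b).
Proof.
move=> ja jb c cj.
have ha : e a c 0 = 0 by exact: delta_above cj.
have hb : e b c 0 = 0 by exact: delta_above cj.
rewrite /test_vec; case: ifP => _ //; rewrite mxE.
by case: sg; rewrite mxE ?opp_mxE ha hb ?oppr0 addr0 mulr0.
Qed.

(** Under a law invariant by the stabilizer all these squares have the same mean [I]. With
    [m = n - j] the inequality then averages to [2 * m ^ 2 * I <= m ^ 2 * I + 2 * nsq (adjmx Z *m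
    Z)], which bounds [I]. *)
Lemma pointwise_second_moment j (Z : 'M[C]_n) (tau : R) : (j <= n)%N ->
  \sum_(a < n | (j <= a)%N) (nsq (Z *m e a) - tau) = 0 ->
  \sum_(a < n | (j <= a)%N) \sum_(b < n | (j <= b)%N)
     ((nsq (Z *m test_vec true a b) - tau) ^+ 2 +
      (nsq (Z *m test_vec false a b) - tau) ^+ 2) <=
  (n - j)%:R * (\sum_(a < n | (j <= a)%N) (nsq (Z *m e a) - tau) ^+ 2) +
  2 * nsq (adjmx Z *m Z).
Proof.
move=> jn s0.
pose q a := nsq (Z *m e a) - tau.
pose p a b := normc ((adjmx Z *m Z) a b) ^+ 2.
(* For [a != b] the two signs give the half-sum of [q a] and [q b] plus or minus the real part of
   the entry [a, b] of [adjmx Z *m Z], so the cross terms cancel. For [a = b] both test vectors are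
   [e a]. *)
have T a b : (nsq (Z *m test_vec true a b) - tau) ^+ 2 +
      (nsq (Z *m test_vec false a b) - tau) ^+ 2 <= 2^-1 * (q a + q b) ^+ 2 + 2 * p a b.
  have p0 : 0 <= p a b by exact: sqr_ge0.
  rewrite /test_vec; have [->|ab] := eqVneq a b.
    rewrite -/(q b) in p0 *; rewrite -[X in X <= _]addr0.
    have -> : 2^-1 * (q b + q b) ^+ 2 = q b ^+ 2 + q b ^+ 2 by field.
    by rewrite lerD2l; have := sqr_ge0 (normc ((adjmx Z *m Z) b b)); rewrite /p; lra.
  rewrite -!scalemxAr !nsqZ normc_real real_normK ?num_real// sqrt2V.
  rewrite mulmxDr mulmxBr !nsqD nsqN mulmxN opp_mxE ReN.
  have -> : adjmx (Z *m e a) *m (Z *m e b) = adjmx (e a) *m ((adjmx Z *m Z) *m e b).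
    by rewrite adjmxM !mulmxA.
  have -> : (adjmx (e a) *m ((adjmx Z *m Z) *m e b)) 0 0 = (adjmx Z *m Z) a b.
    rewrite -col_entry mxE (bigD1 b)//= big1 => [|c cb]; rewrite ?mxE ?eqxx.
      by rewrite mulr1 addr0.
    by rewrite (negPf cb) mulr0.
  have := Re_sqr_le ((adjmx Z *m Z) a b); rewrite -/(p a b).
  move: (complex.Re _) => x xp.
  rewrite /q; move: (nsq (Z *m e a)) (nsq (Z *m e b)) => u v.
  have -> : (2^-1 * (u + v + 2 * x) - tau) ^+ 2 + (2^-1 * (u + v + 2 * - x) - tau) ^+ 2
     = 2^-1 * (u - tau + (v - tau)) ^+ 2 + 2 * x ^+ 2 by field.
  by rewrite lerD2l ler_pM2l.
apply: le_trans (ler_sum _ (fun a _ => ler_sum _ (fun b _ => T a b))) _.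
under eq_bigr do rewrite big_split -mulr_sumr -mulr_sumr /=.
rewrite big_split -mulr_sumr -mulr_sumr /=; apply: lerD; last first.
  rewrite ler_pM2l// /nsq [leRHS](bigID (fun a : 'I_n => (j <= a)%N)) /=.
  rewrite -[leLHS]addr0 lerD//; last first.
    by do 2!(apply: sumr_ge0 => ? _); exact: sqr_ge0.
  apply: ler_sum => a _; rewrite [leRHS](bigID (fun a : 'I_n => (j <= a)%N)) /=.
  by rewrite lerDl; apply: sumr_ge0 => ? _; exact: sqr_ge0.
(* Expanding the square isolates the square of the sum of the [q a], which the centering by [tau]
   makes zero. *)
have -> : \sum_(a < n | (j <= a)%N) \sum_(b < n | (j <= b)%N) (q a + q b) ^+ 2 =
   2 * ((n - j)%:R * \sum_(a < n | (j <= a)%N) q a ^+ 2)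
   + 2 * (\sum_(a < n | (j <= a)%N) q a) ^+ 2.
  transitivity (\sum_(a < n | (j <= a)%N) ((n - j)%:R * q a ^+ 2 +
      \sum_(b < n | (j <= b)%N) q b ^+ 2 + 2 * q a * \sum_(b < n | (j <= b)%N) q b)).
    apply: eq_bigr => a _; rewrite -(card_above jn) mulr_suml mulr_sumr -!big_split.
    by apply: eq_bigr => b _ /=; ring.
  rewrite big_split /= big_split /=.
  set Q1 := \sum_(a < n | (j <= a)%N) q a; set Q2 := \sum_(a < n | (j <= a)%N) q a ^+ 2.
  have -> : \sum_(a < n | (j <= a)%N) (n - j)%:R * q a ^+ 2 = (n - j)%:R * Q2.
    by rewrite -mulr_sumr.
  have -> : \sum_(a < n | (j <= a)%N) Q2 = (n - j)%:R * Q2.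
    by rewrite -(card_above jn) mulr_suml; apply: eq_bigr => a _; rewrite mul1r.
  have -> : \sum_(a < n | (j <= a)%N) 2 * q a * Q1 = 2 * Q1 * Q1.
    by rewrite -mulr_suml -mulr_sumr.
  ring.
by rewrite s0 expr0n /= mulr0 addr0 [2^-1 * _]mulrA mulVf// mul1r.
Qed.

End SecondMoment.

(** * Haar laws on stabilizers *)

Section ProbabilityTools.
Local Open Scope ereal_scope.
Context d (T : measurableType d) (R : realType) (P : probability T R).

Lemma image_law d' (T' : measurableType d') (f : T -> T') : measurable_fun setT f ->
  exists Q : probability T' R, forall B, measurable B -> Q B = P (f @^-1` B).
Proof.
move=> mf; pose X : {mfun T >-> T'} := HB.pack f (isMeasurableFun.Build _ _ _ _ _ mf).
by exists (distribution P X).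
Qed.

Lemma ae_prob1 (E : set T) : measurable E -> P E = 1 -> {ae P, forall x, E x}.
Proof.
move=> mE PE; exists (~` E); split=> //; first exact: measurableC.
by rewrite probability_setC// PE subee.
Qed.

Lemma prob1_ae (E : set T) : measurable E -> {ae P, forall x, E x} -> P E = 1.
Proof.
move=> mE [N [mN PN EN]].
have PC : P (~` E) = 0.
  by apply/eqP; rewrite eq_le measure_ge0 andbT -PN le_measure ?inE//; exact: measurableC.
by rewrite -[E]setCK probability_setC ?PC ?sube0//; exact: measurableC.
Qed.

Lemma prob_markov (f : T -> R) (c : R) : measurable_fun setT f ->
  (forall x, (0 <= f x)%R) -> (0 < c)%R ->
  c%:E * P [set x | (c < f x)%R] <= \int[P]_x (f x)%:E.
Proof.
move=> mf f0 c0.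
have mE : measurable [set x | (c < f x)%R] by exact: measurable_gt.
have h : \int[P]_x (c * \1_[set x | (c < f x)%R] x)%:E = c%:E * P [set x | (c < f x)%R].
  under eq_integral do rewrite EFinM.
  rewrite ge0_integralZl_EFin//; last exact: ltW.
    by rewrite integral_indic// setIT.
  by apply/measurable_EFinP; exact: measurable_indic.
rewrite -h; apply: ge0_le_integral => //.
- by move=> x _; rewrite lee_fin mulr_ge0 ?(ltW c0)// indicE.
- by apply/measurable_EFinP/measurable_funM => //; exact: measurable_indic.
- exact/measurable_EFinP.
move=> x _; rewrite lee_fin indicE.
have [|] := boolP (x \in _); rewrite ?mulr1 ?mulr0//.
by rewrite inE /= => /ltW.
Qed.

Lemma ae_integral_le (f : T -> R) (c : R) : measurable_fun setT f ->
  (forall x, (0 <= f x)%R) -> (0 <= c)%R -> {ae P, forall x, (f x <= c)%R} ->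
  \int[P]_x (f x)%:E <= c%:E.
Proof.
move=> mf f0 c0 fc.
have -> : c%:E = \int[P]_x (cst c%:E x) by rewrite integral_cst//= probability_setT mule1.
apply: ae_ge0_le_integral => //.
- by move=> x _; rewrite lee_fin.
- exact/measurable_EFinP.
by apply: filterS fc => x h _ /=; rewrite lee_fin.
Qed.

Lemma integral_sum_cond (I : Type) (s : seq I) (p : pred I) (f : I -> T -> R) :
  (forall i, measurable_fun setT (f i)) -> (forall i x, (0 <= f i x)%R) ->
  \int[P]_x (\sum_(i <- s | p i) f i x)%R%:E = \sum_(i <- s | p i) \int[P]_x (f i x)%:E.
Proof.
move=> mf f0; rewrite -big_filter -ge0_integral_sum//.
  by apply: eq_integral => x _; rewrite sumEFin big_filter.
  by move=> i; exact/measurable_EFinP.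
by move=> i x _; rewrite lee_fin.
Qed.

Lemma measurable_sum_cond (I : Type) (s : seq I) (p : pred I) (f : I -> T -> R) :
  (forall i, measurable_fun setT (f i)) ->
  measurable_fun setT (fun x => \sum_(i <- s | p i) f i x)%R.
Proof.
by move=> mf; under [X in measurable_fun _ X]funext do rewrite -big_filter;
  exact: measurable_sum.
Qed.

Lemma chebyshev_bound (p I : \bar R) (m c w : R) : (0 < m)%R -> (0 < c)%R ->
  p \is a fin_num -> c%:E * p <= I -> m%:E * I <= w%:E -> p <= (w / (m * c))%:E.
Proof.
move=> m0 c0 pf cpI mIw.
have : m%:E * (c%:E * p) <= w%:E by apply: le_trans mIw; rewrite lee_pmul2l.
rewrite -(fineK pf) -!EFinM !lee_fin => h.
by rewrite ler_pdivlMr ?mulr_gt0// mulrC -mulrA.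
Qed.

End ProbabilityTools.

Section StabLaw.
Variables (R : realType) (n : nat).
Local Notation C := R[i].
Local Notation e a := (delta_mx a 0 : 'cV[C]_n).
Local Notation lawT := (probability (cmx R n) R).
Implicit Types (lam : lawT) (H D L Q S : 'M[C]_n) (B : set (cmx R n)).

(** Haar measure of the stabilizer, recorded through its support and its invariance on the right,
    the side on which the rotations [D] of the orbit are inserted. *)
Definition stab_law j lam : Prop :=
  lam [set H | stab j (H : 'M[C]_n)] = 1%E /\
  forall D, stab j D -> forall B, measurable B ->
    lam [set H | B ((H : 'M[C]_n) *m D)] = lam B.

Lemma stab_law_ae j lam : stab_law j lam -> {ae lam, forall H, stab j (H : 'M[C]_n)}.
Proof. by move=> [l1 _]; apply: ae_prob1 => //; exact: measurable_stab. Qed.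

Lemma measurable_cmx d (T : measurableType d) (F : T -> 'M[C]_n) B :
  mxmeas F -> measurable B -> measurable [set t | B (F t)].
Proof.
move=> /(@cmxP R d T n F) mF mB; rewrite -[X in measurable X]setTI.
exact: mF.
Qed.

(** The reflection bringing [H *m e j] back to [e j], composed with [H], gives a random element of
    the next stabilizer. Multiplying [H] on the right by a [D] that fixes [e j] does not change the
    reflection, so the invariance is inherited. *)
Lemma stab_law_next (j : 'I_n) lam : stab_law j lam ->
  exists lam', stab_law j.+1 lam'.
Proof.
move=> [l1 linv].
pose f (H : cmx R n) : 'M[C]_n := reflection_mx (e j) ((H : 'M[C]_n) *m e j) *m (H : 'M[C]_n).
have mid := @mxmeas_id R n.
have mcol : mxmeas (fun H : cmx R n => (H : 'M[C]_n) *m e j).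
  by apply: mxmeasM => //; exact: mxmeas_cst.
have mw : mxmeas (fun H : cmx R n => (H : 'M[C]_n) *m e j - e j).
  by apply: mxmeasD => //; exact: mxmeas_cst.
have mf : mxmeas f.
  apply: mxmeasM => //; apply: mxmeasD; first exact: mxmeas_cst.
  apply: mxmeasN; apply: mxmeasZ.
    by apply: cmeasV; apply: mxmeasM => //; exact: mxmeas_adj.
  by apply: mxmeasM => //; exact: mxmeas_adj.
have [lam' lam'E] := image_law lam (proj2 (cmxP f) mf).
exists lam'; split.
  rewrite lam'E; last exact: measurable_stab.
  apply/eqP; rewrite eq_le probability_le1/=; last first.
    by apply: measurable_cmx => //; exact: measurable_stab.
  rewrite -l1; apply: le_measure; rewrite ?inE.
  - exact: measurable_stab.
  - by apply: measurable_cmx => //; exact: measurable_stab.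
  move=> H /= Hj; have v1 : nsq (H *m e j) = 1 by rewrite (nsq_unitaryl _ (proj1 Hj)) nsq_delta.
  have ej : above j (e j) by exact: delta_above.
  have Rj := reflection_stab (nsq_delta _ j) v1 ej (stab_above Hj ej).
  have RH := stabM Rj Hj.
  split=> [|a]; first exact: (proj1 RH).
  rewrite ltnS leq_eqVlt => /orP[/eqP/val_inj->|/(proj2 RH)//].
  by rewrite -mulmxA reflection_image ?nsq_delta.
move=> D Dj B mB; rewrite !lam'E//; last first.
  apply: (measurable_cmx _ mB); apply: mxmeasM => //; exact: mxmeas_cst.
have Dj' : stab j D by exact: stab_le (leqnSn j) Dj.
rewrite -(linv D Dj' (f @^-1` B)); last exact: measurable_cmx.
congr (lam _); apply/seteqP; split=> H /=; rewrite /f.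
  by rewrite -(mulmxA H D) (proj2 Dj)// mulmxA.
by rewrite -(mulmxA H D) (proj2 Dj)// mulmxA.
Qed.

(** After exchanging the integrals, the right invariance of [lam] removes each [H'] of the
    stabilizer, that is almost every one. *)
Lemma stab_law_fubini j lam lam' B : measurable B ->
  stab_law j lam -> lam' [set H | stab j (H : 'M[C]_n)] = 1%E ->
  (\int[lam]_H lam' [set H' | B ((H : 'M[C]_n) *m (H' : 'M[C]_n))] = lam B)%E
  /\ measurable_fun setT (fun H : cmx R n =>
       lam' [set H' | B ((H : 'M[C]_n) *m (H' : 'M[C]_n))]).
Proof.
move=> mB [_ linv] l'1.
pose A := [set HH : cmx R n * cmx R n | B ((HH.1 : 'M[C]_n) *m (HH.2 : 'M[C]_n))].
have mA : measurable A.
  apply: (measurable_cmx _ mB); apply: mxmeasM.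
    exact: (mxmeas_comp measurable_fst (@mxmeas_id R n)).
  exact: (mxmeas_comp measurable_snd (@mxmeas_id R n)).
have xE H : xsection A H = [set H' | B ((H : 'M[C]_n) *m (H' : 'M[C]_n))].
  by apply/seteqP; split=> H'; rewrite /xsection /= inE.
have yE H' : ysection A H' = [set H | B ((H : 'M[C]_n) *m (H' : 'M[C]_n))].
  by apply/seteqP; split=> H; rewrite /ysection /= inE.
split; last first.
  under [X in measurable_fun _ X]funext do rewrite -xE.
  exact: measurable_fun_xsection.
have := @indic_fubini_tonelli _ _ _ _ R lam lam' A mA.
rewrite indic_fubini_tonelli_FE// indic_fubini_tonelli_GE//=.
under eq_integral do rewrite xE; move=> ->.
have aeE : {ae lam', forall H', setT H' ->
    (lam (ysection A H') = cst (lam B) H')}.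
  have := ae_prob1 (@measurable_stab R n j) l'1; apply: filterS => H' H'j _.
  by rewrite yE linv.
rewrite (ae_eq_integral (cst (lam B)) _ _ _ _ aeE)//.
- rewrite integral_cst//= probability_setT mule1//.
- exact: measurable_fun_ysection.
Qed.

(* Multiplying [H] by an element of the next stabilizer preserves its law: the
   columns of a Haar unitary can be revealed one at a time. *)
Lemma exposure j lam lam' B (D L Q : 'M[C]_n) (good : set (cmx R n)) (c : R) :
  measurable B -> stab_law j lam -> lam' [set H | stab j (H : 'M[C]_n)] = 1%E ->
  stab j D -> measurable good -> 0 <= c ->
  (forall H, stab j H -> good H ->
     (lam' [set H' | B (L *m H *m (H' : 'M[C]_n) *m (D *m Q))] <= c%:E)%E) ->
  (lam [set H | B (L *m (H : 'M[C]_n) *m Q)] <= lam (~` good) + c%:E)%E.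
Proof.
move=> mB lj l'1 Dj mg c0 Hc.
have mB0 (D' : 'M[C]_n) : measurable [set H : cmx R n | B (L *m (H : 'M[C]_n) *m D')].
  apply: (measurable_cmx _ mB); apply: mxmeasM; last exact: mxmeas_cst.
  by apply: mxmeasM; [exact: mxmeas_cst|exact: mxmeas_id].
have [_ linv] := lj.
(* Invariance inserts [D], so that the conditional bound is only asked with [D *m Q], where the
   Krylov invariant of the next step holds. *)
rewrite -(linv D Dj _ (mB0 Q)) /=.
have -> : [set H : cmx R n | B (L *m ((H : 'M[C]_n) *m D) *m Q)] =
          [set H : cmx R n | B (L *m (H : 'M[C]_n) *m (D *m Q))].
  by apply/seteqP; split=> H /=; rewrite !mulmxA.
have [<- mphi] := stab_law_fubini (mB0 (D *m Q)) lj l'1.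
have ic : (\int[lam]_H (\1_(~` good) H + c)%R%:E = lam (~` good) + c%:E)%E.
  under eq_integral do rewrite EFinD.
  have mgC : measurable (~` good) by exact: measurableC.
  rewrite ge0_integralD//.
    by rewrite integral_indic// setIT integral_cst//= probability_setT mule1.
  by apply/measurable_EFinP; exact: measurable_indic.
rewrite -ic; apply: ae_ge0_le_integral => //.
- by move=> H _; rewrite lee_fin addr_ge0.
- apply/measurable_EFinP; apply: measurable_funD => //.
  by apply: measurable_indic; exact: measurableC.
apply: (@filterS _ _ (ae_filter_ringOfSetsType lam) _ _ _ (stab_law_ae lj)) => H Hj _ /=.
have [gH|gH] := pselect (good H).
  rewrite indicE memNset ?add0r; last by move=> /(_ gH).
  have -> : [set H' : cmx R n | B (L *m ((H : 'M[C]_n) *m (H' : 'M[C]_n)) *m (D *m Q))] =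
     [set H' : cmx R n | B (L *m (H : 'M[C]_n) *m (H' : 'M[C]_n) *m (D *m Q))].
    by apply/seteqP; split=> H' /=; rewrite !mulmxA.
  exact: Hc.
rewrite indicE mem_set//=; apply: (@le_trans _ _ 1%E); last by rewrite lee_fin lerDl.
apply: probability_le1; apply: (measurable_cmx _ mB).
apply: mxmeasM; last exact: mxmeas_cst.
apply: mxmeasM; first exact: mxmeas_cst.
by apply: mxmeasM; [exact: mxmeas_cst|exact: mxmeas_id].
Qed.

End StabLaw.

Lemma adde_fine (R : realType) (x : \bar R) : x \is a fin_num ->
  (x + x = (2 * fine x)%:E)%E.
Proof. by case: x => //= r _; rewrite -EFinD mulrDl mul1r. Qed.

Section StabMoments.
Variables (R : realType) (n : nat).
Local Notation C := R[i].
Local Notation e a := (delta_mx a 0 : 'cV[C]_n).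
Local Notation lawT := (probability (cmx R n) R).
Implicit Types (lam : lawT) (H D L Q S : 'M[C]_n) (B : set (cmx R n)).

Lemma stab_law_int j lam D (f : cmx R n -> R) : stab_law j lam -> stab j D ->
  measurable_fun setT f -> (forall H, 0 <= f H) ->
  (\int[lam]_H (f ((H : 'M[C]_n) *m D))%:E = \int[lam]_H (f H)%:E)%E.
Proof.
move=> [_ linv] Dj mf f0.
have mD : measurable_fun setT (fun H : cmx R n => ((H : 'M[C]_n) *m D) : cmx R n).
  by apply/cmxP; apply: mxmeasM; [exact: mxmeas_id|exact: mxmeas_cst].
have mfE : measurable_fun setT (EFin \o f) by exact/measurable_EFinP.
have := @ge0_integral_pushforward _ _ _ _ R _ mD lam setT (EFin \o f) measurableT mfE.
rewrite preimage_setT /= => <-; last by move=> H _; rewrite lee_fin.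
apply: eq_measure_integral => B mB _.
exact: linv.
Qed.

Lemma stab_transitive (j : 'I_n) (v : 'cV[C]_n) : nsq v = 1 -> above j v ->
  exists2 D : 'M[C]_n, stab j D & D *m e j = v.
Proof.
move=> v1 vj; have ej : above j (e j) by exact: delta_above.
have Rj := reflection_stab (nsq_delta _ j) v1 ej vj.
exists (adjmx (reflection_mx (e j) v)); first exact: stab_adj.
have := congr1 (mulmx (adjmx (reflection_mx (e j) v))) (reflection_image (nsq_delta _ j) v1).
by rewrite mulmxA (unitary_adjmx (proj1 Rj)) mul1mx.
Qed.

Lemma stab_law_vec (j : 'I_n) lam (v : 'cV[C]_n) (g : 'cV[C]_n -> R) :
  stab_law j lam -> nsq v = 1 -> above j v ->
  measurable_fun setT (fun H : cmx R n => g ((H : 'M[C]_n) *m e j)) ->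
  (forall u, 0 <= g u) ->
  (\int[lam]_H (g ((H : 'M[C]_n) *m v))%:E =
   \int[lam]_H (g ((H : 'M[C]_n) *m e j))%:E)%E.
Proof.
move=> lj v1 vj mg g0.
have [D Dj Dv] := stab_transitive v1 vj.
rewrite -(stab_law_int lj Dj mg)//.
by apply: eq_integral => H _; rewrite -mulmxA Dv.
Qed.

(** By Bessel the squared products of [y] with the columns [H *m e a], [j <= a], add up to at most
    [nsq y]. They all have the same mean, hence a mean of at most [nsq y / (n - j)%:R], and Markov's
    inequality applies. *)
Lemma stab_law_dot (j : 'I_n) lam (y : 'cV[C]_n) (c : R) : stab_law j lam -> 0 < c ->
  (lam [set H | c < normc ((adjmx y *m (H : 'M[C]_n) *m e j) 0 0) ^+ 2]%R
   <= (nsq y / ((n - j)%:R * c))%:E)%E.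
Proof.
move=> lj c0; have jn := ltn_ord j.
have m0 : 0 < (n - j)%:R :> R by rewrite ltr0n subn_gt0.
pose g (u : 'cV[C]_n) : R := normc ((adjmx y *m u) 0 0) ^+ 2.
have mgv v : measurable_fun setT (fun H : cmx R n => g ((H : 'M[C]_n) *m v)).
  apply: measurable_normc2; apply: mxmeasM; first exact: mxmeas_cst.
  by apply: mxmeasM; [exact: mxmeas_id|exact: mxmeas_cst].
have g0 u : 0 <= g u by exact: sqr_ge0.
have le1 : ((n - j)%:R%:E * \int[lam]_H (g ((H : 'M[C]_n) *m e j))%:E <= (nsq y)%:E)%E.
  have -> : ((n - j)%:R%:E * \int[lam]_H (g ((H : 'M[C]_n) *m e j))%:E =
      \sum_(a < n | (j <= a)%N) \int[lam]_H (g ((H : 'M[C]_n) *m e a))%:E)%E.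
    rewrite -(card_above R (ltnW jn)) -sumEFin ge0_sume_distrl//.
    apply: eq_bigr => a ja; rewrite mul1e; apply/esym/stab_law_vec => //.
      exact: nsq_delta.
    exact: delta_above.
  rewrite -integral_sum_cond//.
  apply: ae_integral_le.
  - exact: measurable_sum_cond.
  - by move=> H; exact: sumr_ge0.
  - exact: nsq_ge0.
  apply: (@filterS _ _ (ae_filter_ringOfSetsType lam) _ _ _ (stab_law_ae lj)) => H Hj.
  have -> : nsq y = nsq (adjmx y *m H) by rewrite (nsq_unitaryr _ (proj1 Hj)) nsq_adj.
  rewrite /nsq big_ord1 [leRHS](bigID (fun a : 'I_n => (j <= a)%N)) /=.
  rewrite -[leLHS]addr0 lerD//; last by apply: sumr_ge0 => ? _; exact: sqr_ge0.
  apply: ler_sum => a _; rewrite /g mulmxA.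
  rewrite (_ : (_ *m e a) 0 0 = (adjmx y *m H) 0 a)//.
  rewrite mxE (bigD1 a)//= big1 => [|b ba]; rewrite ?mxE ?eqxx ?mulr1 ?addr0//.
  by rewrite (negPf ba) mulr0.
have -> : [set H : cmx R n | c < normc ((adjmx y *m (H : 'M[C]_n) *m e j) 0 0) ^+ 2] =
    [set H : cmx R n | c < g ((H : 'M[C]_n) *m e j)].
  by apply/seteqP; split=> H /=; rewrite /g mulmxA.
apply: (chebyshev_bound m0 c0 _ (prob_markov lam (mgv (e j)) (fun H => g0 _) c0) le1).
by apply: fin_num_measure; exact: measurable_gt.
Qed.

(** Chebyshev's inequality around [tau]; the variance is not computed but bounded by averaging
    [pointwise_second_moment] over [H]. *)
Lemma stab_law_quad (j : 'I_n) lam (S : 'M[C]_n) (b2 eta : R) :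
  stab_law j lam -> 0 < eta -> nsq S <= b2 * (n - j)%:R ->
  (lam [set H | b2 + eta < nsq (S *m (H : 'M[C]_n) *m e j)]%R
   <= (2 * nsq (adjmx S *m S) / ((n - j)%:R ^+ 2 * eta ^+ 2))%:E)%E.
Proof.
move=> lj eta0 Sb; have jn := ltn_ord j.
set m : R := (n - j)%:R.
have m0 : 0 < m by rewrite ltr0n subn_gt0.
(* The columns of [S *m H] before [j] are those of [S], and its squared norm is that of [S]. So
   [tau] is the average of the squared norms of the remaining columns for every [H] of the
   stabilizer. *)
pose tau := (nsq S - \sum_(a < n | (a < j)%N) nsq (S *m e a)) / m.
have tau_le : tau <= b2.
  rewrite ler_pdivrMr//; apply: le_trans Sb; rewrite gerBl.
  by apply: sumr_ge0 => ? _; exact: nsq_ge0.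
pose g (u : 'cV[C]_n) : R := (nsq (S *m u) - tau) ^+ 2.
have mgv v : measurable_fun setT (fun H : cmx R n => g ((H : 'M[C]_n) *m v)).
  apply: measurable_funX; apply: measurable_funB => //.
  apply: measurable_nsq; apply: mxmeasM; first exact: mxmeas_cst.
  by apply: mxmeasM; [exact: mxmeas_id|exact: mxmeas_cst].
have g0 u : 0 <= g u by exact: sqr_ge0.
pose I := (\int[lam]_H (g ((H : 'M[C]_n) *m e j))%:E)%E.
have I_ge0 : (0 <= I)%E by apply: integral_ge0 => H _; rewrite lee_fin.
have lae := stab_law_ae lj.
(* The final inequality has [I] on both sides, so its finiteness is needed before subtracting. *)
have I_fin : I \is a fin_num.
  rewrite ge0_fin_numE//; apply: (@le_lt_trans _ _ ((nsq S + `|tau|) ^+ 2)%:E); last exact: ltry.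
  apply: ae_integral_le => //; first exact: sqr_ge0.
  apply: (@filterS _ _ (ae_filter_ringOfSetsType lam) _ _ _ lae) => H Hj.
  rewrite /g -[leLHS]real_normK ?num_real// lerXn2r ?nnegrE ?addr_ge0 ?nsq_ge0//.
  apply: le_trans (ler_normB _ _) _; rewrite lerD2r ger0_norm ?nsq_ge0//.
  apply: le_trans (nsqM _ _) _.
  by rewrite (nsq_unitaryl _ (proj1 Hj)) nsq_delta mulr1.
have gI v : nsq v = 1 -> above j v -> (\int[lam]_H (g ((H : 'M[C]_n) *m v))%:E)%E = I.
  by move=> v1 vj; exact: stab_law_vec.
pose F (H : cmx R n) : R := \sum_(a < n | (j <= a)%N) \sum_(b < n | (j <= b)%N)
  (g ((H : 'M[C]_n) *m test_vec R true a b) + g ((H : 'M[C]_n) *m test_vec R false a b)).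
pose W := nsq (adjmx S *m S).
have W0 : 0 <= W by exact: nsq_ge0.
pose G (H : cmx R n) : R := m * (\sum_(a < n | (j <= a)%N) g ((H : 'M[C]_n) *m e a)) + 2 * W.
have FI : (\int[lam]_H (F H)%:E = (2 * m ^+ 2 * fine I)%:E)%E.
  rewrite integral_sum_cond; last 2 first.
  - move=> a; apply: measurable_sum_cond => b; exact: measurable_funD.
  - by move=> a H; apply: sumr_ge0 => b _; rewrite addr_ge0.
  transitivity (\sum_(a < n | (j <= a)%N) \sum_(b < n | (j <= b)%N) (2 * fine I)%:E)%E.
    apply: eq_bigr => a ja; rewrite integral_sum_cond; last 2 first.
    - by move=> b; exact: measurable_funD.
    - by move=> b H; rewrite addr_ge0.
    apply: eq_bigr => b jb; under eq_integral do rewrite EFinD.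
    rewrite ge0_integralD//; last first.
    - exact/measurable_EFinP.
    - by move=> H _; rewrite lee_fin.
    - exact/measurable_EFinP.
    - by move=> H _; rewrite lee_fin.
    have vI sg : (\int[lam]_H (g ((H : 'M[C]_n) *m test_vec R sg a b))%:E)%E = I.
      exact: gI (nsq_test_vec R sg a b) (above_test_vec R sg ja jb).
    by rewrite -(adde_fine I_fin) -{1}(vI true) -(vI false).
  under eq_bigr do rewrite sumEFin; rewrite sumEFin; congr _%:E.
  have -> : \sum_(a < n | (j <= a)%N) \sum_(b < n | (j <= b)%N) 2 * fine I =
     \sum_(a < n | (j <= a)%N) 1 * (\sum_(b < n | (j <= b)%N) 1 * (2 * fine I)).
    by apply: eq_bigr => a _; rewrite mul1r; apply: eq_bigr => b _; rewrite mul1r.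
  by rewrite -!mulr_suml (card_above R (ltnW jn)) -/m; ring.
have GI : (\int[lam]_H (G H)%:E = (m ^+ 2 * fine I + 2 * W)%:E)%E.
  under eq_integral do rewrite EFinD.
  have mS : measurable_fun setT (fun H : cmx R n => \sum_(a < n | (j <= a)%N) g ((H : 'M[C]_n) *m e a)).
    exact: measurable_sum_cond.
  have S0 (H : cmx R n) : 0 <= \sum_(a < n | (j <= a)%N) g ((H : 'M[C]_n) *m e a).
    exact: sumr_ge0.
  rewrite ge0_integralD//; last first.
  - by move=> H _; rewrite lee_fin mulr_ge0.
  - by apply/measurable_EFinP; exact: measurable_funM.
  - by move=> H _; rewrite lee_fin mulr_ge0// ltW.
  rewrite integral_cst//= probability_setT mule1.
  under eq_integral do rewrite EFinM.
  rewrite ge0_integralZl_EFin//; last first.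
  - exact/measurable_EFinP.
  - by move=> H _; rewrite lee_fin.
  rewrite integral_sum_cond//.
  have -> : (\sum_(a < n | (j <= a)%N) \int[lam]_H (g ((H : 'M[C]_n) *m e a))%:E =
     (m * fine I)%:E)%E.
    transitivity (\sum_(a < n | (j <= a)%N) (1 * fine I)%:E)%E.
      apply: eq_bigr => a ja; rewrite gI ?nsq_delta//; last exact: delta_above.
      by rewrite mul1r fineK.
    by rewrite sumEFin -mulr_suml (card_above R (ltnW jn)).
  by rewrite -EFinM -EFinD mulrA expr2.
have FG : (\int[lam]_H (F H)%:E <= \int[lam]_H (G H)%:E)%E.
  apply: ae_ge0_le_integral => //.
  - move=> H _; rewrite lee_fin; do 2!(apply: sumr_ge0 => ? _).
    by rewrite addr_ge0.
  - apply/measurable_EFinP; do 2!(apply: measurable_sum_cond => ?).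
    exact: measurable_funD.
  - move=> H _; rewrite lee_fin addr_ge0// mulr_ge0// ?(ltW m0)//.
    exact: sumr_ge0.
  - apply/measurable_EFinP; apply: measurable_funD => //; apply: measurable_funM => //.
    exact: measurable_sum_cond.
  apply: (@filterS _ _ (ae_filter_ringOfSetsType lam) _ _ _ lae) => H Hj _.
  rewrite lee_fin /F /G /g /m.
  have s0 : \sum_(a < n | (j <= a)%N) (nsq (S *m H *m e a) - tau) = 0.
    rewrite sumrB; have -> : \sum_(a < n | (j <= a)%N) tau = nsq S - \sum_(a < n | (a < j)%N) nsq (S *m e a).
      transitivity (\sum_(a < n | (j <= a)%N) 1 * tau); first by apply: eq_bigr => ? _; rewrite mul1r.
      rewrite -mulr_suml (card_above R (ltnW jn)) -/m /tau mulrCA mulfV ?mulr1//.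
      by rewrite gt_eqF.
    apply/eqP; rewrite subr_eq0; apply/eqP.
    have -> : nsq S = \sum_(a < n) nsq (S *m H *m e a).
      rewrite -(nsq_unitaryr S (proj1 Hj)) nsq_col_sum; apply: eq_bigr => a _.
      by rewrite colE.
    rewrite [X in _ = X - _](bigID (fun a : 'I_n => (a < j)%N)) /=.
    have -> : \sum_(a < n | (a < j)%N) nsq (S *m H *m e a) = \sum_(a < n | (a < j)%N) nsq (S *m e a).
      by apply: eq_bigr => a aj; rewrite -mulmxA (proj2 Hj).
    rewrite addrC addrK; apply: eq_bigl => a; by rewrite leqNgt.
  have := pointwise_second_moment (ltnW jn) s0.
  have -> : nsq (adjmx (S *m H) *m (S *m H)) = W.
    rewrite adjmxM -mulmxA (mulmxA (adjmx S)) (mulmxA (adjmx H)) (nsq_unitaryr _ (proj1 Hj)).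
    by rewrite (@nsq_unitaryl R n n (adjmx H))// trmxC_unitary; exact: (proj1 Hj).
  by under eq_bigr do under eq_bigr do rewrite -!mulmxA; under [X in _ <= _ * X + _ -> _]eq_bigr do rewrite -mulmxA.
move: FG; rewrite FI GI lee_fin => FG.
have I_le : ((m ^+ 2)%:E * I <= (2 * W)%:E)%E.
  by rewrite -(fineK I_fin) -EFinM lee_fin; lra.
have sub : [set H : cmx R n | b2 + eta < nsq (S *m (H : 'M[C]_n) *m e j)] `<=`
    [set H : cmx R n | eta ^+ 2 < g ((H : 'M[C]_n) *m e j)].
  move=> H /= h; rewrite /g mulmxA ltrXn2r ?nnegrE//; lra.
apply: (@le_trans _ _ (lam [set H : cmx R n | eta ^+ 2 < g ((H : 'M[C]_n) *m e j)])).
  apply: le_measure => //; rewrite inE.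
    by apply: measurable_gt; apply: measurable_nsq; apply: mxmeasM;
      [apply: mxmeasM; [exact: mxmeas_cst|exact: mxmeas_id]|exact: mxmeas_cst].
  exact: measurable_gt.
have m20 : 0 < m ^+ 2 by rewrite exprn_gt0.
have eta20 : 0 < eta ^+ 2 by rewrite exprn_gt0.
apply: (chebyshev_bound m20 eta20 _
  (prob_markov lam (mgv (e j)) (fun H => g0 _) eta20) I_le).
by apply: fin_num_measure; exact: measurable_gt.
Qed.

End StabMoments.

(** * Orbits of a Haar unitary *)

Section UnionBound.
Local Open Scope ereal_scope.
Context d (T : measurableType d) (R : realType) (P : probability T R).

Lemma union_bound (I : eqType) (s : seq I) (E : set T) (A : I -> set T) (c : I -> R) :
  measurable E -> (forall i, measurable (A i)) ->
  (forall x, E x -> exists2 i, i \in s & A i x) ->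
  (forall i, i \in s -> P (A i) <= (c i)%:E) ->
  P E <= (\sum_(i <- s) c i)%R%:E.
Proof.
move=> mE mA EA Pc.
elim: s E mE EA Pc => [|i s IH] E mE EA Pc.
  have -> : E = set0 by apply/seteqP; split=> // x /EA[].
  by rewrite measure0 big_nil.
rewrite big_cons EFinD.
have mEA : measurable (E `\` A i) by exact: measurableD.
have h1 : P (E `\` A i) <= (\sum_(j <- s) c j)%R%:E.
  apply: IH => //; last by move=> j js; apply: Pc; rewrite inE js orbT.
  move=> x [/EA[k]]; rewrite inE => /orP[/eqP -> //|ks] Akx _.
  by exists k.
apply: (@le_trans _ _ (P (A i `|` (E `\` A i)))).
  apply: le_measure; rewrite ?inE//; first exact: measurableU.
  by move=> x Ex; have [|] := pselect (A i x); [left|right].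
apply: le_trans (measureU2 _ _ _) _ => //.
by apply: leeD => //; apply: Pc; exact: mem_head.
Qed.

End UnionBound.

Lemma size_ord_lt n j : (size [seq b : 'I_n <- enum 'I_n | (b < j)%N] <= j)%N.
Proof.
rewrite -(size_map val) -[leqRHS](size_iota 0 j); apply: uniq_leq_size.
  by rewrite (map_inj_uniq val_inj) filter_uniq ?enum_uniq.
by move=> i /mapP[b]; rewrite mem_filter mem_iota => /andP[bj _] ->.
Qed.

Lemma sqr_le_le (R : realType) (u v : R) : 0 <= u -> 0 <= v -> u ^+ 2 <= v ^+ 2 -> u <= v.
Proof. by move=> u0 v0; rewrite ler_pXn2r. Qed.

Section KrylovProbability.
Variables (R : realType) (n : nat).
Local Notation C := R[i].
Local Notation e a := (delta_mx a 0 : 'cV[C]_n).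
Local Notation lawT := (probability (cmx R n) R).
Variables (S : 'M[C]_n) (K : nat) (b2 h eta Msq W0 : R).
Hypotheses (Kn : (K < n)%N) (b2_ge0 : 0 <= b2) (h_gt0 : 0 < h) (eta_gt0 : 0 < eta)
  (Msq_ge0 : 0 <= Msq) (W0_ge0 : 0 <= W0).
Hypothesis S_op : forall z : 'cV[C]_n, nsq (S *m z) <= Msq * nsq z.
Hypothesis S_adj : forall z : 'cV[C]_n, nsq (adjmx S *m z) <= Msq * nsq z.
Hypothesis S_nsq : nsq S <= b2 * (n - K)%:R.
Hypothesis S_W0 : nsq (adjmx S *m S) <= W0.

Definition growth_rate : R := b2 + eta + K%:R * h.

(** The first term comes from [stab_law_quad]. The second is [stab_law_dot] for [y], of squared norm
    [v], and for at most [K] vectors attached to earlier columns, of squared norm at most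
    [Msq ^+ 2]. Throughout, [n - K] bounds below the dimension left at a step [j < K]. *)
Definition step_error (v : R) : R :=
  2 * W0 / ((n - K)%:R ^+ 2 * eta ^+ 2) + (v + K%:R * Msq ^+ 2) / ((n - K)%:R * h ^+ 2).

Section FixedVectors.
Variables (x y : 'cV[C]_n).

Definition bad_orbit : set (cmx R n) :=
  [set W : cmx R n | exists2 k, (k < K)%N &
    Msq * nsq x * growth_rate ^+ k < nsq (orbit_vec S x (W : 'M[C]_n) k.+1) \/
    K%:R * h ^+ 2 * (Msq * nsq x * growth_rate ^+ k) <
      normc ((adjmx y *m orbit_vec S x (W : 'M[C]_n) k.+1) 0 0) ^+ 2].

Lemma mxmeas_orbit d (T : measurableType d) (F : T -> 'M[C]_n) k : mxmeas F ->
  mxmeas (fun t => orbit_vec S x (F t) k).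
Proof.
move=> mF; apply: mxmeasM; last exact: mxmeas_cst.
by apply: mxmeasX; apply: mxmeasM => //; exact: mxmeas_cst.
Qed.

Lemma measurable_bad_orbit : measurable bad_orbit.
Proof.
rewrite (_ : bad_orbit = \bigcup_(k in [set k | (k < K)%N])
  ([set W : cmx R n | Msq * nsq x * growth_rate ^+ k < nsq (orbit_vec S x (W : 'M[C]_n) k.+1)] `|`
   [set W : cmx R n | K%:R * h ^+ 2 * (Msq * nsq x * growth_rate ^+ k) <
      normc ((adjmx y *m orbit_vec S x (W : 'M[C]_n) k.+1) 0 0) ^+ 2])).
  apply: bigcup_measurable => k _; apply: measurableU; apply: measurable_gt.
    by apply: measurable_nsq; apply: mxmeas_orbit; exact: mxmeas_id.
  apply: measurable_normc2; apply: mxmeasM; first exact: mxmeas_cst.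
  by apply: mxmeas_orbit; exact: mxmeas_id.
by apply/seteqP; split=> W [k kK H]; exists k.
Qed.

Let nK0 : 0 < (n - K)%:R :> R.
Proof. by rewrite ltr0n subn_gt0. Qed.

Let nKj j : (j < K)%N -> (n - K)%:R <= (n - j)%:R :> R.
Proof. by move=> jK; rewrite ler_nat leq_sub2l// ltnW. Qed.

Let inv_le (u v p q : R) : 0 <= u <= p -> 0 < q <= v -> u / v <= p / q.
Proof.
move=> /andP[u0 up] /andP[q0 qv]; apply: ler_pM => //.
  by rewrite invr_ge0 (le_trans (ltW q0)).
by rewrite lef_pV2 ?posrE// (lt_le_trans q0).
Qed.

Lemma exposure_error (j : 'I_n) (lam : lawT) (L : 'M[C]_n) : (j < K)%N ->
  stab_law j lam -> L \is unitarymx ->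
  exists2 good : set (cmx R n), measurable good &
    (lam (~` good) <= (step_error (nsq y))%:E)%E /\
    forall H : 'M[C]_n, stab j H -> good H -> good_vec S y (b2 + eta) h j (L *m H).
Proof.
move=> jK lj Lu.
have LuA : adjmx L \is unitarymx by rewrite (trmxC_unitary L).
(* Moving [S *m L] to the other side of the scalar product turns near orthogonality of two images
   into near orthogonality of the new column to the fixed vector [yb b], as [stab_law_dot]
   requires. *)
have [yb ybE ybN] : exists2 yb : 'I_n -> 'cV[C]_n,
    forall b, adjmx (yb b) = adjmx (S *m L *m e b) *m (S *m L) &
    forall b, nsq (yb b) <= Msq ^+ 2.
  exists (fun b => adjmx (S *m L) *m (S *m L *m e b)) => b.
    by rewrite [LHS]adjmxM adjmxK.
  rewrite adjmxM -mulmxA (nsq_unitaryl _ LuA).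
  apply: le_trans (S_adj _) _; rewrite expr2 ler_wpM2l//.
  rewrite -mulmxA; apply: le_trans (S_op _) _.
  by rewrite (nsq_unitaryl _ Lu) nsq_delta mulr1.
have [y' y'E y'N] : exists2 y' : 'cV[C]_n, adjmx y' = adjmx y *m L & nsq y' = nsq y.
  exists (adjmx L *m y); first by rewrite [LHS]adjmxM adjmxK.
  exact: (nsq_unitaryl _ LuA).
pose good := [set H : cmx R n | [/\ nsq (S *m L *m (H : 'M[C]_n) *m e j) <= b2 + eta,
   normc ((adjmx y' *m (H : 'M[C]_n) *m e j) 0 0) ^+ 2 <= h ^+ 2 &
   forall b : 'I_n, (b < j)%N -> normc ((adjmx (yb b) *m (H : 'M[C]_n) *m e j) 0 0) ^+ 2 <= h ^+ 2]].
have mH v : mxmeas (fun H : cmx R n => (v : 'M[C]_n) *m (H : 'M[C]_n) *m e j).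
  by apply: mxmeasM; [apply: mxmeasM; [exact: mxmeas_cst|exact: mxmeas_id]|exact: mxmeas_cst].
have mr (v : 'rV[C]_n) : mxmeas (fun H : cmx R n => v *m (H : 'M[C]_n) *m e j).
  by apply: mxmeasM; [apply: mxmeasM; [exact: mxmeas_cst|exact: mxmeas_id]|exact: mxmeas_cst].
have mN (v : 'cV[C]_n) : measurable_fun setT
    (fun H : cmx R n => normc ((adjmx v *m (H : 'M[C]_n) *m e j) 0 0) ^+ 2).
  by apply: measurable_normc2; exact: mr.
have mgood : measurable good.
  rewrite (_ : good = [set H : cmx R n | nsq (S *m L *m (H : 'M[C]_n) *m e j) <= b2 + eta] `&`
    ([set H : cmx R n | normc ((adjmx y' *m (H : 'M[C]_n) *m e j) 0 0) ^+ 2 <= h ^+ 2] `&`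
    \bigcap_(b in [set b : 'I_n | (b < j)%N])
      [set H : cmx R n | normc ((adjmx (yb b) *m (H : 'M[C]_n) *m e j) 0 0) ^+ 2 <= h ^+ 2])).
    apply: measurableI; first by apply: measurable_le; exact: measurable_nsq.
    apply: measurableI; first exact: measurable_le.
    apply: fin_bigcap_measurable; first exact: finite_finset.
    by move=> b _; exact: measurable_le.
  by apply/seteqP; split=> H [h1]; [move=> h2 h3|move=> [h2 h3]]; split.
exists good => //; split; last first.
  move=> H Hj [g1 g2 g3]; split.
  - by rewrite (mulmxA S L H).
  - rewrite mulmxA -y'E.
    by apply: sqr_le_le g2; [exact: normc_ge0|exact: ltW].
  - move=> b bj; rewrite (mulmxA S L H).
    have -> : S *m L *m H *m e b = S *m L *m e b.
      by rewrite -mulmxA (proj2 Hj).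
    rewrite !mulmxA -(mulmxA _ S L) -ybE.
    by apply: sqr_le_le (g3 b bj); [exact: normc_ge0|exact: ltW].
pose A (i : option (option 'I_n)) : set (cmx R n) := match i with
  | None => [set H : cmx R n | b2 + eta < nsq (S *m L *m (H : 'M[C]_n) *m e j)]
  | Some None => [set H : cmx R n | h ^+ 2 < normc ((adjmx y' *m (H : 'M[C]_n) *m e j) 0 0) ^+ 2]
  | Some (Some b) => [set H : cmx R n | h ^+ 2 < normc ((adjmx (yb b) *m (H : 'M[C]_n) *m e j) 0 0) ^+ 2]
  end.
pose c (i : option (option 'I_n)) : R := match i with
  | None => 2 * W0 / ((n - K)%:R ^+ 2 * eta ^+ 2)
  | Some None => nsq y / ((n - K)%:R * h ^+ 2)
  | Some (Some b) => Msq ^+ 2 / ((n - K)%:R * h ^+ 2)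
  end.
pose s : seq (option (option 'I_n)) := None :: Some None :: [seq Some (Some b) | b : 'I_n <- [seq b : 'I_n <- enum 'I_n | (b < j)%N]].
have mA i : measurable (A i).
  by case: i => [[b|]|]; apply: measurable_gt => //; exact: measurable_nsq.
have sum_c : \sum_(i <- s) c i <= step_error (nsq y).
  rewrite /s !big_cons big_map /step_error lerD2l mulrDl lerD2l /=.
  rewrite big_const_seq count_predT iter_addr_0 -[leLHS]mulr_natl.
  rewrite -[leRHS]mulrA ler_wpM2r//.
    by rewrite divr_ge0 ?exprn_ge0// mulr_ge0 ?exprn_ge0// ltW.
  by rewrite ler_nat (leq_trans (size_ord_lt _ _) (ltnW jK)).
apply: (@le_trans _ _ (\sum_(i <- s) c i)%:E); last by rewrite lee_fin.
apply: (union_bound (A := A)) => //; first exact: measurableC.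
  move=> H /=; apply: contra_notP => nA; split.
  - rewrite leNgt; apply/negP => h1; apply: nA.
    by exists None; [rewrite !inE|exact: h1].
  - rewrite leNgt; apply/negP => h1; apply: nA.
    by exists (Some None); [rewrite !inE|exact: h1].
  - move=> b bj; rewrite leNgt; apply/negP => h1; apply: nA.
    exists (Some (Some b)); last exact: h1.
    rewrite !inE /=; apply/mapP; exists b => //.
    by rewrite mem_filter bj mem_enum.
have h2 : 0 < h ^+ 2 by rewrite exprn_gt0.
have e2 : 0 < eta ^+ 2 by rewrite exprn_gt0.
have dotb (v : 'cV[C]_n) p : nsq v <= p -> (lam [set H : cmx R n |
    h ^+ 2 < normc ((adjmx v *m (H : 'M[C]_n) *m e j) 0 0) ^+ 2]%R
    <= (p / ((n - K)%:R * h ^+ 2))%:E)%E.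
  move=> vp; apply: le_trans (stab_law_dot v lj h2) _; rewrite lee_fin.
  apply: inv_le; first by rewrite nsq_ge0.
  by rewrite mulr_gt0//= ler_pM2r// nKj.
move=> [[b|]|] _ /=.
- exact: dotb (ybN b).
- by apply: dotb; rewrite y'N.
have SL : nsq (S *m L) <= b2 * (n - j)%:R.
  rewrite (nsq_unitaryr _ Lu); apply: le_trans S_nsq _.
  by rewrite ler_wpM2l// nKj.
apply: (le_trans (stab_law_quad lj eta_gt0 SL)).
rewrite lee_fin; apply: inv_le.
  rewrite mulr_ge0 ?nsq_ge0//= ler_pM2l//.
  rewrite adjmxM -mulmxA (mulmxA (adjmx S)) (nsq_unitaryl _ LuA) (nsq_unitaryr _ Lu).
  exact: S_W0.
rewrite mulr_gt0 ?exprn_gt0//= ler_pM2r// lerXn2r ?nnegrE//; exact: nKj.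
Qed.

Lemma step_error_ge0 v : 0 <= v -> 0 <= step_error v.
Proof.
move=> v0; rewrite /step_error addr_ge0// divr_ge0//.
- by rewrite mulr_ge0.
- by rewrite mulr_ge0 ?exprn_ge0// ltW.
- by rewrite addr_ge0// mulr_ge0 ?exprn_ge0.
- by rewrite mulr_ge0 ?exprn_ge0// ltW.
Qed.

(** Induction on the number [k] of columns still to be revealed, each costing one [step_error]. At
    [k = 0] the orbit no longer depends on [H] in the stabilizer, and [krylov_growth] leaves only a
    null set. *)
Lemma bad_orbit_prob k j (lam : lawT) (L Q : 'M[C]_n) : (j + k = K)%N ->
  stab_law j lam -> krylov_inv S x j L Q ->
  (forall a : 'I_n, (a < j)%N -> good_vec S y (b2 + eta) h a L) ->
  (lam [set H | bad_orbit (L *m (H : 'M[C]_n) *m Q)] <=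
    (k%:R * step_error (nsq y))%:E)%E.
Proof.
have mB (L' Q' : 'M[C]_n) : measurable [set H : cmx R n | bad_orbit (L' *m (H : 'M[C]_n) *m Q')].
  apply: (measurable_cmx _ measurable_bad_orbit).
  by apply: mxmeasM; [apply: mxmeasM; [exact: mxmeas_cst|exact: mxmeas_id]|exact: mxmeas_cst].
elim: k j lam L Q => [|k IH] j lam L Q jk lj inv good.
  rewrite addn0 in jk; rewrite mul0r.
  have lae := stab_law_ae lj.
  suff : {ae lam, forall H : cmx R n, ~ bad_orbit (L *m (H : 'M[C]_n) *m Q)}.
    move=> [N [mN N0 NB]]; apply: (@le_trans _ _ (lam N)); last by rewrite N0.
    apply: le_measure; rewrite ?inE//.
    by move=> H HB; apply: NB => /(_ HB).
  apply: (@filterS _ _ (ae_filter_ringOfSetsType lam) _ _ _ lae) => H Hj [i iK].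
  have ij : (i < j)%N by rewrite jk.
  rewrite (orbit_stab inv Hj ij).
  have jn : (j <= n)%N by rewrite jk ltnW.
  have be0 : 0 <= b2 + eta by rewrite addr_ge0// ltW.
  have [g1 g2] := krylov_growth be0 (ltW h_gt0) jn inv good (S_op x) ij.
  move: g1 g2; rewrite jk -/growth_rate => g1 g2 [|].
    by rewrite ltNge g1.
  by rewrite ltNge g2.
have jK : (j < K)%N by rewrite -jk -addSnnS leq_addr.
have jn : (j < n)%N by exact: ltn_trans Kn.
pose j' := Ordinal jn.
have lj' : stab_law j' lam by [].
have inv' : krylov_inv S x j' L Q by [].
have [D Dj Dinv] := krylov_step inv'.
have [lam' l'] := stab_law_next lj'.
have [gd mgd [gd1 gd2]] := exposure_error (j := j') jK lj' (let: And3 Lu _ _ := inv in Lu).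
have l'1 : lam' [set H | stab j' (H : 'M[C]_n)] = 1%E.
  apply/eqP; rewrite eq_le probability_le1/=; last exact: measurable_stab.
  rewrite -(proj1 l'); apply: le_measure; rewrite ?inE.
  - exact: measurable_stab.
  - exact: measurable_stab.
  by move=> H; exact: stab_le (leqnSn j).
have kd0 : 0 <= k%:R * step_error (nsq y).
  by rewrite mulr_ge0// step_error_ge0// nsq_ge0.
have := exposure (L := L) (Q := Q) measurable_bad_orbit lj' l'1 Dj mgd kd0.
move=> /(_ _)/le_trans; apply.
  move=> H Hj gH; apply: (IH j.+1).
  - by rewrite addSnnS.
  - exact: l'.
  - exact: Dinv.
  move=> a; rewrite ltnS leq_eqVlt => /orP[/eqP aj|aj].
    have -> : a = j' by exact: val_inj.
    exact: gd2.
  have [h1 h2 h3] := good a aj.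
  have He (c : 'I_n) : (c < j)%N -> L *m H *m e c = L *m e c.
    by move=> cj; rewrite -mulmxA (proj2 Hj).
  split.
  - by rewrite -mulmxA He// mulmxA.
  - by rewrite -mulmxA He// mulmxA.
  - move=> b ba; rewrite -!(mulmxA S) !He ?(ltn_trans ba)// !(mulmxA S).
    exact: h3.
rewrite -natr1 mulrDl mul1r addrC EFinD; exact: leeD.
Qed.

End FixedVectors.
End KrylovProbability.

(** * From orbits of vectors to the entries of powers *)

Section Averaging.
Context d (T : measurableType d) (R : realType) (P : probability T R).

(** On [E] at least half of the events [A i] occur, while the mean number of those occurring is at
    most [q * #|I|%:R]. The point [i0] shows that one may divide by [#|I|%:R]. *)
Lemma averaging (I : finType) (i0 : I) (E : set T) (A : I -> set T) (q : R) :
  measurable E -> (forall i, measurable (A i)) -> 0 <= q ->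
  (forall x, E x -> #|I|%:R <= 2 * \sum_i (\1_(A i) x : R)) ->
  (forall i, P (A i) <= q%:E)%E -> (P E <= (2 * q)%:E)%E.
Proof.
move=> mE mA q0 EA Aq.
have I0 : 0 < #|I|%:R :> R by rewrite ltr0n; apply/card_gt0P; exists i0.
have mAE i : measurable_fun setT (fun x => \1_(A i) x : R).
  exact: measurable_indic.
have : (\int[P]_x (#|I|%:R * \1_E x)%:E <= \int[P]_x (2 * \sum_i (\1_(A i) x : R))%:E)%E.
  apply: ge0_le_integral => //.
  - by apply/measurable_EFinP; apply: measurable_funM => //; exact: measurable_indic.
  - apply/measurable_EFinP; apply: measurable_funM => //; exact: measurable_sum.
  move=> x _; rewrite lee_fin indicE; have [xE|xE] := boolP (x \in E).
    by rewrite mulr1 EA//; rewrite inE in xE.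
  by rewrite mulr0 mulr_ge0// sumr_ge0// => i _; rewrite indicE.
under eq_integral do rewrite EFinM.
rewrite ge0_integralZl_EFin//; last first.
  by apply/measurable_EFinP; exact: measurable_indic.
rewrite integral_indic// setIT.
under [X in (_ <= X)%E]eq_integral do rewrite EFinM.
have s0 x : [set: T] x -> (0 <= (\sum_i (\1_(A i) x : R))%:E)%E.
  by move=> _; rewrite lee_fin sumr_ge0// => i _; rewrite indicE.
have ms : measurable_fun [set: T] (fun x => (\sum_i (\1_(A i) x : R))%:E).
  by apply/measurable_EFinP; exact: measurable_sum.
rewrite (ge0_integralZl_EFin _ _ s0 ms)//.
rewrite integral_sum_cond// => le1.
have le2 : (\sum_i \int[P]_x (\1_(A i) x : R)%:E <= \sum_(i : I) q%:E)%E.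
  by apply: lee_sum => i _; rewrite integral_indic// setIT; exact: Aq.
have two0 : (0 <= 2%:E :> \bar R)%E by rewrite lee_fin.
have {le1 le2} := le_trans le1 (lee_wpmul2l two0 le2).
rewrite sumEFin sumr_const -[q *+ _]mulr_natl -EFinM mulrCA EFinM.
by rewrite lee_pmul2l.
Qed.

End Averaging.

Section SectionBound.
Variables (R : realType) (n : nat).
Local Notation C := R[i].
Local Notation e a := (delta_mx a 0 : 'cV[C]_n).

Definition sign_vec (s : {ffun 'I_n -> bool}) : 'cV[C]_n :=
  \col_i (if s i then 1 else -1).

Definition flip (c : 'I_n) (s : {ffun 'I_n -> bool}) : {ffun 'I_n -> bool} :=
  [ffun i => s i (+) (i == c)].

Lemma flipK c : involutive (flip c).
Proof. by move=> s; apply/ffunP => i; rewrite !ffunE addbK. Qed.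

Lemma nsq_sign_vec s : nsq (sign_vec s) = n%:R.
Proof.
rewrite nsq_col (eq_bigr (fun=> 1)) ?sumr_const ?card_ord// => i _.
by rewrite mxE; case: (s i); rewrite ?normcN normc1 expr1n.
Qed.

Lemma nsq_entry m p (A : 'M[C]_(m, p)) i j : normc (A i j) ^+ 2 <= nsq A.
Proof.
rewrite /nsq (bigD1 i)//= (bigD1 j)//= -addrA lerDl addr_ge0//.
  by apply: sumr_ge0 => ? _; exact: sqr_ge0.
by do 2!(apply: sumr_ge0 => ? _); exact: sqr_ge0.
Qed.

(* Flipping one sign of the test vector exhibits any given large entry. *)
Lemma sign_vec_large (B : 'M[C]_n) (a c : 'I_n) (t : R) (s : {ffun 'I_n -> bool}) :
  0 <= t -> t < normc (B a c) ^+ 2 ->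
  t < nsq (B *m sign_vec s) \/ t < nsq (B *m sign_vec (flip c s)).
Proof.
move=> t0 tB; pose f := (B *m sign_vec s) a 0; pose f' := (B *m sign_vec (flip c s)) a 0.
have fE : f - f' = (if s c then 2 else -2) * B a c.
  rewrite /f /f' !mxE -sumrB (bigD1 c)//= big1 => [|i ic].
    by rewrite !mxE ffunE eqxx addr0; case: (s c) => /=; ring.
  by rewrite !mxE ffunE (negPf ic) addbF subrr.
have n2 : normc (if s c then 2 else -2 : C) = 2.
  have -> : (if s c then 2 else -2 : C) = (if s c then 2 else -2 : R)%:C.
    by case: (s c); rewrite ?(rmorphN (real_complex R)) (rmorph_nat (real_complex R)).
  by rewrite normc_real; case: (s c); rewrite ?normrN ger0_norm.
have tri : 2 * normc (B a c) <= normc f + normc f'.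
  by rewrite -n2 -normcM -fE -(normcN f'); exact: le_normcD.
have B0 := normc_ge0 (B a c).
have [h|h] := leP (normc (B a c)) (normc f); [left|right].
  apply: lt_le_trans tB _; apply: le_trans (nsq_entry _ a 0).
  by rewrite lerXn2r ?nnegrE// normc_ge0.
apply: lt_le_trans tB _; apply: le_trans (nsq_entry _ a 0).
by rewrite lerXn2r ?nnegrE ?normc_ge0//; rewrite -/f'; lra.
Qed.

Variables (S : 'M[C]_n) (K : nat) (b2 h eta Msq W0 : R).
Hypotheses (Kn : (K < n)%N) (b2_ge0 : 0 <= b2) (h_gt0 : 0 < h) (eta_gt0 : 0 < eta)
  (Msq_ge0 : 0 <= Msq) (W0_ge0 : 0 <= W0).
Hypothesis S_op : forall z : 'cV[C]_n, nsq (S *m z) <= Msq * nsq z.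
Hypothesis S_adj : forall z : 'cV[C]_n, nsq (adjmx S *m z) <= Msq * nsq z.
Hypothesis S_nsq : nsq S <= b2 * (n - K)%:R.
Hypothesis S_W0 : nsq (adjmx S *m S) <= W0.
Variable lam : probability (cmx R n) R.
Hypothesis lamP : stab_law 0 lam.

Let rate := growth_rate K b2 h eta.
Let err v := step_error n K h eta Msq W0 v.

Let rate_ge0 : 0 <= rate.
Proof.
by rewrite /rate /growth_rate !addr_ge0 ?mulr_ge0// ltW.
Qed.

Lemma bad_orbit_haar (x y : 'cV[C]_n) :
  (lam (bad_orbit S K b2 h eta Msq x y) <= (K%:R * err (nsq y))%:E)%E.
Proof.
have inv : krylov_inv S x 0 (1%:M : 'M[C]_n) 1%:M.
  by split=> //; exact: (proj1 (stab1 R n 0)).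
have good (a : 'I_n) : (a < 0)%N -> good_vec S y (b2 + eta) h a 1%:M by [].
have -> : bad_orbit S K b2 h eta Msq x y =
    [set H : cmx R n | bad_orbit S K b2 h eta Msq x y (1%:M *m (H : 'M[C]_n) *m 1%:M)].
  by apply/seteqP; split=> H /=; rewrite mul1mx mulmx1.
exact: (bad_orbit_prob Kn b2_ge0 h_gt0 eta_gt0 Msq_ge0 W0_ge0
  S_op S_adj S_nsq S_W0 (add0n K) lamP inv good).
Qed.

Definition bad_entries : set (cmx R n) :=
  [set W : cmx R n | exists2 k, (k < K)%N & exists a c,
     Msq * n%:R * rate ^+ k < normc ((((W : 'M[C]_n) *m S) ^+ k.+1) a c) ^+ 2].

Lemma measurable_bad_entries : measurable bad_entries.
Proof.
rewrite (_ : bad_entries = \bigcup_(k in [set k | (k < K)%N])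
  \bigcup_(a in [set: 'I_n]) \bigcup_(c in [set: 'I_n])
  [set W : cmx R n | Msq * n%:R * rate ^+ k <
     normc ((((W : 'M[C]_n) *m S) ^+ k.+1) a c) ^+ 2]).
  apply: bigcup_measurable => k _.
  apply: fin_bigcup_measurable; first exact: finite_finset.
  move=> a _; apply: fin_bigcup_measurable; first exact: finite_finset.
  move=> c _; apply: measurable_gt; apply: measurable_normc2.
  have mW : mxmeas (fun W : cmx R n => ((W : 'M[C]_n) *m S) ^+ k.+1).
    by apply: mxmeasX; apply: mxmeasM; [exact: mxmeas_id|exact: mxmeas_cst].
  exact: mW.
apply/seteqP; split=> W.
  by move=> [k kK [a [c H]]]; exists k => //; exists a => //; exists c.
by move=> [k kK [a _ [c _ H]]]; exists k => //; exists a, c.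
Qed.

(** Flipping the sign at [c] pairs up the sign vectors. A large entry in column [c] makes the orbit
    bad for at least one member of each pair, so for at least half of all sign vectors. *)
Lemma bad_entries_haar : (lam bad_entries <= (2 * (K%:R * err 0))%:E)%E.
Proof.
(* With [y = 0] only the norm clause of [bad_orbit] can hold, and the error is [err 0]. *)
apply: (averaging (A := fun s => bad_orbit S K b2 h eta Msq (sign_vec s) 0) [ffun=> true]).
- exact: measurable_bad_entries.
- by move=> s; exact: measurable_bad_orbit.
- by rewrite mulr_ge0// step_error_ge0.
- move=> W [k kK [a [c H]]].
  have t0 : 0 <= Msq * n%:R * rate ^+ k by rewrite !mulr_ge0 ?exprn_ge0.
  have bd s : Msq * n%:R * rate ^+ k < nsq ((((W : 'M[C]_n) *m S) ^+ k.+1) *m sign_vec s) ->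
     bad_orbit S K b2 h eta Msq (sign_vec s) 0 W.
    by move=> hs; exists k => //; left; rewrite nsq_sign_vec.
  have pair s : 1 <= (\1_(bad_orbit S K b2 h eta Msq (sign_vec s) 0) W : R) +
      \1_(bad_orbit S K b2 h eta Msq (sign_vec (flip c s)) 0) W.
    have ind1 (B : set (cmx R n)) : B W -> (\1_B W : R) = 1.
      by move=> BW; rewrite indicE mem_set.
    have ind0 (B : set (cmx R n)) : 0 <= (\1_B W : R) by rewrite indicE.
    have sum1 (u v : R) : 0 <= u -> 0 <= v -> u = 1 \/ v = 1 -> 1 <= u + v.
      by move=> u0 v0 [->|->]; lra.
    apply: sum1; [exact: ind0|exact: ind0|].
    by have [/bd h1|/bd h1] := sign_vec_large s t0 H; [left|right]; exact: ind1.
  have -> : #|{ffun 'I_n -> bool}|%:R = \sum_(s : {ffun 'I_n -> bool}) 1 :> R.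
    by rewrite sumr_const.
  apply: le_trans (ler_sum _ (fun s _ => pair s)) _.
  rewrite big_split /= mulrDl mul1r lerD2l.
  by rewrite [leRHS](reindex_inj (inv_inj (flipK c))).
- move=> s; have := bad_orbit_haar (sign_vec s) 0.
  by rewrite (_ : nsq 0 = 0)// /nsq big1// => i _; rewrite big1// => j _; rewrite mxE normc0 expr0n.
Qed.

(** The coefficient [2] is the loss of the averaging for the entries; [p * p] counts the orbits of
    the columns of [X] tested against the rows of [Y]. *)
Lemma section_bound p (X : 'M[C]_(n, p)) (Y : 'M[C]_(p, n)) (E : set (cmx R n)) :
  measurable E -> (forall i, nsq (row i Y) <= 1) ->
  (forall H : cmx R n, ~ bad_entries H ->
    (forall i j, ~ bad_orbit S K b2 h eta Msq (col j X) (adjmx (row i Y)) H) -> ~ E H) ->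
  (lam E <= ((2 + (p * p)%:R) * (K%:R * err 1))%:E)%E.
Proof.
move=> mE Y1 HE.
pose A (i : option ('I_p * 'I_p)) := match i with
  | None => bad_entries
  | Some ij => bad_orbit S K b2 h eta Msq (col ij.2 X) (adjmx (row ij.1 Y)) end.
pose c (i : option ('I_p * 'I_p)) : R := match i with
  | None => 2 * (K%:R * err 1) | Some _ => K%:R * err 1 end.
have errle v : v <= 1 -> err v <= err 1.
  move=> v1; rewrite /err /step_error lerD2l ler_wpM2r ?lerD2r//.
  by rewrite invr_ge0 mulr_ge0 ?exprn_ge0// ltW.
have := union_bound (P := lam) (s := index_enum (option ('I_p * 'I_p))) (E := E) (A := A) (c := c) mE.
move=> /(_ _ _ _)/le_trans; apply.
- by case=> [ij|]; [exact: measurable_bad_orbit|exact: measurable_bad_entries].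
- move=> H EH; have [be|be] := pselect (bad_entries H); first by exists None; rewrite ?mem_index_enum.
  have [|nA] := pselect (exists ij, A (Some ij) H).
    by move=> [ij Aij]; exists (Some ij); rewrite ?mem_index_enum.
  by exfalso; apply: (HE H be _ EH) => i j Aij; apply: nA; exists (i, j).
- move=> [[i j]|] _ /=.
    apply: le_trans (bad_orbit_haar _ _) _; rewrite lee_fin ler_wpM2l// errle//.
    by rewrite nsq_adj.
  by apply: le_trans bad_entries_haar _; rewrite lee_fin ler_pM2l// ler_wpM2l// errle.
rewrite lee_fin.
have -> : \sum_(i : option ('I_p * 'I_p)) c i = c None + \sum_(ij : 'I_p * 'I_p) c (Some ij).
  rewrite (bigD1 None)//=; congr (_ + _).
  rewrite (reindex_omap Some id) => [|[ij|]]//=.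
  by apply: eq_bigl => ij; rewrite eqxx.
by rewrite /= sumr_const card_prod card_ord -[_ *+ (p * p)]mulr_natl [leRHS]mulrDl.
Qed.

End SectionBound.

(** * Conditioning on independent variables *)

Section Independence.
Local Open Scope ereal_scope.
Context d (T : measurableType d) (R : realType) (P : probability T R).

Lemma measurable_section2 d1 d2 (T1 : measurableType d1) (T2 : measurableType d2)
    (C : set (T1 * T2)) (y : T2) :
  measurable C -> measurable [set x | C (x, y)].
Proof.
move=> mC; have <- : ysection C y = [set x | C (x, y)].
  by apply/seteqP; split=> x; rewrite /ysection /= inE.
exact: measurable_ysection.
Qed.

(** Independence identifies the joint law with the product law on rectangles, hence everywhere, and
    Fubini then freezes [Y]. *)
Lemma indep_joint d1 d2 (T1 : measurableType d1) (T2 : measurableType d2)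
    (X : T -> T1) (Y : T -> T2) (Q1 : probability T1 R) (Q2 : probability T2 R) :
  measurable_fun setT X -> measurable_fun setT Y ->
  (forall B, measurable B -> Q1 B = P (X @^-1` B)) ->
  (forall B, measurable B -> Q2 B = P (Y @^-1` B)) ->
  independent_rv P X Y -> forall C, measurable C ->
  P [set w | C (X w, Y w)] = \int[Q2]_y Q1 [set x | C (x, y)] /\
  measurable_fun setT (fun y => Q1 [set x | C (x, y)]).
Proof.
move=> mX mY Q1E Q2E ind C mC.
have yE y : ysection C y = [set x | C (x, y)].
  by apply/seteqP; split=> x; rewrite /ysection /= inE.
have mXY : measurable_fun setT (fun w => (X w, Y w)) by exact/measurable_fun_pair.
have [Q12 Q12E] := image_law P mXY.
have rect A B : measurable A -> measurable B -> Q12 (A `*` B) = Q1 A * Q2 B.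
  move=> mA mB; rewrite Q12E; last exact: measurableX.
  by rewrite Q1E// Q2E// -ind.
split.
  have <- : Q12 C = P [set w | C (X w, Y w)] by rewrite Q12E.
  rewrite -(product_measure_unique rect mC).
  have := @indic_fubini_tonelli _ _ _ _ R Q1 Q2 C mC.
  rewrite indic_fubini_tonelli_FE// indic_fubini_tonelli_GE// => h.
  by rewrite [LHS]h; apply: eq_integral => y _ /=; rewrite yE.
under [X in measurable_fun _ X]funext do rewrite -yE.
exact: measurable_fun_ysection.
Qed.

(** Independence is given step by step, whereas conditioning freezes everything but [X]. The event
    is integrated over [Z], and for frozen [Z] the variables [X] and [Y] separate. *)
Lemma indep_assoc d1 d2 d3 (T1 : measurableType d1) (T2 : measurableType d2)
    (T3 : measurableType d3) (X : T -> T1) (Y : T -> T2) (Z : T -> T3) :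
  measurable_fun setT X -> measurable_fun setT Y -> measurable_fun setT Z ->
  independent_rv P X Y -> independent_rv P (fun w => (X w, Y w)) Z ->
  independent_rv P X (fun w => (Y w, Z w)).
Proof.
move=> mX mY mZ XY XYZ A C mA mC.
have mXY : measurable_fun setT (fun w => (X w, Y w)) by exact/measurable_fun_pair.
have [Q1 Q1E] := image_law P mX; have [Q2 Q2E] := image_law P mY.
have [Q3 Q3E] := image_law P mZ; have [Q12 Q12E] := image_law P mXY.
have YZ : independent_rv P Y Z.
  move=> B D mB mD; have := XYZ (setT `*` B) D (measurableX measurableT mB) mD.
  have -> : (fun w => (X w, Y w)) @^-1` (setT `*` B) = Y @^-1` B.
    by apply/seteqP; split=> w //= [].
  by [].
pose C' := [set xyz : (T1 * T2) * T3 | A xyz.1.1 /\ C (xyz.1.2, xyz.2)].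
have mC' : measurable C'.
  rewrite (_ : C' = (fun xyz => xyz.1.1) @^-1` A `&` (fun xyz => (xyz.1.2, xyz.2)) @^-1` C)//.
  apply: measurableI.
    rewrite -[X in measurable X]setTI.
    by have : measurable_fun setT (fun xyz : (T1 * T2) * T3 => xyz.1.1);
      [exact: (measurableT_comp measurable_fst measurable_fst)|apply].
  rewrite -[X in measurable X]setTI.
  have : measurable_fun setT (fun xyz : (T1 * T2) * T3 => (xyz.1.2, xyz.2)).
    apply/measurable_fun_pair; last exact: measurable_snd.
    exact: (measurableT_comp measurable_snd measurable_fst).
  by apply.
have [e1 _] := indep_joint mXY mZ Q12E Q3E XYZ mC'.
have [e2 m2] := indep_joint mY mZ Q2E Q3E YZ mC.
have -> : X @^-1` A `&` (fun w => (Y w, Z w)) @^-1` C = [set w | C' (X w, Y w, Z w)] by [].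
have -> : (fun w => (Y w, Z w)) @^-1` C = [set w | C (Y w, Z w)] by [].
rewrite e1 e2 -ge0_integralZl//.
apply: eq_integral => z _.
have mCz := measurable_section2 z mC.
rewrite Q12E; last first.
  rewrite (_ : [set x | C' (x, z)] = A `*` [set y | C (y, z)])//.
  exact: measurableX.
by rewrite Q2E//; exact: XY.
Qed.

(** The set [good] may fail to be measurable. The [z] whose section has mass above [delta] do form a
    measurable set, and it avoids [good], so an outer measure suffices. *)
Lemma conditional_bound d1 d2 (T1 : measurableType d1) (T2 : measurableType d2)
    (X : T -> T1) (Z : T -> T2) (Q1 : probability T1 R) (B : set (T1 * T2))
    (good : set T2) (delta : R) :
  measurable_fun setT X -> measurable_fun setT Z ->
  (forall B, measurable B -> Q1 B = P (X @^-1` B)) ->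
  independent_rv P X Z -> measurable B -> (0 <= delta)%R ->
  (forall z, good z -> Q1 [set x | B (x, z)] <= delta%:E) ->
  P [set w | B (X w, Z w)] <= delta%:E + mu_ext P [set w | ~ good (Z w)].
Proof.
move=> mX mZ Q1E ind mB d0 Bgood.
have [Q2 Q2E] := image_law P mZ.
have [-> mphi] := indep_joint mX mZ Q1E Q2E ind mB.
set phi := fun z => Q1 [set x | B (x, z)] in mphi *.
pose E := [set z | delta%:E < phi z].
have mE : measurable E.
  by rewrite -[E]setTI; exact: emeasurable_fun_o_infty.
have h1 : \int[Q2]_z phi z <= \int[Q2]_z (delta + \1_E z)%R%:E.
  apply: ge0_le_integral => //.
  - by apply/measurable_EFinP; apply: measurable_funD => //; exact: measurable_indic.
  move=> z _; rewrite indicE; have [zE|zE] := boolP (z \in E).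
    apply: (@le_trans _ _ 1); last by rewrite lee_fin lerDr.
    by apply: probability_le1; exact: measurable_section2.
  by rewrite addr0; move/negP: zE; rewrite inE /E /= => /negP; rewrite -leNgt.
apply: le_trans h1 _.
under eq_integral do rewrite EFinD.
rewrite ge0_integralD//; last by apply/measurable_EFinP; exact: measurable_indic.
rewrite integral_cst//= probability_setT mule1 integral_indic// setIT.
apply: leeD => //; apply: (@le_trans _ _ (P (Z @^-1` E))); first by rewrite -Q2E.
rewrite -measurable_mu_extE; last first.
  by rewrite -[X in measurable X]setTI; exact: mZ.
apply: le_mu_ext => w; rewrite /E /= => h g.
by move: h; rewrite ltNge Bgood.
Qed.

End Independence.

(** * Outliers of a good pair *)

Lemma char_polyMC (F : fieldType) n p (X : 'M[F]_(n, p)) (Y : 'M[F]_(p, n)) :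
  char_poly (X *m Y) * 'X^p = 'X^n * char_poly (Y *m X).
Proof.
rewrite /char_poly /char_poly_mx !map_mxM; exact: det_scalar_subM.
Qed.

Lemma char_poly_roots (R : realType) n (A : 'M[R[i]]_n) :
  exists2 s : seq R[i], size s = n & char_poly A = \prod_(a <- s) ('X - a%:P).
Proof.
have [s sE] := closed_field_poly_normal (char_poly A).
rewrite (monicP (char_poly_monic A)) scale1r in sE; exists s => //.
by apply: succn_inj; rewrite -(size_prod_XsubC s id) -sE size_char_poly.
Qed.

(** By [char_polyMC] the roots for [X *m Y] padded with [p] zeros are those for [Y *m X] padded with
    [n] zeros, and the latter matrix has only [p] roots. *)
Lemma count_nonzero_roots (R : realType) n p (X : 'M[R[i]]_(n, p)) (Y : 'M[R[i]]_(p, n)) s :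
  char_poly (X *m Y) = \prod_(a <- s) ('X - a%:P) ->
  (count (fun a => a != 0%R) s <= p)%N.
Proof.
move=> sE; have [t st tE] := char_poly_roots (Y *m X).
have zE k : 'X^k = \prod_(a <- nseq k 0) ('X - a%:P) :> {poly R[i]}.
  by rewrite big_nseq polyC0 subr0 iter_mulr_1.
have := char_polyMC X Y; rewrite sE tE !zE -!big_cat => /prod_XsubC_eq /seq.permP.
move=> /(_ (fun a => a != 0)); rewrite !count_cat !count_nseq eqxx !mul0n addn0 add0n => ->.
by rewrite -st; exact: seq.count_size.
Qed.

Lemma lists_eigenvalues_filter (R : realType) n (A : 'M[R[i]]_n) (p : pred R[i]) s l :
  char_poly A = \prod_(a <- s) ('X - a%:P) ->
  lists_eigenvalues A p l <-> perm_eq l [seq a <- s | p a].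
Proof.
move=> sE; have E z : count_mem z [seq a <- s | p a] = if p z then count_mem z s else 0%N.
  rewrite count_filter; case: ifPn => pz.
    by apply: eq_count => a /=; case: eqP => [->|].
  rewrite -(count_pred0 s); apply: eq_count => a /=.
  by case: eqP => [->|//]; rewrite (negPf pz).
rewrite /lists_eigenvalues sE; split=> [h|/seq.permP h z].
  by apply/allP => z _ /=; rewrite h mu_prod_XsubC E.
by rewrite h mu_prod_XsubC E.
Qed.

Section OperatorNorm.
Variable R : realType.
Local Notation C := R[i].

Lemma nsq0 m n : nsq (0 : 'M[C]_(m, n)) = 0.
Proof. by rewrite /nsq big1// => i _; rewrite big1// => j _; rewrite mxE normc0 expr0n. Qed.

(** Let [a] be the squared norm of [adjmx A *m z]. It is the scalar product of [z] with
    [A *m (adjmx A *m z)], so Cauchy-Schwarz gives [a ^+ 2 <= nsq z * (c * a)], and [a] cancels. *)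
Lemma adj_op_bound m n (A : 'M[C]_(m, n)) (c : R) : 0 <= c ->
  (forall z : 'cV[C]_n, nsq (A *m z) <= c * nsq z) ->
  forall z : 'cV[C]_m, nsq (adjmx A *m z) <= c * nsq z.
Proof.
move=> c0 Ac z; set a := nsq (adjmx A *m z).
have a0 : 0 <= a by exact: nsq_ge0.
have aE : a%:C = (adjmx z *m (A *m (adjmx A *m z))) 0 0.
  by rewrite /a nsq_tr /mxtrace big_ord1 adjmxM adjmxK !mulmxA.
have h : a ^+ 2 <= nsq z * nsq (A *m (adjmx A *m z)).
  rewrite -[a](ger0_norm a0) -normc_real aE.
  apply: le_trans (nsq_entry _ 0 0) _; apply: le_trans (nsqM _ _) _.
  by rewrite nsq_adj.
have h2 := le_trans h (ler_wpM2l (nsq_ge0 z) (Ac _)); rewrite -/a in h2.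
have [a_eq|an] := eqVneq a 0.
  by rewrite a_eq mulr_ge0// nsq_ge0.
have a_gt0 : 0 < a by rewrite lt_def an.
by rewrite -(ler_pM2r a_gt0) -expr2 (le_trans h2)// mulrA (mulrC (nsq z)).
Qed.

Lemma l2norm_nsq n (x : 'cV[C]_n) : l2norm x = Num.sqrt (nsq x).
Proof. by rewrite /l2norm nsq_col. Qed.

Lemma opnorm_le n (A : 'M[C]_n) (x : 'cV[C]_n) : nsq x <= 1 -> l2norm (A *m x) <= opnorm A.
Proof.
move=> x1; apply: ub_le_sup; last first.
  by exists x => //=; rewrite l2norm_nsq -sqrtr1 ler_wsqrtr.
exists (Num.sqrt (nsq A)) => _ [y /= y1 <-]; rewrite l2norm_nsq ler_wsqrtr//.
apply: le_trans (nsqM _ _) _; rewrite ler_piMr ?nsq_ge0//.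
move: y1; rewrite l2norm_nsq => y1.
by rewrite -(sqr_sqrtr (nsq_ge0 y)) expr_le1 ?sqrtr_ge0.
Qed.

Lemma opnorm_nsq n (A : 'M[C]_n) (c : R) (x : 'cV[C]_n) :
  opnorm A <= c -> nsq (A *m x) <= c ^+ 2 * nsq x.
Proof.
move=> Ac; have [x0|x0] := eqVneq (nsq x) 0.
  by rewrite (nsq_eq0 x0) mulmx0 !nsq0 mulr0.
have xp : 0 < nsq x by rewrite lt_def x0 nsq_ge0.
have sx : 0 < Num.sqrt (nsq x) by rewrite sqrtr_gt0.
pose u := ((Num.sqrt (nsq x))^-1)%:C *: x.
have u1 : nsq u <= 1.
  by rewrite nsqZ normc_real gtr0_norm ?invr_gt0// exprVn sqr_sqrtr ?nsq_ge0// mulVf.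
have := le_trans (opnorm_le A u1) Ac; rewrite l2norm_nsq => h.
have c0 : 0 <= c by apply: le_trans h; exact: sqrtr_ge0.
have {h} : nsq (A *m u) <= c ^+ 2.
  by rewrite -(sqr_sqrtr (nsq_ge0 (A *m u))) lerXn2r ?nnegrE ?sqrtr_ge0.
rewrite -scalemxAr nsqZ normc_real gtr0_norm ?invr_gt0// exprVn sqr_sqrtr ?nsq_ge0//.
by rewrite mulrC ler_pdivrMr.
Qed.

(** [eigenvalue] refers to row eigenvectors, hence the passage to the adjoint. *)
Lemma eigenvalue_opnorm n (A : 'M[C]_n) (c : R) z :
  0 <= c -> opnorm A <= c -> eigenvalue A z -> normc z <= c.
Proof.
move=> c0 Ac /eigenvalueP[v vA v0].
have := adj_op_bound (sqr_ge0 c) (fun x => opnorm_nsq x Ac) (adjmx v).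
rewrite -adjmxM vA !nsq_adj nsqZ => h.
have vp : 0 < nsq v.
  by rewrite lt_def nsq_ge0 andbT; apply: contra v0 => /eqP/nsq_eq0 ->.
by move: h; rewrite ler_pM2r//; apply: sqr_le_le => //; exact: normc_ge0.
Qed.

(** The rows of [Y] are an orthonormal basis of the row space of [P], so [X = P *m adjmx Y] inherits
    the norm bound of [P]. An arbitrary rank factorization would control neither factor. *)
Lemma low_rank_factor n (P : 'M[C]_n) (r : nat) (c : R) :
  (\rank P <= r)%N -> opnorm P <= c ->
  exists p, (p <= r)%N /\ exists (X : 'M[C]_(n, p)) (Y : 'M[C]_(p, n)),
   [/\ P = X *m Y, forall j, nsq (col j X) <= c ^+ 2 & forall i, nsq (row i Y) <= 1].
Proof.
move=> rP Pc; exists (\rank P); split=> //.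
pose Y := schmidt (row_base P).
have Yu : Y \is unitarymx by apply: schmidt_unitarymx; exact: rank_leq_col.
have Y1 i : nsq (row i Y) = 1.
  have := unitarymxP Yu => /(congr1 (fun M : 'M[C]_(_, _) => M i i)).
  rewrite [RHS]mxE eqxx /= mulr1n mxE => h; apply: (@complexI R).
  rewrite (rmorph1 (real_complex R)) -h /nsq big_ord1 (rmorph_sum (real_complex R)).
  by apply: eq_bigr => j _ /=; rewrite !mxE normc_sqr mulrC.
exists (P *m adjmx Y), Y; split.
- have : (P <= Y)%MS.
    apply: (submx_trans _ (schmidt_sub _)); by rewrite eq_row_base.
  move=> /submxP[D PD]; have YY : Y *m adjmx Y = 1%:M by exact: unitarymxP.
  transitivity (D *m (Y *m adjmx Y) *m Y); first by rewrite YY mulmx1.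
  by rewrite mulmxA -PD.
- move=> j; rewrite (_ : col j (P *m adjmx Y) = P *m adjmx (row j Y)).
    by apply: le_trans (opnorm_nsq _ Pc) _; rewrite nsq_adj Y1 mulr1.
  apply/matrixP => i k; rewrite !mxE; apply: eq_bigr => l _.
  by rewrite !mxE.
- by move=> i; rewrite Y1.
Qed.

End OperatorNorm.

(** * Extending polynomial inequalities from rational points *)

Section Density.
Variable R : realType.
Local Notation C := R[i].

Lemma horner_lipschitz (p : {poly C}) (z : C) : exists2 L : R, 0 <= L &
  forall w, normc (w - z) <= 1 -> normc (p.[w] - p.[z]) <= L * normc (w - z).
Proof.
elim/poly_ind: p => [|p c [L L0 HL]].
  by exists 0 => // w _; rewrite !horner0 subrr normc0 mul0r.
exists (normc p.[z] + L * (normc z + 1)).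
  by rewrite addr_ge0 ?mulr_ge0 ?addr_ge0 ?normc_ge0.
move=> w wz; rewrite !hornerMXaddC.
have -> : p.[w] * w + c - (p.[z] * z + c) = (p.[w] - p.[z]) * w + p.[z] * (w - z) by ring.
apply: le_trans (le_normcD _ _) _; rewrite !normcM addrC mulrDl lerD2l.
have wle : normc w <= normc z + 1.
  have := le_normcD (w - z) z; rewrite subrK => h.
  by apply: le_trans h _; rewrite addrC lerD2l.
rewrite -mulrA (mulrC (normc z + 1)) mulrA.
by apply: ler_pM; rewrite ?normc_ge0// HL.
Qed.

Lemma rat_dense (z : C) (d : R) : 0 < d ->
  exists a b : rat, normc ((ratr a +i* ratr b) - z) < d.
Proof.
move=> d0; case: z => x y.
have d2 : 0 < d / 2 by rewrite divr_gt0.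
have [a] : exists a : rat, ratr a \in `]x, (x + d / 2)[ by apply: rat_in_itvoo; lra.
have [b] : exists a : rat, ratr a \in `]y, (y + d / 2)[ by apply: rat_in_itvoo; lra.
rewrite !in_itv /= => /andP[b1 b2] /andP[a1 a2]; exists a, b.
set u := ratr a - x; set v := ratr b - y.
have u0 : 0 < u by rewrite subr_gt0.
have v0 : 0 < v by rewrite subr_gt0.
apply: (@le_lt_trans _ _ (u + v)); last by rewrite /u /v; lra.
have -> : u + v = Num.sqrt ((u + v) ^+ 2) by rewrite sqrtr_sqr gtr0_norm// addr_gt0.
by rewrite ler_wsqrtr//; have := mulr_gt0 u0 v0; rewrite !expr2; lra.
Qed.

(** The gap between [ze0] and [ze] leaves room to approximate a point of modulus [ze] by rational
    ones, and polynomials are locally Lipschitz. *)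
Lemma dense_bound (F G : {poly C}) (ze0 ze : R) : ze0 < ze ->
  (forall a b : rat, ze0 < normc (ratr a +i* ratr b : C) ->
     normc F.[ratr a +i* ratr b] <= normc G.[ratr a +i* ratr b]) ->
  forall z, ze <= normc z -> normc F.[z] <= normc G.[z].
Proof.
move=> zz H z zez; rewrite leNgt; apply/negP => lt.
have [LF LF0 HF] := horner_lipschitz F z; have [LG LG0 HG] := horner_lipschitz G z.
pose m := normc F.[z] - normc G.[z].
have m0 : 0 < m by rewrite subr_gt0.
pose d := Num.min 1 (Num.min (ze - ze0) (m / (LF + LG + 1))).
have L0 : 0 < LF + LG + 1 by lra.
have d0 : 0 < d by rewrite !lt_min ltr01 subr_gt0 zz divr_gt0.
have [a [b ab]] := rat_dense z d0; set w : C := _ +i* _ in ab.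
have d1 : d <= 1 by rewrite ge_min lexx.
have d2 : d <= ze - ze0 by rewrite !ge_min lexx orbT.
have d3 : d <= m / (LF + LG + 1) by rewrite !ge_min lexx !orbT.
have w1 : normc (w - z) <= 1 by apply: ltW; exact: lt_le_trans d1.
have := le_normcD (z - w) w; rewrite subrK (normc_sub z) => zw.
have wz : ze0 < normc w by lra.
have hw := H a b wz.
have hF := HF w w1; have hG := HG w w1.
have t1 := normc_dist F.[z] F.[w]; have t2 := normc_dist G.[w] G.[z].
rewrite (normc_sub F.[z]) in t1.
have : normc (w - z) * (LF + LG + 1) < m.
  by rewrite -ltr_pdivlMr//; exact: lt_le_trans d3.
have n0 := normc_ge0 (w - z).
rewrite -/w in hw; rewrite /m; lra.
Qed.

End Density.

Section MatrixOutliers.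
Variable R : realType.
Local Notation C := R[i].

Lemma matrix_outliers (b eps M D : R) (r : nat) :
  0 <= b -> 0 < eps -> 0 <= M -> 0 < D ->
  exists2 dl : R, 0 < dl & forall (n p : nat) (A P : 'M[C]_n)
      (X : 'M[C]_(n, p)) (Y : 'M[C]_(p, n)),
    P = X *m Y -> (p <= r)%N -> opnorm P <= M ->
    (forall z, b + eps <= normc z -> \det (z%:M - A) != 0) ->
    (forall z, eigenvalue P z -> ~ (b + eps < normc z < b + 3 * eps)) ->
    (forall z, b + eps <= normc z ->
      normc (z ^+ n * \det (z%:M - (A + P)) - \det (z%:M - P) * \det (z%:M - A)) <=
      dl * normc (z ^+ n * \det (z%:M - A))) ->
  forall l, lists_eigenvalues P (fun z => b + 3 * eps <= normc z) l ->
  exists2 m, lists_eigenvalues (A + P) (fun z => b + 2 * eps < normc z) m &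
    all2 (fun c y => normc (y - c) < D) l m.
Proof.
move=> b0 eps0 M0 D0; have [dl dl0 H] := outlier_matching r b0 eps0 M0 D0.
exists dl => // n p A P X Y PE pr PM Anz band close l ll.
have [al sal alE] := char_poly_roots A; have [be sbe beE] := char_poly_roots (A + P).
have [pi spi piE] := char_poly_roots P.
have detE (B : 'M[C]_n) s z : char_poly B = \prod_(a <- s) ('X - a%:P) ->
    \det (z%:M - B) = \prod_(a <- s) (z - a).
  move=> BE; rewrite -horner_char_poly BE horner_prod.
  by apply: eq_bigr => a _; rewrite hornerXsubC.
have eigP z : z \in pi -> eigenvalue P z.
  by move=> zpi; rewrite eigenvalue_root_char piE root_prod_XsubC.
have [||||||m pm am] := H n al be pi sal sbe spi _ _ _ _ _ l.
- by apply: leq_trans pr; apply: (count_nonzero_roots (X := X) (Y := Y)); rewrite -PE.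
- move=> a aal; rewrite ltNge; apply/negP => /Anz.
  rewrite (detE A al)// prodf_seq_neq0 => /allP /(_ _ aal) /=.
  by rewrite subrr eqxx.
- by move=> q /eigP; exact: eigenvalue_opnorm.
- by move=> q /eigP; exact: band.
- by move=> z /close; rewrite (detE A al)// (detE P pi)// (detE (A + P) be).
- exact/(lists_eigenvalues_filter _ _ piE).
by exists m => //; exact/(lists_eigenvalues_filter _ _ beE).
Qed.

(** The matrix [1 - (A / z) ^ K] is invertible as a small perturbation of the identity, and it has
    [z%:M - A] as a factor. *)
Lemma unitmx_small_power n (A : 'M[C]_n) K (z : C) (c : R) : z != 0 ->
  (forall a b, normc ((A ^+ K) a b) <= c) -> (n * n)%:R * c < normc z ^+ K ->
  z%:M - A \in unitmx.
Proof.
move=> z0 Ac cz; have zK : 0 < normc z ^+ K by rewrite exprn_gt0// normc_gt0.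
have : l1 (z^-1 ^+ K *: A ^+ K) < 1.
  rewrite l1Z normcX normcV exprVn mulrC ltr_pdivrMr// mul1r.
  exact: le_lt_trans (l1_le Ac) cz.
by move=> /unit_1sub_l1; rewrite -neumannP// unitmx_mul => /andP[].
Qed.

Definition close_at n (dl : R) (A P : 'M[C]_n) (z : C) : Prop :=
  normc (z ^+ n * \det (z%:M - (A + P)) - \det (z%:M - P) * \det (z%:M - A)) <=
    dl * normc (z ^+ n * \det (z%:M - A)).

(* Closeness is only imposed at rational points, which makes it a measurable event. *)
Definition good_pair n (K : nat) (ka dl ze : R) (A P : 'M[C]_n) : Prop :=
  (forall a c, normc ((A ^+ K) a c) <= ka) /\
  forall a b : rat, ze < normc (ratr a +i* ratr b : C) -> close_at dl A P (ratr a +i* ratr b).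

Lemma good_pair_close n K ka dl ze ze' (A P : 'M[C]_n) : 0 <= dl -> ze < ze' ->
  good_pair K ka dl ze A P -> forall z, ze' <= normc z -> close_at dl A P z.
Proof.
move=> dl0 zz [_ H] z zez.
pose F : {poly C} := 'X^n * char_poly (A + P) - char_poly P * char_poly A.
pose G : {poly C} := dl%:C%:P * ('X^n * char_poly A).
have FE w : F.[w] = w ^+ n * \det (w%:M - (A + P)) - \det (w%:M - P) * \det (w%:M - A).
  by rewrite /F hornerD hornerN !hornerM hornerXn !horner_char_poly.
have GE w : normc G.[w] = dl * normc (w ^+ n * \det (w%:M - A)).
  by rewrite /G !hornerM hornerC hornerXn horner_char_poly normcM normc_real ger0_norm.
rewrite /close_at -FE -GE; apply: dense_bound zz _ _ zez => a b ab.
by rewrite FE GE; exact: H.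
Qed.

Lemma measurable_good_pair d (T : measurableType d) n K ka dl ze
    (A P : T -> 'M[C]_n) : mxmeas A -> mxmeas P ->
  measurable [set t | good_pair K ka dl ze (A t) (P t)].
Proof.
move=> mA mP.
rewrite (_ : [set t | _] = (\bigcap_(a in [set: 'I_n]) \bigcap_(c in [set: 'I_n])
   [set t | normc ((A t ^+ K) a c) <= ka]) `&`
   \bigcap_(ab in [set ab : rat * rat | ze < normc (ratr ab.1 +i* ratr ab.2 : C)])
   [set t | close_at dl (A t) (P t) (ratr ab.1 +i* ratr ab.2)]); last first.
  apply/seteqP; split=> t [h1 h2]; split.
  - by move=> a _ c _; exact: h1.
  - by move=> [a b] ab; exact: h2.
  - by move=> a c; exact: (h1 a I c I).
  - by move=> a b ab; exact: (h2 (a, b) ab).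
apply: measurableI.
  apply: fin_bigcap_measurable; first exact: finite_finset.
  move=> a _; apply: fin_bigcap_measurable; first exact: finite_finset.
  by move=> c _; apply: measurable_le; apply: measurable_normc; exact: (mxmeasX K mA).
rewrite -[X in measurable X]setCK; apply: measurableC.
rewrite setC_bigcap bigcup_mkcond; apply: countable_bigcupT_measurable; first exact: countableP.
move=> ab; case: ifPn => // _; apply: measurableC; rewrite /close_at.
set w : C := _ +i* _.
have md (F : T -> 'M[C]_n) : mxmeas F -> cmeas (fun t => \det (w%:M - F t)).
  move=> mF; apply: cmeas_det; apply: mxmeasD; first exact: mxmeas_cst.
  exact: mxmeasN.
rewrite (_ : [set t | _] = [set t |
   normc (w ^+ n * \det (w%:M - (A t + P t)) + - (\det (w%:M - P t) * \det (w%:M - A t))) -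
   dl * normc (w ^+ n * \det (w%:M - A t)) <= 0]); last first.
  by apply/seteqP; split=> t /=; rewrite subr_le0.
apply: measurable_le; apply: measurable_funB.
  apply: measurable_normc; apply: cmeasD.
    by apply: cmeasM; [exact: cmeas_cst|apply: md; exact: mxmeasD].
  by apply: cmeasN; apply: cmeasM; exact: md.
apply: measurable_funM => //; apply: measurable_normc.
by apply: cmeasM; [exact: cmeas_cst|exact: md].
Qed.

End MatrixOutliers.

(** * The good event when only the Haar unitary is random *)

Section SectionEvent.
Variables (R : realType) (n K p : nat).
Local Notation C := R[i].
Variables (S P : 'M[C]_n) (X : 'M[C]_(n, p)) (Y : 'M[C]_(p, n)).
Variables (b2 h eta M Cx be ze q M1 dl : R).
Hypotheses (K_gt0 : (0 < K)%N) (Kn : (K < n)%N) (b2_ge0 : 0 <= b2) (h_gt0 : 0 < h)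
  (eta_gt0 : 0 < eta) (M_ge0 : 0 <= M) (Cx_ge0 : 0 <= Cx) (beze : 0 < be < ze)
  (q_ge0 : 0 <= q) (M1_ge1 : 1 <= M1) (M1_ge : M / be <= M1).
Hypothesis S_op : forall z : 'cV[C]_n, nsq (S *m z) <= M ^+ 2 * nsq z.
Hypothesis S_nsq : nsq S <= b2 * (n - K)%:R.
Hypothesis S_W0 : nsq (adjmx S *m S) <= n%:R * M ^+ 4.
Hypothesis PE : P = X *m Y.
Hypothesis X_le : forall j, nsq (col j X) <= Cx ^+ 2.
Hypothesis Y_le : forall i, nsq (row i Y) <= 1.
Hypothesis rate_le : growth_rate K b2 h eta <= be ^+ 2.
Hypothesis Kh_le : K%:R * h ^+ 2 <= q ^+ 2.
Hypothesis nu_small : n%:R ^+ 3 * M1 * (be / ze) ^+ K <= 2^-1.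
Let e := q * M * Cx / be * (ze - be)^-1 + remainder_bound n p K be ze M1 Cx.
Hypothesis e_le1 : e <= 1.
Hypothesis dl_ge : (p`!)%:R * (p%:R * (2 + Cx / ze) ^+ p * e) <= dl.

Let be_gt0 : 0 < be. Proof. by case/andP: beze. Qed.

Let rate_ge0 : 0 <= growth_rate K b2 h eta.
Proof. by rewrite /growth_rate !addr_ge0 ?mulr_ge0// ltW. Qed.

Let rate_pow k : growth_rate K b2 h eta ^+ k <= (be ^+ k) ^+ 2.
Proof.
rewrite -exprM mulnC exprM; apply: lerXn2r => //; rewrite nnegrE//.
by rewrite exprn_ge0// ltW.
Qed.

(** The condition [1 <= M1] serves [k = 0]. For other powers [M / be <= M1] turns the factor [M] of
    the first step into the missing [be], and the square root of [n] is rounded up to [n]. *)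
Lemma good_entries (H : cmx R n) : ~ bad_entries S K b2 h eta (M ^+ 2) H ->
  forall k, (k <= K)%N -> forall a c,
    normc ((((H : 'M[C]_n) *m S) ^+ k) a c) <= n%:R * M1 * be ^+ k.
Proof.
have M10 : 0 <= M1 by apply: le_trans M1_ge1.
move=> HB [|k] kK a c.
  rewrite !expr0 mulr1; apply: (@le_trans _ _ 1).
    by rewrite mxE; case: (a == c); rewrite ?normc1 ?normc0.
  have n1 : 1 <= n%:R :> R by rewrite ler1n (leq_ltn_trans _ (ltn_ord a)).
  by rewrite -[leLHS]mulr1 ler_pM.
have {HB} : normc ((((H : 'M[C]_n) *m S) ^+ k.+1) a c) ^+ 2 <= M ^+ 2 * n%:R * (be ^+ k) ^+ 2.
  rewrite leNgt; apply/negP => lt; apply: HB; exists k => //; exists a, c.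
  apply: le_lt_trans lt; rewrite ler_wpM2l// ?rate_pow// mulr_ge0// exprn_ge0//.
have n1 : 1 <= n%:R :> R by rewrite ler1n (leq_ltn_trans _ (ltn_ord a)).
move=> h1; apply: sqr_le_le; first exact: normc_ge0.
  by apply: mulr_ge0; [rewrite mulr_ge0|exact/exprn_ge0/ltW].
apply: le_trans h1 _; rewrite (exprS be k).
have -> : (n%:R * M1 * (be * be ^+ k)) ^+ 2 = (M1 * be) ^+ 2 * n%:R ^+ 2 * (be ^+ k) ^+ 2.
  by ring.
rewrite ler_wpM2r ?sqr_ge0//; apply: ler_pM => //; first exact: sqr_ge0.
  rewrite lerXn2r ?nnegrE ?mulr_ge0 ?(ltW be_gt0)//.
  by rewrite -ler_pdivrMr.
by rewrite expr2 ler_peMl// ltW// (lt_le_trans _ n1).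
Qed.

(** The division by [be] compensates the shift between the power [k.+1] and the exponent [k] of the
    growth bound. *)
Lemma good_orbits (H : cmx R n) :
  (forall i j, ~ bad_orbit S K b2 h eta (M ^+ 2) (col j X) (adjmx (row i Y)) H) ->
  forall k, (0 < k < K)%N -> forall i j,
    normc ((Y *m ((H : 'M[C]_n) *m S) ^+ k *m X) i j) <= q * M * Cx / be * be ^+ k.
Proof.
move=> HB [|k] //= kK i j.
have E : (Y *m ((H : 'M[C]_n) *m S) ^+ k.+1 *m X) i j =
    (adjmx (adjmx (row i Y)) *m orbit_vec S (col j X) (H : 'M[C]_n) k.+1) 0 0.
  rewrite adjmxK /orbit_vec -mulmxA mxE [RHS]mxE; apply: eq_bigr => a _.
  rewrite !mxE; congr (_ * _); apply: eq_bigr => c _.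
  by rewrite !mxE.
rewrite E.
have {HB} : normc ((adjmx (adjmx (row i Y)) *m orbit_vec S (col j X) (H : 'M[C]_n) k.+1) 0 0) ^+ 2
    <= K%:R * h ^+ 2 * (M ^+ 2 * nsq (col j X) * growth_rate K b2 h eta ^+ k).
  rewrite leNgt; apply/negP => lt; apply: (HB i j); exists k; first exact: ltnW.
  by right.
move=> h1; apply: sqr_le_le; first exact: normc_ge0.
  by rewrite !mulr_ge0 ?invr_ge0 ?exprn_ge0 ?(ltW be_gt0).
apply: le_trans h1 _.
have -> : (q * M * Cx / be * be ^+ k.+1) ^+ 2 = q ^+ 2 * (M ^+ 2 * Cx ^+ 2 * (be ^+ k) ^+ 2).
  have -> : q * M * Cx / be * be ^+ k.+1 = q * M * Cx * be ^+ k.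
    by rewrite (exprS be k) mulrA mulfVK// gt_eqF.
  by ring.
apply: ler_pM => //.
- by rewrite mulr_ge0// sqr_ge0.
- by rewrite !mulr_ge0 ?sqr_ge0 ?nsq_ge0 ?exprn_ge0.
apply: ler_pM => //.
- by rewrite mulr_ge0 ?sqr_ge0 ?nsq_ge0.
- exact: exprn_ge0.
by rewrite ler_wpM2l ?sqr_ge0.
Qed.

Lemma good_pair_section (H : cmx R n) : ~ bad_entries S K b2 h eta (M ^+ 2) H ->
  (forall i j, ~ bad_orbit S K b2 h eta (M ^+ 2) (col j X) (adjmx (row i Y)) H) ->
  good_pair K (n%:R * M1 * be ^+ K) dl ze ((H : 'M[C]_n) *m S) P.
Proof.
move=> /good_entries gE /good_orbits gO; split; first exact: gE.
move=> a b ab; set z := _ +i* _ in ab *.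
have M10 : 0 <= M1 by apply: le_trans M1_ge1.
have qb0 : 0 <= q * M * Cx / be by rewrite !mulr_ge0// invr_ge0 ltW.
have Y1 i k : normc (Y i k) <= 1.
  apply: sqr_le_le => //; first exact: normc_ge0.
  rewrite expr1n; apply: le_trans (Y_le i); have := nsq_entry (row i Y) 0 k.
  by rewrite mxE.
have X1 k j : normc (X k j) <= Cx.
  apply: sqr_le_le => //; first exact: normc_ge0.
  apply: le_trans (X_le j); have := nsq_entry (col j X) k 0.
  by rewrite mxE.
have YX1 i j : normc ((Y *m X) i j) <= Cx.
  apply: sqr_le_le => //; first exact: normc_ge0.
  apply: le_trans (mulmx_cauchy _ _ _ _) _.
  rewrite -[leRHS]mul1r; apply: ler_pM.
  - by apply: sumr_ge0 => ? _; exact: sqr_ge0.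
  - by apply: sumr_ge0 => ? _; exact: sqr_ge0.
  - apply: le_trans (Y_le i); rewrite /nsq big_ord1 le_eqVlt; apply/orP; left; apply/eqP.
    by apply: eq_bigr => ? _; rewrite mxE.
  - apply: le_trans (X_le j); rewrite nsq_col le_eqVlt; apply/orP; left; apply/eqP.
    by apply: eq_bigr => ? _; rewrite mxE.
have := @det_close R n p K _ X Y be ze M1 (q * M * Cx / be) Cx beze M10 qb0 Cx_ge0
  gE gO Y1 X1 YX1 nu_small K_gt0 z (ltW ab) e_le1.
rewrite -PE /close_at => /le_trans; apply.
by rewrite ler_wpM2r ?normc_ge0.
Qed.

Lemma good_pair_haar (lam : probability (cmx R n) R) : stab_law 0 lam ->
  (lam [set H : cmx R n | ~ good_pair K (n%:R * M1 * be ^+ K) dl ze ((H : 'M[C]_n) *m S) P]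
   <= ((2 + (p * p)%:R) * (K%:R * step_error n K h eta (M ^+ 2) (n%:R * M ^+ 4) 1))%:E)%E.
Proof.
move=> l0.
have W0 : 0 <= n%:R * M ^+ 4 by rewrite mulr_ge0 ?exprn_ge0.
have S_adj := adj_op_bound (sqr_ge0 M) S_op.
apply: (section_bound Kn b2_ge0 h_gt0 eta_gt0 (sqr_ge0 M) W0 S_op S_adj S_nsq S_W0 l0
  (X := X) (Y := Y)).
- apply: measurableC; apply: measurable_good_pair; last exact: mxmeas_cst.
  by apply: mxmeasM; [exact: mxmeas_id|exact: mxmeas_cst].
- exact: Y_le.
by move=> H HE HO /=; apply; exact: good_pair_section.
Qed.

End SectionEvent.

(** * Asymptotics *)

Section Asymptotics.
Variable R : realType.

(* Logarithmically many steps: a geometric decay beats any power of [n], while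
   the errors, polynomial in the number of steps, stay below [n]. *)
Definition nb_steps (c n : nat) : nat := (c * (trunc_log 2 n).+1)%N.

(** The constant [c] makes [th ^+ c] at most [2 ^ -9]. With [n <= 2 ^ L], eight of the nine factors
    [2 ^ L] thus gained pay for [n ^ 8] and the ninth tends to infinity. *)
Lemma nb_steps_geometric (th : R) : 0 < th < 1 -> exists2 c : nat, (0 < c)%N &
  forall t : R, 0 < t -> exists N, forall n, (N <= n)%N ->
    n%:R ^+ 8 * th ^+ nb_steps c n <= t.
Proof.
move=> /andP[th0 th1].
have th01 : 0 <= th < 1 by rewrite ltW.
have e0 : 0 < (2 ^+ 9)^-1 :> R by rewrite invr_gt0 exprn_gt0.
have [c Hc] := geom_small th01 e0.
exists c.+1 => // t t0; exists (Num.truncn t^-1).+1 => n nN.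
have n0 : (0 < n)%N by apply: leq_trans nN.
have tn : t^-1 <= n%:R.
  apply: ltW; apply: lt_le_trans (truncnS_gt _) _.
  by rewrite ler_nat.
set L := (trunc_log 2 n).+1.
have nL : n%:R <= 2 ^+ L :> R.
  by rewrite -natrX ler_nat ltnW// trunc_log_ltn.
have x0 : 0 < 2 ^+ L :> R by rewrite exprn_gt0.
have h1 : th ^+ nb_steps c.+1 n <= ((2 ^+ L)^-1) ^+ 9.
  rewrite /nb_steps exprM.
  apply: (@le_trans _ _ (((2 ^+ 9)^-1) ^+ L)).
    apply: lerXn2r; rewrite ?nnegrE ?exprn_ge0 ?invr_ge0 ?(ltW th0)//.
    exact: Hc.
  by rewrite !exprVn -!exprM mulnC.
apply: (@le_trans _ _ ((2 ^+ L) ^+ 8 * ((2 ^+ L)^-1) ^+ 9)).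
  apply: ler_pM => //; rewrite ?exprn_ge0 ?(ltW th0)//.
  by rewrite lerXn2r ?nnegrE// ltW.
have -> : (2 ^+ L) ^+ 8 * ((2 ^+ L)^-1) ^+ 9 = (2 ^+ L)^-1 :> R.
  by field; rewrite gt_eqF.
rewrite -[leRHS]invrK lef_pV2 ?posrE ?invr_gt0//.
exact: le_trans tn nL.
Qed.

(** With [m] a fifth of the logarithm, the number of steps is at most [5 * c * 2 ^ m], while [n] is
    at least [2 ^ (5 * m)]. After the fourth power a factor [2 ^ m] remains to beat the constants,
    among them [625 = 5 ^ 4]. *)
Lemma nb_steps_pow4 (c : nat) (t : R) : 0 < t -> exists N, forall n, (N <= n)%N ->
  (nb_steps c n)%:R ^+ 4 <= t * n%:R :> R.
Proof.
move=> t0; pose A : R := 625 * c%:R ^+ 4.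
pose m0 := (Num.truncn (A / t)).+1.
exists (2 ^ (5 * m0))%N => n nN.
have n0 : (0 < n)%N by apply: leq_trans nN; rewrite expn_gt0.
set L := trunc_log 2 n; pose m := (L %/ 5)%N.
have Ln : (2 ^ L <= n)%N by exact: trunc_logP.
have m0L : (5 * m0 <= L)%N by exact: trunc_log_max.
have m0m : (m0 <= m)%N by rewrite /m leq_divRL// mulnC.
have L5 : (L.+1 <= 5 * 2 ^ m)%N.
  apply: (@leq_trans (5 * m.+1)).
    by rewrite mulnC ltn_ceil.
  by rewrite leq_mul2l /= ltn_expl.
have h1 : (nb_steps c n)%:R <= (5 * c%:R) * 2 ^+ m :> R.
  rewrite /nb_steps -/L -natrX -!natrM ler_nat (mulnC 5) -mulnA.
  by rewrite leq_mul2l L5 orbT.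
have h2 : (2 ^+ m) ^+ 5 <= n%:R :> R.
  rewrite -exprM -natrX ler_nat; apply: leq_trans Ln.
  by rewrite leq_exp2l// leq_trunc_div.
have h3 : A <= t * 2 ^+ m.
  rewrite -ler_pdivrMl// mulrC; apply: ltW; apply: lt_le_trans (truncnS_gt _) _.
  rewrite -natrX ler_nat (leq_trans m0m)//; exact: ltnW (ltn_expl _ _).
have x0 : 0 < 2 ^+ m :> R by rewrite exprn_gt0.
apply: (@le_trans _ _ (((5 * c%:R) * 2 ^+ m) ^+ 4)).
  by rewrite lerXn2r ?nnegrE ?mulr_ge0// ltW.
apply: (@le_trans _ _ (t * (2 ^+ m) ^+ 5)); last by rewrite ler_wpM2l// ltW.
have -> : ((5 * c%:R) * 2 ^+ m) ^+ 4 = A * (2 ^+ m) ^+ 4 by rewrite /A; ring.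
have -> : t * (2 ^+ m) ^+ 5 = (t * 2 ^+ m) * (2 ^+ m) ^+ 4 by ring.
by rewrite ler_wpM2r// exprn_ge0// ltW.
Qed.

(** The fourth power of [K] comes from [K] steps, up to [K] earlier columns at each step, and
    [h ^ 2 = q ^ 2 / K ^ 2]. The condition [2 * K <= n] replaces [n - K] by [n / 2]. *)
Lemma step_error_le (n K : nat) (q eta M t : R) (r p : nat) :
  (0 < K)%N -> 0 < q -> 0 < eta -> 0 <= M -> (p <= r)%N -> (2 * K <= n)%N ->
  (2 + (r * r)%:R) * (8 * M ^+ 4 / eta ^+ 2 + 2 * (1 + M ^+ 4) / q ^+ 2) * K%:R ^+ 4
    <= t * n%:R ->
  (2 + (p * p)%:R) * (K%:R * step_error n K (q / K%:R) eta (M ^+ 2) (n%:R * M ^+ 4) 1) <= t.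
Proof.
move=> K0 q0 eta0 M0 pr K2n Ht.
have n0 : (0 < n)%N by apply: leq_trans K2n; rewrite muln_gt0.
have nR : 0 < n%:R :> R by rewrite ltr0n.
have KR : 1 <= K%:R :> R by rewrite ler1n.
have KR0 : 0 < K%:R :> R by lra.
have M40 : 0 <= M ^+ 4 by rewrite exprn_ge0.
have nK : n%:R / 2 <= (n - K)%:R :> R.
  rewrite natrB; last by apply: leq_trans K2n; rewrite leq_pmull.
  have : (2 * K)%:R <= n%:R :> R by rewrite ler_nat.
  by rewrite natrM; lra.
have nK0 : 0 < (n - K)%:R :> R by apply: lt_le_trans nK; rewrite divr_gt0.
set m : R := (n - K)%:R in nK nK0.
have eta20 : 0 < eta ^+ 2 by rewrite exprn_gt0.
have q20 : 0 < q ^+ 2 by rewrite exprn_gt0.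
have t1 : 2 * (n%:R * M ^+ 4) / (m ^+ 2 * eta ^+ 2) <= 8 * M ^+ 4 / eta ^+ 2 / n%:R.
  have -> : 8 * M ^+ 4 / eta ^+ 2 / n%:R = 2 * (n%:R * M ^+ 4) / ((n%:R / 2) ^+ 2 * eta ^+ 2).
    by field; rewrite !gt_eqF.
  rewrite ler_wpM2l ?mulr_ge0 ?(ltW nR)// lef_pV2 ?posrE ?mulr_gt0 ?exprn_gt0 ?divr_gt0//.
  by rewrite ler_pM2r// lerXn2r ?nnegrE ?(ltW nK0) ?divr_ge0 ?(ltW nR).
have t2 : (1 + K%:R * (M ^+ 2) ^+ 2) / (m * (q / K%:R) ^+ 2) <=
    2 * (1 + M ^+ 4) / q ^+ 2 * K%:R ^+ 3 / n%:R.
  have -> : 2 * (1 + M ^+ 4) / q ^+ 2 * K%:R ^+ 3 / n%:R =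
      (K%:R * (1 + M ^+ 4)) / (n%:R / 2 * (q / K%:R) ^+ 2).
    by field; rewrite !gt_eqF.
  apply: ler_pM.
  - by rewrite addr_ge0// mulr_ge0// sqr_ge0.
  - by rewrite invr_ge0 mulr_ge0 ?sqr_ge0// ltW.
  - by rewrite -exprM mulrDr mulr1 lerD2r.
  - have qK : 0 < (q / K%:R) ^+ 2 by rewrite exprn_gt0// divr_gt0.
    by rewrite lef_pV2 ?posrE ?(mulr_gt0 _ qK) ?divr_gt0// ler_pM2r.
have se : step_error n K (q / K%:R) eta (M ^+ 2) (n%:R * M ^+ 4) 1 <=
    (8 * M ^+ 4 / eta ^+ 2 + 2 * (1 + M ^+ 4) / q ^+ 2) * K%:R ^+ 3 / n%:R.
  rewrite /step_error -/m; apply: le_trans (lerD t1 t2) _.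
  set x := 8 * _ / _; set y := 2 * _ / _.
  have x0 : 0 <= x by rewrite /x !mulr_ge0// invr_ge0 ltW.
  have -> : (x + y) * K%:R ^+ 3 / n%:R = x * K%:R ^+ 3 / n%:R + y * K%:R ^+ 3 / n%:R by ring.
  rewrite lerD2r ler_pM2r ?invr_gt0// ler_peMr//; exact: exprn_ege1.
have se0 : 0 <= step_error n K (q / K%:R) eta (M ^+ 2) (n%:R * M ^+ 4) 1.
  have v0 : 0 <= n%:R * M ^+ 4 by rewrite mulr_ge0.
  have d0 : 0 <= K%:R * (M ^+ 2) ^+ 2 by rewrite mulr_ge0// sqr_ge0.
  rewrite /step_error -/m; apply: addr_ge0; apply: divr_ge0.
  - by rewrite mulr_ge0.
  - by apply: mulr_ge0; apply: sqr_ge0.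
  - by rewrite addr_ge0.
  - by rewrite mulr_ge0 ?(ltW nK0)// sqr_ge0.
apply: (@le_trans _ _ ((2 + (r * r)%:R) * (K%:R *
   ((8 * M ^+ 4 / eta ^+ 2 + 2 * (1 + M ^+ 4) / q ^+ 2) * K%:R ^+ 3 / n%:R)))).
  apply: ler_pM; rewrite ?lerD2l ?ler_nat ?leq_mul//.
  - by rewrite mulr_ge0.
  by rewrite ler_pM2l.
have -> : (2 + (r * r)%:R) * (K%:R *
   ((8 * M ^+ 4 / eta ^+ 2 + 2 * (1 + M ^+ 4) / q ^+ 2) * K%:R ^+ 3 / n%:R)) =
   (2 + (r * r)%:R) * (8 * M ^+ 4 / eta ^+ 2 + 2 * (1 + M ^+ 4) / q ^+ 2) * K%:R ^+ 4 / n%:R.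
  by field; rewrite !gt_eqF.
by rewrite ler_pdivrMr.
Qed.

Lemma haar_good_pair (b eps M Cx dl : R) (r : nat) :
  0 <= b -> 0 < eps -> 0 < M -> 0 <= Cx -> 0 < dl ->
  exists (be ze M1 g : R) (K : nat -> nat), [/\ 0 < g, 0 < ze, ze < b + eps &
  forall t, 0 < t -> exists N, forall n, (N <= n)%N ->
    (n * n)%:R * (n%:R * M1 * be ^+ K n) < ze ^+ K n /\
    forall (S P : 'M[R[i]]_n),
      (forall z : 'cV[R[i]]_n, nsq (S *m z) <= M ^+ 2 * nsq z) ->
      nsq S <= n%:R * (b ^+ 2 + g) -> nsq (adjmx S *m S) <= n%:R * M ^+ 4 ->
      (\rank P <= r)%N -> opnorm P <= Cx ->
      forall lam : probability (cmx R n) R, stab_law 0 lam ->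
      (lam [set H : cmx R n | ~ good_pair (K n) (n%:R * M1 * be ^+ K n) dl ze
         ((H : 'M[R[i]]_n) *m S) P] <= t%:E)%E].
Proof.
move=> b0 eps0 M0 Cx0 dl0.
(* [be] bounds the growth of the orbits and the determinants are compared beyond [ze]; the margin
   left up to [b + eps] absorbs the passage from rational points to all points. *)
pose be := b + eps / 2; pose ze := b + 3 / 4 * eps.
have be0 : 0 < be by rewrite /be; lra.
have beze : 0 < be < ze by rewrite be0 /be /ze; lra.
have ze0 : 0 < ze by rewrite /ze; lra.
(* The room [G] is spent in quarters: the deviation of the trace, the replacement of [n] by [n - K],
   the deviation [eta] of the quadratic forms, and the accumulated correlations [K%:R * h = q]. *)
pose G := be ^+ 2 - b ^+ 2.
have G0 : 0 < G.
  rewrite subr_gt0 ltrXn2r ?nnegrE ?(ltW be0)//; rewrite /be; lra.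
pose M1 := Num.max 1 (M / be).
have M11 : 1 <= M1 by rewrite le_max lexx.
have M12 : M / be <= M1 by rewrite le_max lexx orbT.
have zb : 0 < ze - be by rewrite subr_gt0; case/andP: beze.
pose Q : R := (r`!)%:R * (r%:R * (2 + Cx / ze) ^+ r).
have Cz0 : 0 <= Cx / ze by rewrite divr_ge0// ltW.
have Q0 : 0 <= Q by rewrite mulr_ge0 ?mulr_ge0 ?exprn_ge0//; lra.
pose e0 := Num.min 1 (dl / (Q + 1)).
have e00 : 0 < e0 by rewrite lt_min ltr01 divr_gt0//; lra.
have e01 : e0 <= 1 by rewrite ge_min lexx.
have e0Q : Q * e0 <= dl.
  have : e0 <= dl / (Q + 1) by rewrite ge_min lexx orbT.
  by rewrite ler_pdivlMr ?mulrDr ?mulr1; lra.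
pose D := M * Cx / be * (ze - be)^-1.
have D0 : 0 <= D by rewrite !mulr_ge0 ?invr_ge0 ?(ltW be0) ?(ltW zb) ?(ltW M0).
(* The second bound leaves half of [e0] to the correlations and the other half to the remainder.
   Dividing by [D + 1] covers the case [D = 0]. *)
pose q := Num.min (G / 4) (e0 / 2 / (D + 1)).
have q0 : 0 < q by rewrite lt_min !divr_gt0//; lra.
have q1 : q <= G / 4 by rewrite ge_min lexx.
have q2 : q * D <= e0 / 2.
  have : q <= e0 / 2 / (D + 1) by rewrite ge_min lexx orbT.
  by rewrite ler_pdivlMr ?mulrDr ?mulr1; lra.
pose th := be / ze.
have th01 : 0 < th < 1.
  by rewrite divr_gt0//= ltr_pdivrMr// mul1r; case/andP: beze.
have [c c0 Hgeo] := nb_steps_geometric th01.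
exists be, ze, M1, (G / 4), (nb_steps c); split => //.
- by rewrite divr_gt0.
- by rewrite /ze; lra.
move=> t t0.
pose b2 := b ^+ 2 + G / 2; pose eta := G / 4.
have eta0 : 0 < eta by rewrite divr_gt0.
have b20 : 0 <= b2 by rewrite addr_ge0 ?sqr_ge0// divr_ge0// ltW.
pose Err : R := (2 + (r * r)%:R) * (8 * M ^+ 4 / eta ^+ 2 + 2 * (1 + M ^+ 4) / q ^+ 2).
have Err0 : 0 <= Err.
  have M4 : 0 <= M ^+ 4 by rewrite exprn_ge0// ltW.
  apply: mulr_ge0; first by rewrite addr_ge0.
  by apply: addr_ge0; apply: divr_ge0; rewrite ?sqr_ge0// mulr_ge0// addr_ge0.
pose J : R := r%:R ^+ 2 * (2 * M1 ^+ 2 * Cx * (ze - be)^-1).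
have M10 : 0 < M1 by lra.
have J0 : 0 <= J.
  rewrite mulr_ge0 ?sqr_ge0//; apply: divr_ge0 (ltW zb); apply: mulr_ge0 Cx0.
  by rewrite mulr_ge0 ?sqr_ge0.
have J1 : 0 < J + 1 by lra.
have Err1 : 0 < Err + 1 by lra.
have b21 : 0 < b2 + 1 by lra.
have pos1 : 0 < e0 / 2 / (J + 1) by rewrite !divr_gt0.
have pos2 : 0 < (2 * M1)^-1 / 2 by rewrite divr_gt0// invr_gt0 mulr_gt0.
have pos3 : 0 < t / (Err + 1) by rewrite divr_gt0.
have pos4 : 0 < 2^-1 :> R by rewrite invr_gt0.
have pos5 : 0 < G / 4 / (b2 + 1) by rewrite !divr_gt0.
have [N1 H1] := Hgeo _ pos1.
have [N2 H2] := Hgeo _ pos2.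
have [N3 H3] := nb_steps_pow4 c pos3.
have [N4 H4] := nb_steps_pow4 c pos4.
have [N5 H5] := nb_steps_pow4 c pos5.
exists (N1 + N2 + N3 + N4 + N5).+1 => n nN.
have leN1 : (N1 <= n)%N by clear -nN; lia.
have leN2 : (N2 <= n)%N by clear -nN; lia.
have leN3 : (N3 <= n)%N by clear -nN; lia.
have leN4 : (N4 <= n)%N by clear -nN; lia.
have leN5 : (N5 <= n)%N by clear -nN; lia.
have n0 : (0 < n)%N by clear -nN; lia.
move: (H1 n leN1) (H2 n leN2) (H3 n leN3) (H4 n leN4) (H5 n leN5) => {H1 H2 H3 H4 H5} H1 H2 H3 H4 H5.
set K := nb_steps c n in H1 H2 H3 H4 H5 *.
have K0 : (0 < K)%N by rewrite /K /nb_steps muln_gt0 c0.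
have n1R : 1 <= n%:R :> R by rewrite ler1n.
have K1R : 1 <= K%:R :> R by rewrite ler1n.
have K4 : K%:R <= K%:R ^+ 4 :> R.
  by rewrite exprS ler_peMr// exprn_ege1.
have K2n : (2 * K <= n)%N by rewrite -(ler_nat R) natrM; lra.
have Kn : (K < n)%N by clear -K2n K0; lia.
have thK0 : 0 < th ^+ K by rewrite exprn_gt0//; case/andP: th01.
have nu : n%:R ^+ 3 * M1 * th ^+ K <= 4^-1.
  have n38 : n%:R ^+ 3 <= n%:R ^+ 8 :> R by exact: ler_weXn2l.
  have := ler_wpM2r (ltW thK0) n38 => h.
  have := le_trans h H2; rewrite invfM => h'.
  have := ler_wpM2l (ltW M10) h'.
  have -> : M1 * (2^-1 / M1 / 2) = 4^-1 by field; rewrite gt_eqF.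
  by rewrite mulrCA mulrA.
split.
  have zeK : 0 < ze ^+ K by rewrite exprn_gt0.
  have thE : th ^+ K * ze ^+ K = be ^+ K by rewrite -exprMn divfK// gt_eqF.
  rewrite natrM.
  have -> : n%:R * n%:R * (n%:R * M1 * be ^+ K) = (n%:R ^+ 3 * M1 * th ^+ K) * ze ^+ K.
    by rewrite -thE; ring.
  by rewrite gtr_pMl//; lra.
move=> S P S_op S_nsq S_W0 rP PC lam l0.
have [p [pr [X [Y [PE Xc Yr]]]]] := low_rank_factor rP PC.
have pR : p%:R <= r%:R :> R by rewrite ler_nat.
have K0R : 0 < K%:R :> R by rewrite ltr0n.
pose h := q / K%:R.
have h0 : 0 < h by rewrite divr_gt0.
have hK : K%:R * h = q by rewrite /h mulrC divfK// gt_eqF.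
have err_le : (2 + (p * p)%:R) * (K%:R * step_error n K h eta (M ^+ 2) (n%:R * M ^+ 4) 1) <= t.
  apply: (step_error_le K0 q0 eta0 (ltW M0) pr K2n).
  rewrite -/Err; apply: le_trans (ler_wpM2l Err0 H3) _.
  rewrite mulrA ler_pM2r ?ltr0n// mulrCA ger_pMr// ler_pdivrMr// mul1r.
  by rewrite lerDl.
have remainder_le : remainder_bound n p K be ze M1 Cx <= e0 / 2.
  rewrite /remainder_bound -/th.
  have -> : p%:R ^+ 2 * n%:R ^+ 8 * (2 * M1 ^+ 2 * Cx / (ze - be)) * th ^+ K =
    p%:R ^+ 2 * (2 * M1 ^+ 2 * Cx / (ze - be)) * (n%:R ^+ 8 * th ^+ K) by ring.
  have J' : p%:R ^+ 2 * (2 * M1 ^+ 2 * Cx / (ze - be)) <= J + 1.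
    apply: (@le_trans _ _ J); last by rewrite lerDl.
    rewrite ler_wpM2r//; last by rewrite lerXn2r ?nnegrE.
    apply: divr_ge0 (ltW zb); apply: mulr_ge0 Cx0.
    by rewrite mulr_ge0 ?sqr_ge0.
  have x0 : 0 <= n%:R ^+ 8 * th ^+ K by apply: mulr_ge0 (ltW thK0); rewrite exprn_ge0.
  apply: le_trans (ler_wpM2r x0 J') _.
  by rewrite mulrC -ler_pdivlMr.
pose ee := q * M * Cx / be * (ze - be)^-1 + remainder_bound n p K be ze M1 Cx.
have eeE : q * M * Cx / be * (ze - be)^-1 = q * D by rewrite /D; ring.
have ee_le : ee <= e0 by rewrite /ee eeE; lra.
have ee0 : 0 <= ee.
  rewrite /ee eeE; apply: addr_ge0; first exact: mulr_ge0 (ltW q0) D0.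
  rewrite /remainder_bound -/th; apply: mulr_ge0 (ltW thK0); apply: mulr_ge0.
    by rewrite mulr_ge0 ?exprn_ge0.
  apply: divr_ge0 (ltW zb); apply: mulr_ge0 Cx0.
  by rewrite mulr_ge0 ?sqr_ge0.
apply: le_trans (@good_pair_haar R n K p S P X Y b2 h eta M Cx be ze q M1 dl K0 Kn b20 h0 eta0
  (ltW M0) Cx0 beze (ltW q0) M11 M12 S_op _ S_W0 PE Xc Yr _ _ _ _ _ lam l0) _.
- apply: le_trans S_nsq _; rewrite natrB ?(ltnW Kn)//.
  have KG : K%:R * (b2 + 1) <= G / 4 * n%:R.
    rewrite -ler_pdivlMr; last by lra.
    by apply: le_trans K4 _; rewrite mulrAC.
  rewrite /b2 in KG *; lra.
- rewrite /growth_rate hK /b2 /eta; rewrite /G in q1 *; lra.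
- rewrite expr2 mulrA hK expr2 ler_pM2l// /h ler_pdivrMr// ler_peMr// ltW//.
- by rewrite -/th; lra.
- by rewrite -/ee; lra.
- rewrite -/ee; apply: le_trans e0Q; rewrite mulrA.
  have Cz1 : 1 <= 2 + Cx / ze by clear -Cz0; lra.
  have Czp : 0 <= (2 + Cx / ze) ^+ p by rewrite exprn_ge0// (le_trans ler01).
  apply: ler_pM => //; first by rewrite mulr_ge0// mulr_ge0.
  apply: ler_pM => //; first by rewrite mulr_ge0.
    by rewrite ler_nat leq_fact.
  by apply: ler_pM => //; exact: ler_weXn2l.
by rewrite lee_fin.
Qed.

End Asymptotics.

Section Limits.
Variable R : realType.

Lemma cvg_to_0eP (f : nat -> \bar R) : (forall n, (0 <= f n)%E) ->
  (f @ \oo --> 0%E) <->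
  (forall t : R, 0 < t -> exists N, forall n, (N <= n)%N -> (f n <= t%:E)%E).
Proof.
move=> f0; split=> [/fine_cvgP[[N1 _ fN1] /cvgrPdist_le fc] t t0|H].
  have [N2 _ fN2] := fc t t0.
  exists (maxn N1 N2) => n; rewrite geq_max => /andP[nN1 nN2].
  rewrite -(fineK (fN1 n nN1)) lee_fin.
  by have := fN2 n nN2; rewrite /= sub0r normrN; apply: le_trans; exact: ler_norm.
have ffin t N n : (forall n, (N <= n)%N -> (f n <= t%:E)%E) -> (N <= n)%N ->
    f n \is a fin_num.
  move=> HN nN; rewrite ge0_fin_numE//; apply: le_lt_trans (HN n nN) _.
  exact: ltry.
apply/fine_cvgP; split.
  by have [N HN] := H 1 ltr01; exists N => // n; exact: ffin HN.
apply/cvgrPdist_le => t t0; have [N HN] := H t t0.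
exists N => // n nN /=; rewrite sub0r normrN ger0_norm ?fine_ge0//.
by rewrite -lee_fin fineK ?HN//; exact: ffin HN nN.
Qed.

Lemma argmin_seq (T : eqType) (f : T -> R) (s : seq T) : s != [::] ->
  exists2 x, x \in s & forall y, y \in s -> f x <= f y.
Proof.
elim: s => // a s IH _; have [->|/IH[x xs xmin]] := eqVneq s [::].
  by exists a; rewrite ?inE// => y; rewrite inE => /eqP ->.
have [ax|xa] := leP (f a) (f x).
  exists a; rewrite ?inE ?eqxx// => y; rewrite inE => /orP[/eqP->//|/xmin].
  exact: le_trans.
exists x; rewrite ?inE ?xs ?orbT// => y; rewrite inE => /orP[/eqP->|/xmin//].
exact: ltW.
Qed.

(* The labelling minimizes the largest displacement over the permutations of a
   list, so that it does not depend on the precision [D]. *)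
Lemma best_labeling (l : seq R[i]) (Q : seq R[i] -> Prop) :
  (forall m m', Q m -> perm_eq m m' <-> Q m') ->
  exists m0, forall D, 0 < D ->
    (exists2 m, Q m & all2 (fun c y => normc (y - c) < D) l m) ->
    Q m0 /\ all2 (fun c y => normc (y - c) < D) l m0.
Proof.
move=> Qperm; pose cost m := \big[Num.max/0]_(p <- zip l m) normc (p.2 - p.1).
have costP D m : 0 < D -> size l = size m ->
    all2 (fun c y => normc (y - c) < D) l m = (cost m < D).
  move=> D0 lm; rewrite all2E lm eqxx /= /cost; elim: (zip l m) => [|p z IH].
    by rewrite big_nil D0.
  by rewrite big_cons gt_max /= IH.
(* If no list satisfying [Q] has the length of [l], the premise on [m] never holds and any [m0] will
   do. *)
have [[m1 Q1 s1]|noQ] := pselect (exists2 m, Q m & size l = size m); last first.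
  exists [::] => D D0 [m Qm]; rewrite all2E => /andP[/eqP lm _].
  by case: noQ; exists m.
have [|m0 m0p m0min] := @argmin_seq _ cost (permutations m1).
  by apply/eqP => m1E; have := perm_refl m1; rewrite -mem_permutations m1E.
have Q0 : Q m0 by apply/(Qperm m1) => //; rewrite perm_sym -mem_permutations.
have s0 : size l = size m0.
  by rewrite s1; apply/esym/perm_size; rewrite -mem_permutations.
exists m0 => D D0 [m Qm am]; split=> //.
have sm : size l = size m by move: am; rewrite all2E => /andP[/eqP].
rewrite costP// (le_lt_trans (m0min m _)) -?costP//.
by rewrite mem_permutations perm_sym; apply/(Qperm m1).
Qed.

End Limits.

(** * The random model and the conclusion *)

Section Model.
Variable R : realType.
Local Notation C := R[i].

Lemma lists_eigenvalues_perm n (A : 'M[C]_n) (p : pred C) m m' :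
  lists_eigenvalues A p m -> perm_eq m m' <-> lists_eigenvalues A p m'.
Proof.
move=> Am; split=> [/seq.permP mm' z|Am'].
  by rewrite -mm'; exact: Am.
by apply/allP => z _ /=; rewrite Am Am'.
Qed.

(** The two clauses of [good_pair] act separately: the bound on [A ^+ K] keeps the spectrum of [A]
    below [b + eps], and closeness at rational points extends to all the points where determinants
    are compared. *)
Lemma good_pair_outliers (b eps M D : R) (r : nat) :
  0 <= b -> 0 < eps -> 0 <= M -> 0 < D ->
  exists2 dl : R, 0 < dl & forall n K ka ze (A P : 'M[C]_n),
    0 < ze -> ze < b + eps -> (n * n)%:R * ka < ze ^+ K ->
    (\rank P <= r)%N -> opnorm P <= M ->
    (forall z, eigenvalue P z -> ~ (b + eps < normc z < b + 3 * eps)) ->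
    good_pair K ka dl ze A P ->
  forall l, lists_eigenvalues P (fun z => b + 3 * eps <= normc z) l ->
  exists2 m, lists_eigenvalues (A + P) (fun z => b + 2 * eps < normc z) m &
    all2 (fun c y => normc (y - c) < D) l m.
Proof.
move=> b0 eps0 M0 D0; have [dl dl0 H] := matrix_outliers r b0 eps0 M0 D0.
exists dl => // n K ka ze A P ze0 zeb kaK rP PM band gp l.
have [p [pr [X [Y [PE _ _]]]]] := low_rank_factor rP PM.
apply: (H n p A P X Y) => //; last first.
  by move=> z zb; apply: (good_pair_close (ltW dl0) zeb gp).
move=> z zb; have zez : ze < normc z by exact: lt_le_trans zb.
have z0 : z != 0 by rewrite -normc_gt0 (lt_trans ze0).
rewrite -unitfE -unitmxE; apply: unitmx_small_power z0 gp.1 _.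
by apply: lt_le_trans kaK _; apply: lerXn2r (ltW zez); rewrite nnegrE ?normc_ge0// ltW.
Qed.

(** The unitary [V] changes neither norm. The last bound adds up [n] columns of squared norm at most
    [M ^+ 4]. *)
Lemma unitary_model_bounds n (T V : 'M[C]_n) (M : R) : V \is unitarymx -> opnorm T <= M ->
  [/\ forall z : 'cV[C]_n, nsq (T *m V *m z) <= M ^+ 2 * nsq z,
      nsq (T *m V) = nsq T &
      nsq (adjmx (T *m V) *m (T *m V)) <= n%:R * M ^+ 4].
Proof.
move=> Vu TM; split.
- by move=> z; rewrite -mulmxA -(nsq_unitaryl z Vu); exact: opnorm_nsq.
- exact: nsq_unitaryr.
have Vu' : adjmx V \is unitarymx by rewrite (trmxC_unitary V).
rewrite adjmxM -mulmxA (nsq_unitaryl _ Vu') mulmxA (nsq_unitaryr _ Vu) nsq_col_sum.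
rewrite mulr_natl -[X in _ *+ X]card_ord -sumr_const; apply: ler_sum => a _.
have T_op (z : 'cV[C]_n) : nsq (T *m z) <= M ^+ 2 * nsq z by exact: opnorm_nsq.
rewrite colE -mulmxA; apply: le_trans (adj_op_bound (sqr_ge0 M) T_op _) _.
apply: le_trans (ler_wpM2l (sqr_ge0 M) (T_op _)) _.
by rewrite nsq_delta mulr1 -exprD.
Qed.

Section Diagonal.
Variables (n : nat) (x : 'I_n -> R).
Let D : 'M[C]_n := diag_mx (\row_i (x i)%:C).

Lemma nsq_diag (z : 'cV[C]_n) : nsq (D *m z) = \sum_i x i ^+ 2 * normc (z i 0) ^+ 2.
Proof.
rewrite nsq_col; apply: eq_bigr => i _; rewrite /D mul_diag_mx !mxE.
by rewrite normcM normc_real exprMn real_normK// num_real.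
Qed.

Lemma trace_diag_sqr : \tr (D *m D) = (nsq D)%:C.
Proof.
rewrite /D mulmx_diag mxtrace_diag nsq_col_sum rmorph_sum; apply: eq_bigr => i _.
rewrite colE nsq_diag (bigD1 i)//= big1 => [|j ji]; rewrite !mxE ?eqxx.
  by rewrite normc1 expr1n mulr1 addr0 rmorphM.
by rewrite (negPf ji) normc0 expr0n mulr0.
Qed.

Lemma opnorm_diag_le (M : R) : 0 <= M -> opnorm D <= M <-> forall i, `|x i| <= M.
Proof.
move=> M0; split=> [DM i|xM].
  have := opnorm_nsq (delta_mx i 0) DM.
  rewrite nsq_delta mulr1 -colE => /(le_trans (nsq_entry _ i 0)).
  rewrite /D !mxE eqxx normc_real => h.
  by rewrite -(@ler_pXn2r _ 2) ?nnegrE.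
apply: ge_sup.
  by exists (l2norm (D *m 0)), 0 => //=; rewrite l2norm_nsq nsq0 sqrtr0.
move=> _ [z /= z1 <-]; rewrite l2norm_nsq -(ger0_norm M0) -sqrtr_sqr ler_wsqrtr//.
rewrite nsq_diag; apply: (@le_trans _ _ (M ^+ 2 * nsq z)); last first.
  rewrite ler_piMr ?sqr_ge0// -(sqr_sqrtr (nsq_ge0 z)) expr_le1 ?sqrtr_ge0//.
  by rewrite -l2norm_nsq.
rewrite nsq_col mulr_sumr; apply: ler_sum => i _; apply: (ler_wpM2r (sqr_ge0 _)).
by rewrite -(real_normK (num_real (x i))) lerXn2r ?nnegrE.
Qed.

End Diagonal.

Section HaarModel.
Context d (Om : measurableType d) (Pr : probability Om R).

Lemma mu_ext_ae (Q : Om -> Prop) : {ae Pr, forall w, Q w} ->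
  mu_ext Pr [set w | ~ Q w] = 0%E.
Proof.
move=> [N [mN PN QN]]; apply/eqP; rewrite eq_le; apply/andP; split; last exact: mu_ext_ge0.
by rewrite -PN -measurable_mu_extE//; exact: le_mu_ext.
Qed.

Lemma mu_extU2 (A B : set Om) : (mu_ext Pr (A `|` B) <= mu_ext Pr A + mu_ext Pr B)%E.
Proof. exact: outer_measureU2. Qed.

Lemma haar_law n (U : Om -> cmx R n) : haar_unitary Pr U ->
  exists2 lam : probability (cmx R n) R, stab_law 0 lam &
    forall B, measurable B -> lam B = Pr (U @^-1` B).
Proof.
move=> [mU Uu _ Ur]; have [lam lamE] := image_law Pr mU.
exists lam => //; split.
  rewrite lamE; last exact: measurable_stab.
  apply: prob1_ae.
    by rewrite -[X in measurable X]setTI; apply: mU => //; exact: measurable_stab.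
  by apply: (@filterS _ _ (ae_filter_ringOfSetsType Pr) _ _ _ Uu) => w Uw; split.
move=> D [Du _] B mB; rewrite !lamE//; first exact: Ur.
by apply: measurable_cmx => //; apply: mxmeasM; [exact: mxmeas_id|exact: mxmeas_cst].
Qed.

Lemma haar_model_bound n (U T V P : Om -> cmx R n) K ka dl ze (t : R)
    (goodT goodP : 'M[C]_n -> Prop) :
  haar_unitary Pr U -> haar_unitary Pr V ->
  measurable_fun setT T -> measurable_fun setT P ->
  independent_rv Pr U V -> independent_rv Pr (fun w => (U w, V w)) T ->
  independent_rv Pr (fun w => (U w, T w, V w)) P -> 0 <= t ->
  (forall (T V P : 'M[C]_n) (lam : probability (cmx R n) R),
    goodT T -> V \is unitarymx -> goodP P -> stab_law 0 lam ->
    (lam [set H : cmx R n | ~ good_pair K ka dl ze ((H : 'M[C]_n) *m (T *m V)) P] <= t%:E)%E) ->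
  (mu_ext Pr [set w | ~ good_pair K ka dl ze (U w *m T w *m V w) (P w)] <=
    t%:E + (mu_ext Pr [set w | ~ goodT (T w)] + mu_ext Pr [set w | ~ goodP (P w)]))%E.
Proof.
move=> hU hV mT mP UV UVT UTVP t0 Hlam.
have [lam lam0 lamE] := haar_law hU.
have mU : measurable_fun setT U by case: hU.
have mV : measurable_fun setT V by case: hV.
have mVT : measurable_fun setT (fun w => (V w, T w)) by exact/measurable_fun_pair.
have UVT_P : independent_rv Pr (fun w => (U w, (V w, T w))) P.
  move=> A B mA mB.
  pose g (q : cmx R n * cmx R n * cmx R n) := (q.1.1, (q.2, q.1.2)).
  have mg : measurable_fun setT g.
    apply/measurable_fun_pair; first exact: measurableT_comp measurable_fst measurable_fst.
    apply/measurable_fun_pair => //.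
    exact: measurableT_comp measurable_snd measurable_fst.
  apply: (UTVP (g @^-1` A)) => //.
  by rewrite -[X in measurable X]setTI; exact: mg.
have ind := indep_assoc mU mVT mP (indep_assoc mU mV mT UV UVT) UVT_P.
pose B := [set q : cmx R n * (cmx R n * cmx R n * cmx R n) |
  ~ good_pair K ka dl ze ((q.1 : 'M[C]_n) *m ((q.2.1.2 : 'M[C]_n) *m (q.2.1.1 : 'M[C]_n)))
    (q.2.2 : 'M[C]_n)].
have m1 : measurable_fun setT (fun q : cmx R n * (cmx R n * cmx R n * cmx R n) => q.2.1).
  exact: measurableT_comp measurable_fst measurable_snd.
have mB : measurable B.
  apply: measurableC; apply: measurable_good_pair; last first.
    exact: mxmeas_comp (measurableT_comp measurable_snd measurable_snd) (@mxmeas_id R n).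
  apply: mxmeasM; first exact: mxmeas_comp measurable_fst (@mxmeas_id R n).
  apply: mxmeasM.
    exact: mxmeas_comp (measurableT_comp measurable_snd m1) (@mxmeas_id R n).
  exact: mxmeas_comp (measurableT_comp measurable_fst m1) (@mxmeas_id R n).
have mZ : measurable_fun setT (fun w => (V w, T w, P w)) by exact/measurable_fun_pair.
pose good (z : cmx R n * cmx R n * cmx R n) :=
  [/\ (z.1.1 : 'M[C]_n) \is unitarymx, goodT z.1.2 & goodP z.2].
have := conditional_bound (good := good) mU mZ lamE ind mB t0.
have mBad : measurable [set w | B (U w, (V w, T w, P w))].
  have mUZ : measurable_fun setT (fun w => (U w, (V w, T w, P w))).
    exact/measurable_fun_pair.
  by rewrite -[X in measurable X]setTI; exact: mUZ.
move: mBad; have -> : [set w | B (U w, (V w, T w, P w))] =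
    [set w | ~ good_pair K ka dl ze (U w *m T w *m V w) (P w)].
  by apply/seteqP; split=> w; rewrite /B /= mulmxA.
move=> mBad bound; rewrite measurable_mu_extE//.
apply: le_trans (bound _) _.
  by move=> [[v t'] p] [/= vu gT gP]; exact: Hlam.
apply: leeD => //.
apply: (@le_trans _ _ (mu_ext Pr ([set w | ~ (V w : 'M[C]_n) \is unitarymx] `|`
    ([set w | ~ goodT (T w)] `|` [set w | ~ goodP (P w)])))).
  apply: le_mu_ext => w /= ngood.
  have [Vw|] := pselect ((V w : 'M[C]_n) \is unitarymx); last by left.
  have [Tw|] := pselect (goodT (T w)); last by right; left.
  by right; right => Pw; apply: ngood; split.
apply: le_trans (mu_extU2 _ _) _.
have V0 : mu_ext Pr [set w | ~ (V w : 'M[C]_n) \is unitarymx] = 0%E.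
  by apply: mu_ext_ae; case: hV.
by rewrite V0 add0e; exact: mu_extU2.
Qed.

End HaarModel.

End Model.

Theorem theorem2p5 (R : realType)
  (d : nat -> measure_display)
  (Omega : forall n, measurableType (d n))
  (Pr : forall n, probability (Omega n) R)
  (* the matrix model: s n w i is the (i+1)-st singular value s_{i+1} *)
  (s : forall n, Omega n -> nat -> R)
  (U T V A P : forall n, Omega n -> cmx R n)
  (s_meas : forall n i, (i < n)%N -> measurable_fun setT (fun w => s n w i))
  (s_ge0 : forall n, {ae Pr n, forall w, forall i, (i < n)%N -> 0 <= s n w i})
  (T_def : forall n w, T n w = diag_mx (\row_(i < n) (s n w i)%:C))
  (U_haar : forall n, haar_unitary (Pr n) (U n))
  (V_haar : forall n, haar_unitary (Pr n) (V n))
  (UV_indep : forall n, independent_rv (Pr n) (U n) (V n))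
  (UVT_indep : forall n,
     independent_rv (Pr n) (fun w => (U n w, V n w)) (T n))
  (A_def : forall n w, A n w = U n w *m T n w *m V n w)
  (* (1) *)
  (b : R) (b_ge0 : 0 <= b)
  (trace_cvg : cvg_in_probability Pr
     (fun n w => n%:R^-1 * \tr (T n w *m T n w)) (b ^+ 2)%:C)
  (* (2) *)
  (M : R) (M_gt0 : 0 < M)
  (T_bounded : (fun n => Pr n [set w | M < opnorm (T n w)]) @ \oo --> 0%E)
  (* (3) *)
  (kappa : R) (kappa_gt0 : 0 < kappa)
  (stieltjes_bounded : forall n, {ae Pr n, forall w, forall z : R[i],
     n%:R `^ (- kappa) < complex.Im z ->
     `|complex.Im (stieltjes (esd_diag n (s n w)) z)| <= kappa^-1})
  (* the perturbation *)
  (r : nat) (C : R)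
  (P_meas : forall n, measurable_fun setT (P n))
  (P_indep : forall n,
     independent_rv (Pr n) (fun w => (U n w, T n w, V n w)) (P n))
  (P_rank : forall n, {ae Pr n, forall w, (\rank (P n w) <= r)%N})
  (P_bounded : forall n, {ae Pr n, forall w, opnorm (P n w) <= C})
  (eps : R) (eps_gt0 : 0 < eps)
  (* r_b(n, w) and the lambda_{i+1}(P_n) *)
  (rb : forall n, Omega n -> nat) (lamP : forall n, Omega n -> nat -> R[i])
  (P_band : \forall n \near \oo, {ae Pr n, forall w, forall z : R[i],
     eigenvalue (P n w) z -> ~ (b + eps < normc z < b + 3 * eps)})
  (P_outer : \forall n \near \oo, {ae Pr n, forall w,
     lists_eigenvalues (P n w) (fun z => b + 3 * eps <= normc z)
       [seq lamP n w i | i <- iota 0 (rb n w)]}) :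
  with_high_probability Pr (fun n => [set w |
    has_nb_eigenvalues (A n w + P n w) (fun z => b + 2 * eps < normc z)
      (rb n w)]) /\
  exists lam : forall n, Omega n -> nat -> R[i],
    with_high_probability Pr (fun n => [set w |
      lists_eigenvalues (A n w + P n w) (fun z => b + 2 * eps < normc z)
        [seq lam n w i | i <- iota 0 (rb n w)]]) /\
    forall i : nat, cvg_in_probability Pr
      (fun n w => if (i < rb n w)%N then lam n w i - lamP n w i else 0) 0.
Proof.
pose Cx := Num.max 0 C.
have Cx0 : 0 <= Cx by rewrite le_max lexx.
(* [E D] contains both the count of the outliers and a displacement below [D], so its high
   probability for each [D] yields every conclusion; [D = 1] is enough for the count. *)
pose E D n w := exists2 m,
  lists_eigenvalues (A n w + P n w) (fun z => b + 2 * eps < normc z) m &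
  all2 (fun c y => normc (y - c) < D) [seq lamP n w i | i <- iota 0 (rb n w)] m.
have T_meas n : measurable_fun setT (T n).
  apply/cmxP => i j; have -> : (fun w => T n w i j) = (fun w => (s n w i)%:C *+ (i == j)).
    by apply/funext => w; rewrite T_def !mxE.
  case: (i == j).
    split; first exact: s_meas.
    exact: measurable_cst.
  by split; exact: measurable_cst.
(* Condition (2) speaks of the measure itself, so its event must be measurable before it is bounded
   by an outer measure. *)
have T_large n : measurable [set w | M < opnorm (T n w)].
  rewrite (_ : [set w | _] = \bigcup_(i in [set: 'I_n]) [set w | M < `|s n w i|]).
    apply: fin_bigcup_measurable => // i _; apply: measurable_gt.
    by apply: measurableT_comp => //; exact: s_meas.
  apply/seteqP; split=> w /=.
    rewrite ltNge => /negP h; apply: contrapT => nex; apply: h; rewrite T_def.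
    apply/(opnorm_diag_le (fun i => s n w i) (ltW M_gt0)) => i.
    by rewrite leNgt; apply/negP => hi; apply: nex; exists i.
  move=> [i _ /= hi]; rewrite ltNge; apply/negP; rewrite T_def.
  by move=> /(opnorm_diag_le (fun i => s n w i) (ltW M_gt0))/(_ i); rewrite leNgt hi.
have high D : 0 < D -> forall t : R, 0 < t -> exists N, forall n, (N <= n)%N ->
    (mu_ext (Pr n) [set w | ~ E D n w] <= t%:E)%E.
  (* One third each for the Haar estimate, the trace and the norm of [T]; the exceptional events of
     [P] have outer measure zero. *)
  move=> D0 t t0; have t3 : 0 < t / 3 by rewrite divr_gt0.
  have [dl dl0 outl] := good_pair_outliers r b_ge0 eps_gt0 Cx0 D0.
  have [be [ze [M1 [g [K [g0 ze0 zeb Hhaar]]]]]] :=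
    haar_good_pair r b_ge0 eps_gt0 M_gt0 Cx0 dl0.
  have [N1 H1] := Hhaar _ t3.
  have tr_cvg := trace_cvg g g0.
  have [|N2 H2] := (cvg_to_0eP _).1 tr_cvg _ t3; first by move=> n; exact: mu_ext_ge0.
  have [|N3 H3] := (cvg_to_0eP _).1 T_bounded _ t3; first by move=> n; exact: measure_ge0.
  have [N4 _ H4] := P_band; have [N5 _ H5] := P_outer.
  exists (N1 + N2 + N3 + N4 + N5).+1 => n nN.
  have n0 : (0 < n)%N by clear -nN; lia.
  have [leN1 leN2 leN3 leN4 leN5] : [/\ N1 <= n, N2 <= n, N3 <= n, N4 <= n & N5 <= n]%N.
    by clear -nN; split; lia.
  have [kaK Hn] := H1 n leN1.
  pose goodT (S : 'M[R[i]]_n) := opnorm S <= M /\ nsq S <= n%:R * (b ^+ 2 + g).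
  pose goodP (S : 'M[R[i]]_n) := (\rank S <= r)%N /\ opnorm S <= Cx.
  pose ka := n%:R * M1 * be ^+ K n.
  have bound := haar_model_bound (K := K n) (ka := ka) (dl := dl) (ze := ze)
    (goodT := goodT) (goodP := goodP) (U_haar n) (V_haar n) (T_meas n) (P_meas n)
    (UV_indep n) (UVT_indep n) (P_indep n) (ltW t3).
  have good_bound : (mu_ext (Pr n) [set w | ~ goodT (T n w)] <= (t / 3 + t / 3)%:E)%E.
    apply: (@le_trans _ _ (mu_ext (Pr n) ([set w | M < opnorm (T n w)] `|`
      [set w | g <= normc (n%:R^-1 * \tr (T n w *m T n w) - (b ^+ 2)%:C)]))).
      apply: le_mu_ext => w /= ngood.
      have [TM|] := leP (opnorm (T n w)) M; last by left.
      right; rewrite leNgt; apply/negP => lt; apply: ngood; split=> //.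
      rewrite T_def; set x := fun i : 'I_n => s n w i.
      move: lt; rewrite T_def (trace_diag_sqr x); set y := nsq _.
      have -> : n%:R^-1 * y%:C - (b ^+ 2)%:C = (n%:R^-1 * y - b ^+ 2)%:C.
        rewrite (rmorphB (real_complex R)) (rmorphM (real_complex R) n%:R^-1).
        by rewrite (fmorphV (real_complex R)) (rmorph_nat (real_complex R)).
      rewrite normc_real => /ltr_normlW; rewrite ltrBlDr addrC => /ltW.
      by rewrite ler_pdivrMl ?ltr0n.
    apply: le_trans (mu_extU2 _ _ _) _; rewrite EFinD; apply: leeD; last exact: H2.
    by rewrite measurable_mu_extE//; exact: H3.
  pose Q w := [/\ goodP (P n w),
    forall z : R[i], eigenvalue (P n w) z -> ~ (b + eps < normc z < b + 3 * eps) &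
    lists_eigenvalues (P n w) (fun z => b + 3 * eps <= normc z)
      [seq lamP n w i | i <- iota 0 (rb n w)]].
  have P_good : {ae Pr n, forall w, goodP (P n w)}.
    apply: (@filterS2 _ _ (ae_filter_ringOfSetsType (Pr n)) _ _ _ _ (P_rank n) (P_bounded n)).
    by move=> w rP PC; split=> //; rewrite le_max PC orbT.
  have Q0 : mu_ext (Pr n) [set w | ~ Q w] = 0%E.
    apply: mu_ext_ae.
    apply: (@filterS3 _ _ (ae_filter_ringOfSetsType (Pr n)) _ _ _ _ _ P_good (H4 n leN4)
      (H5 n leN5)).
    by move=> w; split.
  apply: (@le_trans _ _ (mu_ext (Pr n)
      ([set w | ~ good_pair (K n) ka dl ze (U n w *m T n w *m V n w) (P n w)] `|`
       [set w | ~ Q w]))).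
    apply: le_mu_ext => w /= nE.
    have [[[rP PC] band outer]|] := pselect (Q w); last by right.
    left => gp; apply: nE; rewrite /E A_def.
    exact: outl ze0 zeb kaK rP PC band gp _ outer.
  apply: le_trans (mu_extU2 _ _ _) _; rewrite Q0 adde0.
  apply: le_trans (bound _) _.
    move=> T' V' P' lam [TM Tt] Vu [rP PC] lam0.
    have [S1 S2 S3] := unitary_model_bounds Vu TM.
    by apply: Hn => //; rewrite S2.
  rewrite (mu_ext_ae P_good) adde0; apply: le_trans (leeD (lexx _) good_bound) _.
  by rewrite -EFinD lee_fin; lra.
have mono n D1 (X : set (Omega n)) : (forall w, E D1 n w -> X w) ->
    (mu_ext (Pr n) (~` X) <= mu_ext (Pr n) [set w | ~ E D1 n w])%E.
  by move=> EX; apply: le_mu_ext => w /= nX /EX.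
(* The labelling is chosen before [D], since one labelling must serve all precisions. It is chosen
   separately for each [w], which the outer probabilities allow. *)
have lab n w : exists f : nat -> R[i], forall D, 0 < D -> E D n w ->
    lists_eigenvalues (A n w + P n w) (fun z => b + 2 * eps < normc z)
      [seq f i | i <- iota 0 (rb n w)] /\
    forall i, (i < rb n w)%N -> normc (f i - lamP n w i) < D.
  set l := [seq lamP n w i | i <- iota 0 (rb n w)].
  have sl : size l = rb n w by rewrite size_map size_iota.
  have [m0 Hm0] := best_labeling l (fun m m' => @lists_eigenvalues_perm R n
    (A n w + P n w) (fun z => b + 2 * eps < normc z) m m').
  exists (nth 0 m0) => D D0 /(Hm0 D D0)[Qm]; rewrite all2E sl => /andP[/eqP sm am].
  split; first by rewrite sm -/(mkseq _ _) mkseq_nth.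
  move=> i il; have iz : (i < size (zip l m0))%N by rewrite size_zip sl -sm minnn.
  have := allP am _ (mem_nth (0, 0) iz).
  by rewrite nth_zip ?sl//= (nth_map 0%N) ?size_iota// nth_iota.
split.
  apply/cvg_to_0eP => [n|t t0]; first exact: mu_ext_ge0.
  have [N HN] := high 1 ltr01 t t0; exists N => n /HN; apply: le_trans.
  apply: mono => w [m Qm]; rewrite all2E size_map size_iota => /andP[/eqP sm _].
  by exists m.
exists (fun n w => sval (cid (lab n w))); split.
  apply/cvg_to_0eP => [n|t t0]; first exact: mu_ext_ge0.
  have [N HN] := high 1 ltr01 t t0; exists N => n /HN; apply: le_trans.
  by apply: mono => w /= Ew; have [] := svalP (cid (lab n w)) 1 ltr01 Ew.
move=> i D D0; apply/cvg_to_0eP => [n|t t0]; first exact: mu_ext_ge0.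
have [N HN] := high D D0 t t0; exists N => n /HN; apply: le_trans.
apply: le_mu_ext => w /= Dw Ew; move: Dw; rewrite leNgt subr0 => /negP; apply.
case: ifPn => [ir|_]; last by rewrite normc0.
by have [_] := svalP (cid (lab n w)) D D0 Ew; apply.
Qed.
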